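(* Let $k\ge2$ and let $\Gamma<\mathrm{SL}(k+1,\mathbb R)$ be a projective Anosov subgroup. Then $$\delta_{1,k+1}\ \le\ \dim_{Haus}^{Riem}\big(\xi^1(\partial_\infty\Gamma)\big)\ \le\ \dim\mathbb{R}P^k=k .$$
   Context: For $g\in\mathrm{SL}(k+1,\mathbb R)$ let $\sigma_1(g)\ge\dots\ge\sigma_{k+1}(g)$ be the logarithms of the singular values of $g$. A subgroup $\Gamma<\mathrm{SL}(k+1,\mathbb R)$ is projective Anosov if it is Anosov with respect to the parabolic stabilizing a partial flag (line $\subset$ hyperplane) in $\mathbb R^{k+1}$; equivalently, $\Gamma$ is discrete, finitely generated, the orbit maps of $\Gamma$ (with a word metric) into the symmetric space $\mathrm{SL}(k+1,\mathbb R)/\mathrm{SO}(k+1)$ are quasiisometric embeddings, and for every sequence of distinct $\gamma_n\in\Gamma$ one has $\liminf_n \min\{\sigma_1-\sigma_2,\sigma_k-\sigma_{k+1}\}(\gamma_n)/\|(\sigma_1,\dots,\sigma_{k+1})(\gamma_n)\|>0$. Such $\Gamma$ is word-hyperbolic with Gromov boundary $\partial_\infty\Gamma$, and there is a $\Gamma$-equivariant embedding of $\partial_\infty\Gamma$ onto the limit set of $\Gamma$ in the flag manifold of pairs (line $\subset$ hyperplane); $\xi^1:\partial_\infty\Gamma\to\mathbb{R}P^k$ is its composition with the projection (line, hyperplane) $\mapsto$ line. The Hilbert critical exponent is $\delta_{1,k+1}=\limsup_{r\to\infty}\frac{\log\mathrm{card}\{\gamma\in\Gamma:\sigma_1(\gamma)-\sigma_{k+1}(\gamma)<r\}}{r}$.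 $\dim_{Haus}^{Riem}$ denotes Hausdorff dimension with respect to a Riemannian metric on $\mathbb{R}P^k$. *)

(* Defs.v *)
From HB Require Import structures.
From mathcomp Require Import all_boot all_order all_algebra.
From mathcomp Require Import all_classical all_reals all_analysis.

Set Implicit Arguments.
Unset Strict Implicit.
Unset Printing Implicit Defensive.

Import Order.TTheory GRing.Theory Num.Theory.
Import numFieldNormedType.Exports.

Local Open Scope classical_set_scope.
Local Open Scope ring_scope.

Section SingularValues.
Context {R : realType} {k : nat}.
Implicit Types (g U V : 'M[R]_k.+1) (s : 'rV[R]_k.+1).

Definition is_svd g U V s : Prop :=
  [/\ U *m U^T = 1%:M, V *m V^T = 1%:M,
      (forall i, 0 <= s 0 i),
      (forall i j : 'I_k.+1, (i <= j)%N -> s 0 j <= s 0 i)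
    & g = U *m diag_mx s *m V^T].

(* Every matrix has a singular value decomposition and [s] is determined by
   [g], so the default value of [xget] is never used. *)
Definition singular_values g : 'rV[R]_k.+1 :=
  xget 0 [set s | exists U V, is_svd g U V s].

(* Numbered from 1: [sigma 1 g >= ... >= sigma k.+1 g]. *)
Definition sigma (i : nat) g : R := ln (singular_values g 0 (inord i.-1)).

Definition sigma_norm g : R :=
  Num.sqrt (\sum_(1 <= i < k.+2) (sigma i g) ^+ 2).

(* Smallest of the two simple-root gaps attached to (line, hyperplane). *)
Definition sigma_gap g : R :=
  Num.min (sigma 1 g - sigma 2 g) (sigma k g - sigma k.+1 g).

End SingularValues.

Section Groups.
Context {R : realType} {k : nat}.
Local Notation M := 'M[R]_k.+1.
Implicit Types (Gam : set M) (S : seq M).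

Definition SL_subgroup Gam : Prop :=
  [/\ (forall g, Gam g -> \det g = 1), Gam 1,
      (forall g h, Gam g -> Gam h -> Gam (g * h))
    & (forall g, Gam g -> Gam g^-1)].

Definition discrete_in_matrices Gam : Prop :=
  forall g, Gam g -> \forall h \near g, Gam h -> h = g.

Definition is_word S (w : seq M) : bool :=
  all (fun a => (a \in S) || (a^-1 \in S)) w.

Definition generates Gam S : Prop :=
  (forall a, a \in S -> Gam a) /\
  (forall g, Gam g -> exists2 w, is_word S w & \prod_(a <- w) a = g).

Definition word_length S (g : M) : R :=
  inf [set r | exists2 w, is_word S w & \prod_(a <- w) a = g /\ r = (size w)%:R].

Definition word_dist S (g h : M) : R := word_length S (g^-1 * h).

(* The distance of the symmetric space SL(k+1,R)/SO(k+1) between the cosets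
   of [g] and [h]; an invariant Riemannian metric on this space is unique up to
   a constant factor, which does not matter for quasiisometric embeddings. *)
Definition symspace_dist (g h : M) : R := sigma_norm (g^-1 * h).

Definition orbit_map_qi_embedding Gam S (x : M) : Prop :=
  exists L C : R, [/\ 1 <= L, 0 <= C &
    forall g h, Gam g -> Gam h ->
      L^-1 * word_dist S g h - C <= symspace_dist (g * x) (h * x) /\
      symspace_dist (g * x) (h * x) <= L * word_dist S g h + C].

Definition projective_anosov Gam : Prop :=
  [/\ discrete_in_matrices Gam,
      (exists2 S, generates Gam S &
         forall x : M, \det x = 1 -> orbit_map_qi_embedding Gam S x)
    & (forall gam : nat -> M, injective gam -> (forall n, Gam (gam n)) ->
         (0 < limn_einf (fun n =>
                (sigma_gap (gam n) / sigma_norm (gam n))%:E))%E)].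

Definition hilbert_critical_exponent Gam : \bar R :=
  limf_esup (fun r : R =>
    lne (counting [set g | Gam g /\ (sigma 1 g - sigma k.+1 g < r)%R])
      * (r^-1)%:E)%E (pinfty_nbhs R).

End Groups.

(* A boundary point is an equivalence class, represented as a set of sequences of
group elements converging to infinity.  The sets [shadow Gam S p r], [r : R],
form a basis of neighborhoods of [p] for the topology of the boundary of a
word-hyperbolic group. *)
Section GromovBoundary.
Context {R : realType} {k : nat}.
Local Notation M := 'M[R]_k.+1.
Implicit Types (Gam : set M) (S : seq M) (x y : nat -> M).

Definition gromov_product S (g h : M) : R :=
  (word_dist S 1 g + word_dist S 1 h - word_dist S g h) / 2.

Definition gromov_equiv S x y : Prop :=
  forall r : R, exists N : nat, forall i j : nat,
    (N <= i)%N -> (N <= j)%N -> r <= gromov_product S (x i) (y j).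

Definition conv_to_infinity Gam S x : Prop :=
  (forall n, Gam (x n)) /\ gromov_equiv S x x.

Definition boundary_class Gam S x : set (nat -> M) :=
  [set y | conv_to_infinity Gam S y /\ gromov_equiv S x y].

Definition gromov_boundary Gam S : set (set (nat -> M)) :=
  [set boundary_class Gam S x | x in conv_to_infinity Gam S].

Definition boundary_act (g : M) (p : set (nat -> M)) : set (nat -> M) :=
  [set (fun n => g * x n) | x in p].

(* There are representatives with liminf of the Gromov products >= r. *)
Definition shadow Gam S (p : set (nat -> M)) (r : R) : set (set (nat -> M)) :=
  [set q | gromov_boundary Gam S q /\
     exists x y, [/\ p x, q y &
       forall e : R, 0 < e -> exists N : nat, forall i j : nat,
         (N <= i)%N -> (N <= j)%N -> r - e <= gromov_product S (x i) (y j)]].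

End GromovBoundary.

Section Flags.
Context (R : realType) (k : nat).

Definition proj_space := {L : {vspace 'cV[R]_k.+1} | \dim L == 1%N}.

Definition flag :=
  {F : {vspace 'cV[R]_k.+1} * {vspace 'cV[R]_k.+1}
  | [&& \dim F.1 == 1%N, \dim F.2 == k & (F.1 <= F.2)%VS]}.

Definition flag_line (F : flag) : proj_space :=
  exist _ (val F).1 (proj1 (andP (valP F))).

End Flags.

Section LimitSet.
Context {R : realType} {k : nat}.
Local Notation M := 'M[R]_k.+1.
Local Notation VS := {vspace 'cV[R]_k.+1}.
Implicit Types (Gam : set M) (S : seq M) (g : M).

Definition lin_act g : 'End('cV[R]_k.+1) :=
  linfun (mulmx g : 'cV[R]_k.+1 -> 'cV[R]_k.+1).

(* Matrix of the orthogonal projection onto W. *)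
Definition orthproj (W : VS) : M :=
  xget 0 [set P | [/\ P^T = P, P *m P = P & limg (lin_act P) = W]].

(* A distance inducing the usual topology of the flag manifold. *)
Definition flag_dist (F F' : flag R k) : R :=
  `|orthproj (val F).1 - orthproj (val F').1|
  + `|orthproj (val F).2 - orthproj (val F').2|.

(* With g = U diag(s) V^T: the line spanned by the first column of U and the
   hyperplane spanned by its first k columns.  The flag is unique as soon as
   [0 < sigma_gap g]. *)
Definition cartan_flag g (F : flag R k) : Prop :=
  exists U V s, [/\ is_svd g U V s,
    (val F).1 = <[col ord0 U]>%VS
  & (val F).2 = (\sum_(i < k.+1 | (i < k)%N) <[col i U]>)%VS].

(* Limits of the Cartan flags of regular sequences (those whose gaps tend to
   infinity). *)
Definition limit_set Gam : set (flag R k) :=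
  [set F | exists (gam : nat -> M) (Fn : nat -> flag R k),
     [/\ (forall n, Gam (gam n)),
         sigma_gap (gam n) @[n --> \oo] --> +oo,
         (forall n, cartan_flag (gam n) (Fn n))
       & flag_dist (Fn n) F @[n --> \oo] --> (0 : R)]].

(* [xi] restricts to a Gam-equivariant topological embedding of the Gromov
   boundary onto the limit set; its values elsewhere are irrelevant. *)
Definition boundary_embedding Gam S (xi : set (nat -> M) -> flag R k) : Prop :=
  let bd := gromov_boundary Gam S in
  [/\ (forall g p, Gam g -> bd p ->
         (val (xi (boundary_act g p))).1 = (lin_act g @: (val (xi p)).1)%VS /\
         (val (xi (boundary_act g p))).2 = (lin_act g @: (val (xi p)).2)%VS),
      {in bd &, injective xi},
      (forall p, bd p -> forall e : R, 0 < e ->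
         exists r, forall q, shadow Gam S p r q -> flag_dist (xi q) (xi p) < e),
      (forall p, bd p -> forall r : R, exists2 e : R, 0 < e &
         forall q, bd q -> flag_dist (xi q) (xi p) < e -> shadow Gam S p r q)
    & xi @` bd = limit_set Gam].

Definition xi1 (xi : set (nat -> M) -> flag R k) (p : set (nat -> M)) :
    proj_space R k :=
  flag_line (xi p).

End LimitSet.

(* A Riemannian metric on RP^k is encoded by its pullback under the submersion
R^{k+1} \ {0} -> RP^k, u |-> R u: a smooth field h of symmetric bilinear forms
(v, w) |-> v^T h(u) w, invariant under u |-> a u, and whose kernel at u is
exactly the line R u. *)
Section Riemannian.
Context {R : realType} {k : nat}.
Local Notation V := 'cV[R]_k.+1.
Local Notation M := 'M[R]_k.+1.

Fixpoint iter_derive (vs : seq V) (h : V -> M) : V -> M :=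
  if vs is v :: vs' then fun u => 'D_v (iter_derive vs' h) u else h.

Definition smooth_off0 (h : V -> M) : Prop :=
  forall (vs : seq V) (u : V), u != 0 ->
    {for u, continuous (iter_derive vs h)} /\
    forall v : V, derivable (iter_derive vs h) u v.

Definition riemannian_metric (h : V -> M) : Prop :=
  smooth_off0 h /\
  forall u : V, u != 0 ->
    [/\ (h u)^T = h u,
        (forall a : R, a != 0 -> h (a *: u) = a ^- 2 *: h u),
        h u *m u = 0
      & (forall v : V, v \notin <[u]>%VS -> 0 < (v^T *m h u *m v) 0 0)].

(* C^1 curves in R^{k+1} \ {0}, parametrized by [0, 1]; every C^1 curve in
   RP^k lifts to such a curve. *)
Definition C1_curve (c : R -> V) : Prop :=
  [/\ (forall t, derivable c t 1), continuous (derive1 c)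
    & (forall t, 0 <= t <= 1 -> c t != 0)].

Definition curve_length (h : V -> M) (c : R -> V) : R :=
  \int[@lebesgue_measure R]_(t in `[0, 1])
     Num.sqrt (((derive1 c t)^T *m h (c t) *m derive1 c t) 0 0).

Definition riem_dist (h : V -> M) (L L' : proj_space R k) : R :=
  inf [set l | exists c, [/\ C1_curve c, c 0 \in val L, c 1 \in val L'
                           & l = curve_length h c]].

End Riemannian.

Section Hausdorff.
Context {R : realType} {X : Type} (d : X -> X -> R).
Local Open Scope ereal_scope.

(* The diameter of the empty set is 0. *)
Definition diam (U : set X) : \bar R :=
  maxe 0 (ereal_sup [set (d z.1 z.2)%:E | z in U `*` U]).

Definition hausdorff_premeasure (s e : R) (A : set X) : \bar R :=
  ereal_inf [set \sum_(0 <= i <oo) (diam (U i) `^ s) | U in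
    [set U : nat -> set X |
      A `<=` \bigcup_i U i /\ forall i, diam (U i) <= e%:E]].

Definition hausdorff_measure (s : R) (A : set X) : \bar R :=
  ereal_sup [set hausdorff_premeasure s e A | e in [set e : R | (0 < e)%R]].

Definition hausdorff_dim (A : set X) : \bar R :=
  ereal_inf [set s%:E | s in
    [set s : R | (0 < s)%R /\ hausdorff_measure s A = 0]].

End Hausdorff.

(* Main.v *)
Require Import Defs.
From HB Require Import structures.
From mathcomp Require Import all_boot all_order all_algebra.
From mathcomp Require Import all_classical all_reals all_analysis.
From mathcomp Require Import perm ring lra zify.
Import Order.TTheory GRing.Theory Num.Theory.
Import numFieldNormedType.Exports.
Local Open Scope classical_set_scope.
Local Open Scope ring_scope.

(** The boundary embedding identifies the set in the theorem with the set of lines of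
the flags in the limit set, so the proof takes place in projective space.

The upper bound holds for every subset of projective space: the k + 1 standard
charts are cut into about [N ^ k] small cubes each, whose Riemannian diameter is of
order [1 / N].

For the lower bound write [omega g] for [sigma 1 g - sigma k.+1 g], the logarithm of
the product of the operator norms of [g] and its inverse.  It is enough to see that
a cover of the limit lines by sets whose
diameters have a very small sum of [s]-th powers makes the Poincare series
[\sum_g expR (- s * omega g)] converge ([poincare_bound]), since this bounds the
number of elements with [omega g < r] by a multiple of [expR (s * r)]
([omega_count]).

Let a set of the cover have diameter about [rho] and contain the limit line of [x].
Choose a group element [g] with [omega g] about [ln rho^-1] on the way from the
identity to [x].  At a line which it attracts strongly, [g] shrinks distances by at
most the factor [expR (- omega g)].  Hence a long element [gam] whose top singular
line is in the given set is mapped by [g^-1] to an element whose top singular line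
is transverse to the hyperplane that [g] contracts, and therefore
[omega gam >= omega g + omega (g^-1 * gam) - A] with a constant [A]
([limit_shadow]).  By compactness of the limit set, finitely many elements [g_i],
one for each of finitely many sets of the cover, handle in this way all elements of
the group except finitely many ([finite_shadow_cover]).  The series is thus bounded
by a constant plus its product with a multiple of the small sum of [rho_i `^ s],
which is at most one half.

Two facts on norms of products carry the choice of [g] and the inequality for
[omega].  Along a product of bounded matrices all of whose segments are
exponentially close to rank one, the operator norm is multiplicative up to a
constant factor ([dominated_tau_ge]); for geodesic words in an Anosov group the
assumption holds because the gap of singular values grows linearly with word length
([gap_ge_length]).  And if the norm of [g * h] is comparable to the product of the
norms, the geodesic words for [g] and [h] form together a quasigeodesic, so that the
same holds for the inverse elements ([omega_superadd]).

Finally, Riemannian distances are bounded below by a multiple of the chordal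
distance, by integrating the derivative of [c / |c|] along a lift [c] of a curve
([curve_length_ge]). *)

Set Implicit Arguments.
Unset Strict Implicit.
Unset Printing Implicit Defensive.

(** * Euclidean norm and operator norm *)

Section Euclid.
Context {R : realType}.

Definition dot n (u v : 'cV[R]_n) : R := (u^T *m v) 0 0.
Definition enorm n (u : 'cV[R]_n) : R := Num.sqrt (dot u u).

Section vec.
Variable n : nat.
Implicit Types (u v w : 'cV[R]_n) (a : R).

Lemma dotE u v : dot u v = \sum_i u i 0 * v i 0.
Proof. by rewrite /dot !mxE; apply: eq_bigr => i _; rewrite !mxE. Qed.

Lemma dotC u v : dot u v = dot v u.
Proof. by rewrite !dotE; apply: eq_bigr => i _; rewrite mulrC. Qed.

Lemma dotDr u v w : dot u (v + w) = dot u v + dot u w.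
Proof. by rewrite /dot mulmxDr mxE. Qed.

Lemma dotZr a u v : dot u (a *: v) = a * dot u v.
Proof. by rewrite /dot -scalemxAr mxE. Qed.

Lemma dotNr u v : dot u (- v) = - dot u v.
Proof. by rewrite -scaleN1r dotZr mulN1r. Qed.

Lemma dotBr u v w : dot u (v - w) = dot u v - dot u w.
Proof. by rewrite dotDr dotNr. Qed.

Lemma dotDl u v w : dot (u + v) w = dot u w + dot v w.
Proof. by rewrite dotC dotDr !(dotC w). Qed.

Lemma dotZl a u v : dot (a *: u) v = a * dot u v.
Proof. by rewrite dotC dotZr dotC. Qed.

Lemma dotNl u v : dot (- u) v = - dot u v.
Proof. by rewrite dotC dotNr dotC. Qed.

Lemma dotBl u v w : dot (u - v) w = dot u w - dot v w.
Proof. by rewrite dotDl dotNl. Qed.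

Lemma dot0r u : dot u 0 = 0.
Proof. by rewrite /dot mulmx0 mxE. Qed.

Lemma dot_ge0 u : 0 <= dot u u.
Proof. by rewrite dotE sumr_ge0 // => i _; rewrite -expr2 sqr_ge0. Qed.

Lemma dot_eq0 u : (dot u u == 0) = (u == 0).
Proof.
apply/idP/eqP => [|->]; last by rewrite dot0r.
rewrite dotE psumr_eq0 => [/allP u0|i _]; last by rewrite -expr2 sqr_ge0.
apply/colP => i; rewrite mxE.
by have := u0 i; rewrite mem_index_enum mulf_eq0 orbb => /(_ isT) /eqP.
Qed.

Lemma enorm_ge0 u : 0 <= enorm u. Proof. exact: sqrtr_ge0. Qed.

Lemma enorm_sqr u : enorm u ^+ 2 = dot u u.
Proof. by rewrite sqr_sqrtr // dot_ge0. Qed.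

Lemma enorm_eq0 u : (enorm u == 0) = (u == 0).
Proof. by rewrite -dot_eq0 -enorm_sqr sqrf_eq0. Qed.

Lemma enorm_gt0 u : (0 < enorm u) = (u != 0).
Proof. by rewrite lt_def enorm_ge0 andbT enorm_eq0. Qed.

Lemma enorm0 : enorm (0 : 'cV[R]_n) = 0.
Proof. by apply/eqP; rewrite enorm_eq0. Qed.

Lemma enormZ a u : enorm (a *: u) = `|a| * enorm u.
Proof.
by rewrite /enorm dotZl dotZr mulrA -expr2 sqrtrM ?sqr_ge0 // sqrtr_sqr.
Qed.

Lemma enormN u : enorm (- u) = enorm u.
Proof. by rewrite -scaleN1r enormZ normrN1 mul1r. Qed.

Lemma cauchy_schwarz u v : `|dot u v| <= enorm u * enorm v.
Proof.
have [->|v0] := eqVneq v 0; first by rewrite dot0r normr0 mulr_ge0 ?enorm_ge0.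
rewrite -(@ler_pXn2r _ 2) ?nnegrE ?mulr_ge0 ?enorm_ge0 // exprMn !enorm_sqr.
rewrite real_normK ?num_real //.
have vv : 0 < dot v v by rewrite lt_def dot_eq0 v0 dot_ge0.
have := dot_ge0 (dot v v *: u - dot u v *: v).
rewrite !(dotBl, dotBr, dotZl, dotZr) (dotC v u) => h.
have -> : dot u v ^+ 2 = dot u v * dot u v by rewrite expr2.
rewrite -(ler_pM2l vv) -subr_ge0; apply: le_trans h _.
by rewrite le_eqVlt; apply/orP; left; apply/eqP; ring.
Qed.

Lemma enormD u v : enorm (u + v) <= enorm u + enorm v.
Proof.
rewrite -(@ler_pXn2r _ 2) ?nnegrE ?addr_ge0 ?enorm_ge0 //.
rewrite sqrrD !enorm_sqr !(dotDl, dotDr) (dotC v u).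
have := le_trans (ler_norm _) (cauchy_schwarz u v).
by rewrite mulr2n; lra.
Qed.

Lemma enorm_distC u v : enorm (u - v) = enorm (v - u).
Proof. by rewrite -enormN opprB. Qed.

Lemma enorm_coord u i : `|u i 0| <= enorm u.
Proof.
rewrite -(@ler_pXn2r _ 2) ?nnegrE ?enorm_ge0 // enorm_sqr dotE.
rewrite real_normK ?num_real // (bigD1 i) //= -expr2 lerDl sumr_ge0 // => j _.
by rewrite -expr2 sqr_ge0.
Qed.

Lemma enorm_le_sum u : enorm u <= \sum_i `|u i 0|.
Proof.
rewrite -(@ler_pXn2r _ 2) ?nnegrE ?enorm_ge0 ?sumr_ge0 // enorm_sqr dotE expr2.
rewrite big_distrl /=; apply: ler_sum => i _.
rewrite -expr2 -real_normK ?num_real // expr2 ler_wpM2l //.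
by rewrite (bigD1 i) //= lerDl sumr_ge0.
Qed.

End vec.

(** Moves a matrix across the inner product, which is how all facts about
transposes below are obtained. *)
Lemma dot_mulmx m n (A : 'M[R]_(m, n)) u v : dot u (A *m v) = dot (A^T *m u) v.
Proof. by rewrite /dot trmx_mul trmxK mulmxA. Qed.

Lemma mulmx_dot m n (u : 'cV[R]_m) (v w : 'cV[R]_n) :
  u *m v^T *m w = dot v w *: u.
Proof.
rewrite -mulmxA [v^T *m w]mx11_scalar -/(dot v w) scalar_mxC.
by rewrite mul_scalar_mx.
Qed.

Definition opnorm m n (A : 'M[R]_(m, n)) : R :=
  sup [set enorm (A *m w) | w in [set w | enorm w <= 1]].

Section opnorm.
Variables m n : nat.
Implicit Types (A B : 'M[R]_(m, n)).

Let opset A := [set enorm (A *m w) | w in [set w | enorm w <= 1]].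

Lemma mulmx_enorm_bounded A w :
  enorm (A *m w) <= (\sum_i \sum_j `|A i j|) * enorm w.
Proof.
apply: le_trans (enorm_le_sum _) _.
rewrite big_distrl; apply: ler_sum => i _ /=.
rewrite mxE; apply: le_trans (ler_norm_sum _ _ _) _.
rewrite big_distrl; apply: ler_sum => j _ /=.
by rewrite normrM ler_wpM2l // enorm_coord.
Qed.

Let opset_ub A : has_ubound (opset A).
Proof.
exists (\sum_i \sum_j `|A i j|) => _ [w /= w1 <-].
apply: le_trans (mulmx_enorm_bounded A w) _.
by rewrite ler_piMr // sumr_ge0 // => i _; rewrite sumr_ge0.
Qed.

Let opset0 A : opset A !=set0.
Proof. by exists 0, 0; rewrite /= ?mulmx0 enorm0 ?ler01. Qed.

Lemma enorm_mulmx A w : enorm (A *m w) <= opnorm A * enorm w.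
Proof.
have [->|w0] := eqVneq w 0; first by rewrite mulmx0 !enorm0 mulr0.
have nw : 0 < enorm w by rewrite enorm_gt0.
rewrite -ler_pdivrMr //.
apply: (ub_le_sup (opset_ub A)); exists ((enorm w)^-1 *: w) => /=.
  by rewrite enormZ ger0_norm ?invr_ge0 ?enorm_ge0 // mulVf ?gt_eqF.
by rewrite -scalemxAr enormZ ger0_norm ?invr_ge0 ?enorm_ge0 // mulrC.
Qed.

Lemma opnorm_le A b :
  0 <= b -> (forall w, enorm (A *m w) <= b * enorm w) -> opnorm A <= b.
Proof.
move=> b0 Ab; apply: (ge_sup (opset0 A)) => _ [w /= w1 <-].
by apply: le_trans (Ab w) _; rewrite ler_piMr.
Qed.

Lemma opnorm_ge0 A : 0 <= opnorm A.
Proof.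
by apply: (ub_le_sup (opset_ub A)); exists 0; rewrite /= ?mulmx0 enorm0 ?ler01.
Qed.

Lemma opnorm_eq0 A : opnorm A = 0 -> A = 0.
Proof.
move=> A0; apply/matrixP => i j; rewrite mxE.
have := enorm_mulmx A (delta_mx j 0); rewrite A0 mul0r => h.
have := enorm_coord (A *m delta_mx j 0) i; rewrite -colE mxE => h'.
by apply/eqP; rewrite -normr_le0; move: h; rewrite -colE; exact: le_trans.
Qed.

Lemma opnormD A B : opnorm (A + B) <= opnorm A + opnorm B.
Proof.
apply: opnorm_le => [|w]; first by rewrite addr_ge0 ?opnorm_ge0.
rewrite mulmxDl mulrDl; apply: le_trans (enormD _ _) _.
by rewrite lerD ?enorm_mulmx.
Qed.

Lemma opnormZ a A : opnorm (a *: A) = `|a| * opnorm A.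
Proof.
have le1 b B : opnorm (b *: B) <= `|b| * opnorm B.
  apply: opnorm_le => [|w]; first by rewrite mulr_ge0 ?opnorm_ge0.
  by rewrite -scalemxAl enormZ -mulrA ler_wpM2l // enorm_mulmx.
apply/le_anti; rewrite le1 /=.
have [->|a0] := eqVneq a 0; first by rewrite normr0 mul0r opnorm_ge0.
rewrite -ler_pdivlMl ?normr_gt0 // -normfV.
by apply: le_trans (le1 a^-1 _); rewrite scalerA mulVf // scale1r.
Qed.

Lemma opnormN A : opnorm (- A) = opnorm A.
Proof. by rewrite -scaleN1r opnormZ normrN1 mul1r. Qed.

Lemma opnorm_dist A B : `|opnorm A - opnorm B| <= opnorm (A - B).
Proof.
rewrite ler_norml lerBrDr; apply/andP; split.
  have := opnormD (- (A - B)) A; rewrite opprB subrK -(opnormN (B - A)) opprB.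
  by lra.
by have := opnormD (A - B) B; rewrite subrK; lra.
Qed.

End opnorm.

Lemma opnormM m n p (A : 'M[R]_(m, n)) (B : 'M[R]_(n, p)) :
  opnorm (A *m B) <= opnorm A * opnorm B.
Proof.
apply: opnorm_le => [|w]; first by rewrite mulr_ge0 ?opnorm_ge0.
rewrite -mulmxA; apply: le_trans (enorm_mulmx _ _) _.
by rewrite -mulrA ler_wpM2l ?opnorm_ge0 // enorm_mulmx.
Qed.

Lemma opnorm_tr m n (A : 'M[R]_(m, n)) : opnorm A^T = opnorm A.
Proof.
have le1 p q (B : 'M[R]_(p, q)) : opnorm B^T <= opnorm B.
  apply: opnorm_le => [|w]; first exact: opnorm_ge0.
  have [->|Bw0] := eqVneq (B^T *m w) 0.
    by rewrite enorm0 mulr_ge0 ?opnorm_ge0 ?enorm_ge0.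
  rewrite -(@ler_pM2l _ (enorm (B^T *m w))) ?enorm_gt0 //.
  rewrite -expr2 enorm_sqr -dot_mulmx.
  apply: le_trans (ler_norm _) _; apply: le_trans (cauchy_schwarz _ _) _.
  apply: le_trans (_ : enorm w *
    (opnorm B * enorm (B^T *m w)) <= _).
    by rewrite ler_wpM2l ?enorm_ge0 // enorm_mulmx.
  by rewrite le_eqVlt; apply/orP; left; apply/eqP; ring.
by apply/le_anti; rewrite le1 /= -{1}(trmxK A) le1.
Qed.

Lemma opnorm1 n : opnorm (1%:M : 'M[R]_n.+1) = 1.
Proof.
have l1 : opnorm (1%:M : 'M[R]_n.+1) <= 1.
  by apply: opnorm_le => // w; rewrite mul1mx mul1r.
apply/le_anti; rewrite l1 /=.
have e0 : (delta_mx 0 0 : 'cV[R]_n.+1) != 0.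
  by apply/eqP => /colP/(_ 0); rewrite !mxE !eqxx; apply/eqP; rewrite oner_eq0.
rewrite -enorm_gt0 in e0; rewrite -(ler_pM2r e0) mul1r.
by rewrite -[X in enorm X <= _]mul1mx enorm_mulmx.
Qed.

Lemma opnorm_rank1 m n (u : 'cV[R]_m) (v : 'cV[R]_n) :
  opnorm (u *m v^T) = enorm u * enorm v.
Proof.
apply/le_anti/andP; split.
  apply: opnorm_le => [|w]; first by rewrite mulr_ge0 ?enorm_ge0.
  rewrite mulmx_dot enormZ mulrC -mulrA ler_wpM2l ?enorm_ge0 //.
  exact: cauchy_schwarz.
have [->|v0] := eqVneq v 0; first by rewrite enorm0 mulr0 opnorm_ge0.
have := enorm_mulmx (u *m v^T) v.
rewrite mulmx_dot enormZ ger0_norm ?dot_ge0 // -enorm_sqr expr2 mulrC mulrA.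
by rewrite ler_pM2r ?enorm_gt0.
Qed.

Lemma enormM1 n (v : 'cV[R]_n) (A : 'M[R]_n) : A^T *m A = 1%:M ->
  enorm (A *m v) = enorm v.
Proof. by move=> AA; rewrite /enorm dot_mulmx mulmxA AA mul1mx. Qed.

End Euclid.

(** * Compactness and singular value decomposition *)

Section Compactness.
Context {R : realType}.

Lemma increasing_seq_comp (f g : nat -> nat) :
  increasing_seq f -> increasing_seq g -> increasing_seq (f \o g).
Proof. by move=> fi gi i j /=; rewrite fi -leEnat gi. Qed.

Lemma increasing_seq_ge (f : nat -> nat) n : increasing_seq f -> (n <= f n)%N.
Proof.
move=> fi; elim: n => // n IH; apply: leq_ltn_trans IH _.
by rewrite ltnNge -leEnat fi -ltnNge.
Qed.

Lemma cvg_increasing_seq (f : nat -> nat) (u : nat -> R) (l : R) :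
  increasing_seq f -> u @ \oo --> l -> (u \o f) @ \oo --> l.
Proof.
move=> fi ul; apply: cvg_comp ul; apply/cvgnyPge => A.
by exists A => // n /= An; exact: leq_trans An (increasing_seq_ge n fi).
Qed.

(** Bolzano-Weierstrass, applied to one coordinate after the other. *)
Lemma bounded_seq_finType (I : finType) (u : nat -> I -> R) (b : R) :
  (forall n i, `|u n i| <= b) ->
  exists f, increasing_seq f /\ exists l : I -> R, forall i, u (f n) i @[n --> \oo] --> l i.
Proof.
move=> ub.
suff [f [fi fc]] : exists f, increasing_seq f /\
    forall i, i \in enum I -> exists l : R, u (f n) i @[n --> \oo] --> l.
  have /boolp.choice[l ll] i : exists l : R, u (f n) i @[n --> \oo] --> l.
    by apply: fc; rewrite mem_enum.
  by exists f; split => //; exists l.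
elim: (enum I) => [|i s [f [fi fc]]]; first by exists id; split.
have [|g gi gc] := @bolzano_weierstrass R (fun n => u (f n) i).
  by exists b; split=> [|x bx n _]; rewrite ?num_real //= (le_trans (ub _ _)) // ltW.
exists (f \o g); split; first exact: increasing_seq_comp.
move=> j; rewrite inE => /predU1P[->|/fc[l ul]].
  by move/cvg_ex: gc => [l]; exists l.
by exists l; exact: (cvg_increasing_seq (u := fun n => u (f n) j)).
Qed.

(** Convergence is entrywise, so that limits of products and of transposes are
limits of finite sums and products of real sequences. *)
Definition mxcvg m n (A : nat -> 'M[R]_(m, n)) (B : 'M[R]_(m, n)) :=
  forall i j, A l i j @[l --> \oo] --> (B i j : R).

Lemma mxcvg_compact m n (A : nat -> 'M[R]_(m, n)) (b : R) :
  (forall l i j, `|A l i j| <= b) ->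
  exists f, increasing_seq f /\ exists B, mxcvg (A \o f) B.
Proof.
move=> Ab; have [|f [fi [B AB]]] :=
  @bounded_seq_finType _ (fun l (ij : 'I_m * 'I_n) => A l ij.1 ij.2) b.
  by move=> l [i j] /=.
exists f; split => //; exists (\matrix_(i, j) B (i, j)) => i j.
by rewrite mxE; exact: (AB (i, j)).
Qed.

Lemma mxcvg_subseq m n (A : nat -> 'M[R]_(m, n)) B f :
  increasing_seq f -> mxcvg A B -> mxcvg (A \o f) B.
Proof.
by move=> fi AB i j; exact: (cvg_increasing_seq (u := fun n => A n i j)).
Qed.

Lemma mxcvg_cst m n (A : 'M[R]_(m, n)) : mxcvg (fun=> A) A.
Proof. by move=> i j; exact: cvg_cst. Qed.

Lemma mxcvg_tr m n (A : nat -> 'M[R]_(m, n)) B :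
  mxcvg A B -> mxcvg (fun l => (A l)^T) B^T.
Proof. by move=> AB i j; rewrite mxE; under eq_fun do rewrite mxE; exact: AB. Qed.

Lemma cvg_sum_fin {T : Type} {F : set_system T} {FF : Filter F} (I : finType)
    (u : I -> T -> R) (l : I -> R) :
  (forall i, u i @ F --> l i) -> (\sum_i u i x) @[x --> F] --> \sum_i l i.
Proof.
move=> ul; elim: (index_enum I) => [|i s IH].
  by rewrite big_nil; under eq_fun do rewrite big_nil; exact: cvg_cst.
rewrite big_cons; under eq_fun do rewrite big_cons.
exact: (cvgD (ul i) IH).
Qed.

Lemma mxcvg_mul m n p (A : nat -> 'M[R]_(m, n)) A0 (B : nat -> 'M[R]_(n, p)) B0 :
  mxcvg A A0 -> mxcvg B B0 -> mxcvg (fun l => A l *m B l) (A0 *m B0).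
Proof.
move=> AA BB i j; rewrite mxE; under eq_fun do rewrite mxE.
by apply: cvg_sum_fin => k; apply: cvgM; [exact: AA|exact: BB].
Qed.

Lemma mxcvg_unique m n (A : nat -> 'M[R]_(m, n)) B C :
  mxcvg A B -> mxcvg A C -> B = C.
Proof.
move=> AB AC; apply/matrixP => i j.
exact: (cvg_unique _ (AB i j) (AC i j)).
Qed.

Lemma mxcvg_tr_cst n (A : nat -> 'M[R]_n) B :
  mxcvg A B -> \tr (A l) @[l --> \oo] --> \tr B.
Proof. by move=> AB; apply: cvg_sum_fin => i; exact: AB. Qed.

Lemma mxcvg_norm m n (A : nat -> 'M[R]_(m, n)) B :
  mxcvg A B -> `|A l - B| @[l --> \oo] --> (0 : R).
Proof.
move=> AB.
have H (ij : 'I_m * 'I_n) :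
    (fun l => `|A l ij.1 ij.2 - B ij.1 ij.2|) @ \oo --> (0 : R).
  rewrite -(normr0 R) -(subrr (B ij.1 ij.2)); apply: cvg_norm.
  by apply: cvgB; [exact: AB|exact: cvg_cst].
have {}H : \sum_(ij : 'I_m * 'I_n) `|A l ij.1 ij.2 - B ij.1 ij.2|
    @[l --> \oo] --> \sum_(ij : 'I_m * 'I_n) (0 : R) by exact: cvg_sum_fin.
rewrite big1 // in H.
apply: squeeze_cvgr (cvg_cst 0) H; near=> l; rewrite normr_ge0 /=.
rewrite [leLHS]/Num.Def.normr/= mx_normrE (bigmax_le _) ?sumr_ge0 //.
move=> [i j] _; rewrite !mxE /= (bigD1 (i, j)) //= lerDl sumr_ge0 //.
Unshelve. all: by end_near. Qed.

End Compactness.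

Section SVD.
Context {R : realType} {n : nat}.
Local Notation M := 'M[R]_n.

Lemma orth_entry (U : M) i j : U *m U^T = 1%:M -> `|U i j| <= 1.
Proof.
move=> /(congr1 (fun A : M => A i i)); rewrite !mxE eqxx mulr1n => h.
rewrite -(@expr_le1 _ 2) // real_normK ?num_real // -h.
rewrite (bigD1 j) //= mxE -expr2 lerDl sumr_ge0 // => l _.
by rewrite mxE -expr2 sqr_ge0.
Qed.

(** Orthogonal matrices form a compact set, so this function of two of them,
which is linear in each, attains its maximum.  The weights [C] are there to make
the maximum pick a diagonal and sorted representative, see [svd_exists]. *)
Lemma max_trace_orth (C g : M) : exists U V : M,
  [/\ U *m U^T = 1%:M, V *m V^T = 1%:M &
   forall U' V' : M, U' *m U'^T = 1%:M -> V' *m V'^T = 1%:M ->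
     \tr (C *m (U'^T *m g *m V')) <= \tr (C *m (U^T *m g *m V))].
Proof.
pose F (U V : M) := \tr (C *m (U^T *m g *m V)).
pose E := [set x | exists U V : M,
  [/\ U *m U^T = 1%:M, V *m V^T = 1%:M & x = F U V]].
have FE (U V : M) : F U V = \sum_i \sum_j C i j *
    (\sum_l (\sum_m U m j * g m l) * V l i).
  rewrite /F /mxtrace; apply: eq_bigr => i _; rewrite mxE; apply: eq_bigr => j _.
  rewrite mxE; congr (_ * _); apply: eq_bigr => l _; rewrite mxE; congr (_ * _).
  by apply: eq_bigr => m _; rewrite mxE.
have ubE : has_ubound E.
  exists (\sum_i \sum_j `|C i j| * \sum_l \sum_m `|g m l|).
  move=> _ [U [V [oU oV ->]]]; rewrite FE; apply: ler_sum => i _.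
  apply: ler_sum => j _; apply: le_trans (ler_norm _) _; rewrite normrM.
  apply: ler_wpM2l => //; apply: le_trans (ler_norm_sum _ _ _) _.
  apply: ler_sum => l _; rewrite normrM.
  have h : `|\sum_m U m j * g m l| <= \sum_m `|g m l|.
    apply: le_trans (ler_norm_sum _ _ _) _; apply: ler_sum => m _.
    by rewrite normrM ler_piMl // orth_entry.
  by apply: le_trans h; rewrite ler_piMr // orth_entry.
have E0 : E !=set0.
  by exists (F 1%:M 1%:M), 1%:M, 1%:M; rewrite trmx1 mulmx1.
have /boolp.choice[w hw] : forall l : nat, exists w : M * M,
    [/\ w.1 *m w.1^T = 1%:M, w.2 *m w.2^T = 1%:M &
     sup E - l.+1%:R^-1 < F w.1 w.2].
  move=> l; have [|_ [U [V [oU oV ->]]] h] :=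
    @sup_adherent _ E (l.+1%:R^-1) _ (conj E0 ubE); first by rewrite invr_gt0.
  by exists (U, V).
have [|f [fi [U hU]]] := @mxcvg_compact R n n (fun l => (w l).1) 1.
  by move=> l i j; have [ow _ _] := hw l; exact: orth_entry.
have [|f2 [fi2 [V hV]]] := @mxcvg_compact R n n (fun l => (w (f l)).2) 1.
  by move=> l i j; have [_ ow _] := hw (f l); exact: orth_entry.
have {}hU := mxcvg_subseq fi2 hU; rewrite /comp in hU hV.
have orth_lim (A : nat -> M) B : mxcvg A B ->
    (forall l, A l *m (A l)^T = 1%:M) -> B *m B^T = 1%:M.
  move=> AB oA; apply: (mxcvg_unique (mxcvg_mul AB (mxcvg_tr AB))).
  by under eq_fun do rewrite oA; exact: mxcvg_cst.
exists U, V; split.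
- by apply: orth_lim hU _ => l; have [] := hw (f (f2 l)).
- by apply: orth_lim hV _ => l; have [] := hw (f (f2 l)).
move=> U' V' oU' oV'; apply: (@le_trans _ _ (sup E)).
  by apply: (ub_le_sup ubE); exists U', V'.
have hF : F (w (f (f2 l))).1 (w (f (f2 l))).2 @[l --> \oo] --> F U V.
  apply: mxcvg_tr_cst; apply: mxcvg_mul; first exact: mxcvg_cst.
  apply: mxcvg_mul hV; apply: mxcvg_mul; last exact: mxcvg_cst.
  exact: mxcvg_tr hU.
have hS : sup E - (f (f2 l)).+1%:R^-1 @[l --> \oo] --> sup E.
  rewrite -[X in _ --> X]subr0; apply: cvgB; first exact: cvg_cst.
  apply: (cvg_increasing_seq (f := f \o f2) (u := fun l => l.+1%:R^-1)).
    exact: increasing_seq_comp.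
  exact: cvg_harmonic.
apply: (ler_cvg_to hS hF); near=> l; apply: ltW.
by have [] := hw (f (f2 l)).
Unshelve. all: by end_near. Qed.

Lemma orth_trC (U : M) : U *m U^T = 1%:M -> U^T *m U = 1%:M.
Proof. exact: mulmx1C. Qed.

Lemma mxtrace_delta (X : M) i j : \tr (X *m delta_mx i j) = X j i.
Proof.
rewrite /mxtrace (bigD1 j) //= mxE (bigD1 i) //= !mxE !eqxx mulr1.
rewrite !big1 ?addr0 // => l lN.
  rewrite mxE big1 // => m _; rewrite mxE (negbTE lN) andbF mulr0 //.
by rewrite mxE (negbTE lN) mulr0.
Qed.

(** In a coordinate plane the trace of the rotated matrix is [a cos t + b sin t]
plus a constant, where [b] is the difference of the two off-diagonal entries, and
it is maximal at [t = 0] only if [b = 0].  A reflection would improve a negative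
diagonal entry. *)
Lemma max_trace_sym (X : M) :
  (forall G : M, G *m G^T = 1%:M -> \tr (X *m G) <= \tr X) ->
  (forall i j, X i j = X j i) /\ (forall i, 0 <= X i i).
Proof.
move=> hX; split=> [i j|i]; last first.
  (* Flipping the sign of the i-th coordinate changes the trace by -2 X i i. *)
  pose G : M := 1%:M - 2 *: delta_mx i i.
  have GT : G^T = G by rewrite /G linearB linearZ /= trmx1 trmx_delta.
  have /hX : G *m G^T = 1%:M.
    rewrite GT /G mulmxBl mul1mx mulmxBr mulmx1 -scalemxAl -scalemxAr.
    rewrite mul_delta_mx scalerA; apply/matrixP => x y; rewrite !mxE; ring.
  rewrite /G mulmxBr mulmx1 linearB /= -scalemxAr linearZ /= mxtrace_delta; lra.
have [->//|ij] := eqVneq i j.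
have ji : j != i by rewrite eq_sym.
pose P : M := delta_mx i i + delta_mx j j.
pose J : M := delta_mx i j - delta_mx j i.
have PP : P *m P = P.
  by rewrite /P mulmxDl !mulmxDr !mul_delta_mx !mul_delta_mx_0 // addr0 add0r.
have JJ : J *m J = - P.
  rewrite /J /P mulmxBl !mulmxBr !mul_delta_mx !mul_delta_mx_0 //.
  by rewrite !sub0r subr0 opprD.
have PJ : P *m J = J.
  rewrite /J /P mulmxDl !mulmxBr !mul_delta_mx !mul_delta_mx_0 //.
  by rewrite subr0 sub0r.
have JP : J *m P = J.
  rewrite /J /P mulmxBl !mulmxDr !mul_delta_mx !mul_delta_mx_0 //.
  by rewrite addr0 add0r.
have PT : P^T = P by rewrite /P linearD /= !trmx_delta.
have JT : J^T = - J by rewrite /J linearB /= !trmx_delta opprB.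
pose a := X i i + X j j; pose b := X j i - X i j.
have trP : \tr (X *m P) = a by rewrite /P mulmxDr linearD /= !mxtrace_delta.
have trJ : \tr (X *m J) = b by rewrite /J mulmxBr linearB /= !mxtrace_delta.
have key co si : co ^+ 2 + si ^+ 2 = 1 -> (co - 1) * a + si * b <= 0.
  move=> cs; pose G : M := 1%:M + ((co - 1) *: P + si *: J).
  have GT : G^T = 1%:M + ((co - 1) *: P - si *: J).
    by rewrite /G linearD /= trmx1 linearD /= !linearZ /= PT JT scalerN.
  have /hX : G *m G^T = 1%:M.
    rewrite GT /G mulmxDl mul1mx mulmxDl !mulmxDr !mulmx1 !mulmxN.
    rewrite -!(scalemxAl, scalemxAr) PP PJ JP JJ.
    apply/matrixP => x y; rewrite !mxE.
    transitivity ((x == y)%:R + (co ^+ 2 + si ^+ 2 - 1) * P x y).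
      by rewrite !mxE; ring.
    by rewrite cs subrr mul0r addr0.
  rewrite /G mulmxDr mulmx1 mulmxDr -!scalemxAr linearD /= linearD /=.
  by rewrite !linearZ /= trP trJ; lra.
suff : b = 0 by rewrite /b; lra.
(* The rotation by the argument of a + i b turns the value into |a + i b|. *)
pose r := Num.sqrt (a ^+ 2 + b ^+ 2).
have r2 : r ^+ 2 = a ^+ 2 + b ^+ 2 by rewrite sqr_sqrtr // addr_ge0 ?sqr_ge0.
have [r0|r0] := eqVneq r 0.
  apply/eqP; rewrite -sqrf_eq0 eq_le sqr_ge0 andbT.
  by have := sqr_ge0 a; move: r2; rewrite r0 expr0n /=; lra.
have rp : 0 < r by rewrite lt_def r0 sqrtr_ge0.
have := key (a / r) (b / r).
have -> : (a / r) ^+ 2 + (b / r) ^+ 2 = (a ^+ 2 + b ^+ 2) / r ^+ 2 by field.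
rewrite -r2 divff ?sqrf_eq0 // => /(_ erefl).
have -> : (a / r - 1) * a + b / r * b = (a ^+ 2 + b ^+ 2) / r - a by field.
rewrite -r2 expr2 mulfK // subr_le0 => ra.
apply/eqP; rewrite -sqrf_eq0 eq_le sqr_ge0 andbT.
have : r ^+ 2 <= a ^+ 2.
  by rewrite ler_pXn2r // nnegrE; [exact: ltW|apply: le_trans ra; exact: ltW].
by rewrite r2; lra.
Qed.

End SVD.

Section SVDex.
Context {R : realType} {k : nat}.
Local Notation M := 'M[R]_k.+1.

(** Take [U] and [V] maximizing the trace of [C U^T g V], where [C] is diagonal
with positive, strictly decreasing entries [c i], and let [D] be [U^T g V].
Rotating [U] or [V] does not increase the trace, so [D C] and [C D] are both
symmetric by [max_trace_sym], which gives [c i ^ 2 D i j = c j ^ 2 D i j] and hence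
makes [D] diagonal, with nonnegative entries.  They are sorted because exchanging
two of them changes the trace by a multiple of [c i - c j]. *)
Lemma svd_exists (g : M) : exists U V s, is_svd g U V s.
Proof.
pose c (i : 'I_k.+1) : R := (k.+1 - i)%:R.
have c_gt0 i : 0 < c i by rewrite ltr0n subn_gt0.
have c_lt (i j : 'I_k.+1) : (i < j)%N -> c j < c i.
  by move=> ij; rewrite ltr_nat ltn_sub2l.
have [U [V [oU oV hmax]]] := max_trace_orth (diag_mx (\row_i c i)) g.
set C := diag_mx _ in hmax.
have [D defD] : exists D, D = U^T *m g *m V by exists (U^T *m g *m V).
rewrite -defD in hmax.
have CD i j : (C *m D) i j = c i * D i j by rewrite mul_diag_mx !mxE.
have DC i j : (D *m C) i j = D i j * c j by rewrite mul_mx_diag !mxE.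
have [sym1 _] : (forall i j, (D *m C) i j = (D *m C) j i) /\
    (forall i, 0 <= (D *m C) i i).
  apply: max_trace_sym => G oG.
  have oUG : U *m G^T *m (U *m G^T)^T = 1%:M.
    by rewrite trmx_mul trmxK mulmxA -(mulmxA U) orth_trC // mulmx1.
  have := hmax _ V oUG oV; rewrite trmx_mul trmxK.
  have -> : G *m U^T *m g *m V = G *m D by rewrite defD !mulmxA.
  by rewrite mulmxA mxtrace_mulC mulmxA (mxtrace_mulC C).
have [sym2 pos] : (forall i j, (C *m D) i j = (C *m D) j i) /\
    (forall i, 0 <= (C *m D) i i).
  apply: max_trace_sym => G oG.
  have oVG : V *m G *m (V *m G)^T = 1%:M.
    by rewrite trmx_mul mulmxA -(mulmxA V) oG mulmx1.
  have := hmax U _ oU oVG.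
  have -> : U^T *m g *m (V *m G) = D *m G by rewrite defD mulmxA.
  by rewrite mulmxA.
have off i j : i != j -> D i j = 0.
  move=> ij; have := sym1 i j; have := sym2 i j; rewrite !CD !DC => e1 e2.
  have : (c i ^+ 2 - c j ^+ 2) * D i j = 0.
    transitivity (c i * (c i * D i j) - c j * (D i j * c j)); first by ring.
    by rewrite e1 e2; ring.
  move/eqP; rewrite mulf_eq0 => /orP[|/eqP//].
  have cc : c i + c j == 0 = false by rewrite gt_eqF ?addr_gt0.
  rewrite subr_sqr mulf_eq0 cc orbF subr_eq0.
  case: (ltngtP i j) ij => [ij|ij|/val_inj->]; rewrite ?eqxx // => _.
    by rewrite gt_eqF // c_lt.
  by rewrite lt_eqF // c_lt.
have DE : D = diag_mx (\row_i D i i).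
  apply/matrixP => i j; rewrite !mxE; have [->|/off->] := eqVneq i j.
    by rewrite mulr1n.
  by rewrite mulr0n.
exists U, V, (\row_i D i i); split => //.
- by move=> i; rewrite mxE; have := pos i; rewrite CD pmulr_rge0.
- move=> i j ij; rewrite !mxE; case: ltngtP ij => // [ij|/val_inj->] _ //.
  (* Exchanging two columns of both factors exchanges two diagonal entries. *)
  have /= := hmax (U *m tperm_mx i j) (V *m tperm_mx i j).
  rewrite !trmx_mul !tr_tperm_mx.
  have TT : tperm_mx i j *m tperm_mx i j = 1%:M :> M.
    by rewrite /tperm_mx -perm_mxM tperm2 perm_mx1.
  have -> : U *m tperm_mx i j *m (tperm_mx i j *m U^T) = 1%:M.
    by rewrite mulmxA -(mulmxA U) TT mulmx1.
  have -> : V *m tperm_mx i j *m (tperm_mx i j *m V^T) = 1%:M.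
    by rewrite mulmxA -(mulmxA V) TT mulmx1.
  move=> /(_ erefl erefl).
  have -> : tperm_mx i j *m U^T *m g *m (V *m tperm_mx i j) =
      xrow i j (xcol i j D) by rewrite xrowE xcolE defD !mulmxA.
  have trE (X : M) : \tr (C *m X) = \sum_l c l * X l l.
    by apply: eq_bigr => l _; rewrite mul_diag_mx !mxE.
  have ji : j != i by rewrite neq_ltn ij orbT.
  rewrite !trE (bigD1 i) //= (bigD1 j) //= [leRHS](bigD1 i) //= [X in _ <= _ + X](bigD1 j) //=.
  rewrite (eq_bigr (fun l => c l * D l l)) => [|l /andP[li lj]]; last first.
    by rewrite !mxE tpermD // eq_sym.
  rewrite !addrA lerD2r !mxE tpermL tpermR => h.
  have cij := c_lt _ _ ij.
  have : 0 <= (c i - c j) * (D i i - D j j) by lra.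
  by rewrite pmulr_rge0 ?subr_gt0 // subr_ge0.
- rewrite -DE defD !mulmxA oU mul1mx -mulmxA oV mulmx1 //.
Qed.

End SVDex.

(** * Almost multiplicativity of the norm along dominated products *)

Section Tau.
Context {R : realType} {k : nat}.
Local Notation M := 'M[R]_k.+1.
Implicit Types (a b g h p q : M).

(** The ratio of the norm of a product to its trivial upper bound.  For matrices
close to rank one it is nearly the cosine of the angle between the direction that
[p] expands most and the image of the direction that [q] expands most. *)
Definition tau p q : R := opnorm (p *m q) / (opnorm p * opnorm q).

(** A large gap between the two largest singular values, stated without singular
values so that it can be added up along products. *)
Definition almost_rank1 g (e : R) : Prop :=
  exists u v : 'cV[R]_k.+1, [/\ enorm u = 1, enorm v = 1 &
    opnorm (g - opnorm g *: (u *m v^T)) <= e * opnorm g].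

Lemma opnorm_gt0 g : g \is a GRing.unit -> 0 < opnorm g.
Proof.
move=> gu; rewrite lt_def opnorm_ge0 andbT; apply/eqP => /opnorm_eq0 g0.
by move: gu; rewrite g0 unitr0.
Qed.

Lemma opnorm_mul_ge g h : g \is a GRing.unit ->
  opnorm h <= opnorm g^-1 * opnorm (g * h).
Proof. by move=> gu; rewrite -{1}(mulKr gu h); exact: opnormM. Qed.

Lemma opnorm_mul_ger g h : h \is a GRing.unit ->
  opnorm g <= opnorm (g * h) * opnorm h^-1.
Proof. by move=> hu; rewrite -{1}(mulrK hu g); exact: opnormM. Qed.

Lemma tau_tr p q : tau q^T p^T = tau p q.
Proof. by rewrite /tau -trmx_mul !opnorm_tr (mulrC (opnorm q)). Qed.

Lemma tau_ge0 p q : 0 <= tau p q.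
Proof. by rewrite divr_ge0 ?mulr_ge0 ?opnorm_ge0. Qed.

Lemma almost_rank1_tr g e : almost_rank1 g e -> almost_rank1 g^T e.
Proof.
move=> [u [v [u1 v1 uv]]]; exists v, u; split => //.
rewrite opnorm_tr (_ : _ - _ = (g - opnorm g *: (u *m v^T))^T) ?opnorm_tr //.
by rewrite [RHS]linearB /= [in RHS]linearZ /= trmx_mul trmxK.
Qed.

(** Up to a small relative error [p] is a multiple of [u v^T], and for a matrix of
that form [tau p q] is the norm of [v^T q] divided by that of [q], which does not
change when [u] is replaced by [a u]. *)
Lemma tau_mull_dist a p q (K e : R) :
  a \is a GRing.unit -> opnorm a <= K -> opnorm a^-1 <= K -> 1 <= K ->
  p \is a GRing.unit -> q \is a GRing.unit -> 0 <= e ->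
  almost_rank1 p e -> `|tau (a * p) q - tau p q| <= 3 * K ^+ 2 * e.
Proof.
move=> au aK aVK K1 pu qu e0 [u [v [u1 v1 puv]]].
have P0 := opnorm_gt0 pu; have Q0 := opnorm_gt0 qu.
have A0 := opnorm_gt0 au; have K0 : 0 < K by lra.
have AP0 : 0 < opnorm (a * p) by rewrite opnorm_gt0 // unitrMr.
set P := opnorm p in puv P0; set Q := opnorm q in Q0.
pose E := p - P *: (u *m v^T).
have EP : opnorm E <= e * P by [].
pose x := enorm (q^T *m v) / Q.
pose au1 := enorm (a *m u).
have au0 : 0 <= au1 by exact: enorm_ge0.
have Eq b : opnorm (b *m E *m q) <= opnorm b * (e * P) * Q.
  apply: le_trans (opnormM _ _) _; apply: ler_wpM2r; first exact: ltW.
  apply: le_trans (opnormM _ _) _; by apply: ler_wpM2l; [exact: opnorm_ge0|exact: EP].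
have r1 b : `|opnorm (b *m p *m q) - P * (enorm (b *m u) * enorm (q^T *m v))| <=
    opnorm b * (e * P) * Q.
  rewrite -opnorm_rank1 -[X in X * opnorm _](ger0_norm (ltW P0)) -opnormZ.
  apply: le_trans (opnorm_dist _ _) _; apply: le_trans (Eq b).
  rewrite le_eqVlt; apply/orP; left; apply/eqP; congr opnorm.
  rewrite /E mulmxBr mulmxBl trmx_mul trmxK -scalemxAr -scalemxAl !mulmxA //.
have r2 : `|opnorm (a * p) - P * au1| <= opnorm a * (e * P).
  have -> : P * au1 = opnorm (P *: (a *m u *m v^T)).
    by rewrite opnormZ opnorm_rank1 v1 mulr1 ger0_norm // ltW.
  apply: le_trans (opnorm_dist _ _) _.
  rewrite (_ : _ - _ = a *m E); last by rewrite /E mulmxBr -scalemxAr mulmxA.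
  apply: le_trans (opnormM _ _) _; by apply: ler_wpM2l; [exact: opnorm_ge0|exact: EP].
have x0 : 0 <= x by rewrite divr_ge0 ?enorm_ge0 // ltW.
have x1 : x <= 1.
  rewrite ler_pdivrMr // mul1r -/Q -(mulr1 Q) -v1 /Q -opnorm_tr.
  exact: enorm_mulmx.
have t0 : `|tau p q - x| <= e.
  have := r1 1%:M; rewrite !mul1mx opnorm1 u1 !mul1r /tau -/P -/Q.
  have -> : opnorm (p *m q) / (P * Q) - x =
    (opnorm (p *m q) - P * enorm (q^T *m v)) / (P * Q).
    by rewrite /x; field; rewrite !gt_eqF.
  by rewrite normrM normfV (ger0_norm (ltW (mulr_gt0 P0 Q0)))
    ler_pdivrMr ?mulr_gt0 // mulrA.
pose y1 := opnorm (a *m p *m q) / (P * Q).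
pose y2 := opnorm (a * p) / P.
have y1E : `|y1 - au1 * x| <= K * e.
  have -> : y1 - au1 * x = (opnorm (a *m p *m q) -
      P * (au1 * enorm (q^T *m v))) / (P * Q).
    by rewrite /y1 /x; field; rewrite !gt_eqF.
  rewrite normrM normfV (ger0_norm (ltW (mulr_gt0 P0 Q0))).
  rewrite ler_pdivrMr ?mulr_gt0 //; apply: le_trans (r1 a) _.
  rewrite -!mulrA; apply: ler_wpM2r => //.
  by rewrite !mulr_ge0 // ltW.
have y2E : `|y2 - au1| <= K * e.
  have -> : y2 - au1 = (opnorm (a * p) - P * au1) / P.
    by rewrite /y2; field; rewrite !gt_eqF.
  rewrite normrM normfV (ger0_norm (ltW P0)) ler_pdivrMr //.
  apply: le_trans r2 _; rewrite -!mulrA; apply: ler_wpM2r => //.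
  by rewrite !mulr_ge0 // ltW.
have y2K : 1 <= K * y2.
  rewrite /y2 mulrA ler_pdivlMr // mul1r.
  apply: le_trans (opnorm_mul_ge p au) _; apply: ler_wpM2r => //.
  exact: opnorm_ge0.
have y20 : 0 < y2 by rewrite divr_gt0.
have -> : tau (a * p) q = y1 / y2.
  rewrite /tau /y1 /y2 -mulmxE -/Q mulmxE; field.
  by rewrite !gt_eqF.
have h : `|y1 / y2 - x| <= K * (2 * K * e).
  have -> : y1 / y2 - x = (y1 - x * y2) / y2 by field; rewrite gt_eqF.
  rewrite normrM normfV (gtr0_norm y20) ler_pdivrMr //.
  have h1 : `|y1 - x * y2| <= 2 * K * e.
    have -> : y1 - x * y2 = (y1 - au1 * x) - x * (y2 - au1) by ring.
    apply: le_trans (ler_normB _ _) _; rewrite normrM (ger0_norm x0).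
    have : x * `|y2 - au1| <= 1 * (K * e).
      by apply: ler_pM.
    by lra.
  apply: le_trans h1 _.
  have Ke : 0 <= 2 * K * e by rewrite !mulr_ge0 // ltW.
  have : 2 * K * e * 1 <= 2 * K * e * (K * y2) by exact: ler_wpM2l.
  by rewrite mulr1 => /le_trans; apply; rewrite le_eqVlt; apply/orP; left;
    apply/eqP; ring.
have -> : y1 / y2 - tau p q = (y1 / y2 - x) - (tau p q - x) by ring.
apply: le_trans (ler_normB _ _) _.
have K2 : 1 <= K ^+ 2 by rewrite exprn_ege1.
have : e * 1 <= e * K ^+ 2 by apply: ler_wpM2l.
rewrite (_ : K * (2 * K * e) = 2 * (e * K ^+ 2)) in h; last by ring.
have -> : 3 * K ^+ 2 * e = 3 * (e * K ^+ 2) by ring.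
lra.
Qed.

Lemma tau_mulr_dist p q a (K e : R) :
  a \is a GRing.unit -> opnorm a <= K -> opnorm a^-1 <= K -> 1 <= K ->
  p \is a GRing.unit -> q \is a GRing.unit -> 0 <= e ->
  almost_rank1 q e -> `|tau p (q * a) - tau p q| <= 3 * K ^+ 2 * e.
Proof.
move=> au aK aVK K1 pu qu e0 /almost_rank1_tr q1.
rewrite -(tau_tr p (q * a)) -(tau_tr p q) -mulmxE trmx_mul mulmxE.
apply: tau_mull_dist => //; rewrite ?unitmx_tr ?opnorm_tr //.
by rewrite -[a^T^-1]/(invmx a^T) -trmx_inv opnorm_tr.
Qed.

End Tau.

Section Segments.
Context {R : realType} {k : nat}.
Local Notation M := 'M[R]_k.+1.
Variables (a : nat -> M) (K : R).
Hypothesis a_unit : forall l, a l \is a GRing.unit.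
Hypothesis aK : forall l, opnorm (a l) <= K.
Hypothesis aVK : forall l, opnorm (a l)^-1 <= K.
Hypothesis K1 : 1 <= K.

Definition segprod i j : M := \prod_(i <= l < j) a l.
Local Notation P := segprod.

Lemma segprodM i m j : (i <= m <= j)%N -> P i j = P i m * P m j.
Proof. by move=> /andP[im mj]; rewrite /P (big_cat_nat im mj). Qed.

Lemma segprod_unit i j : P i j \is a GRing.unit.
Proof. by apply: rpred_prod => l _. Qed.

Lemma segprod_gt0 i j : 0 < opnorm (P i j).
Proof. exact/opnorm_gt0/segprod_unit. Qed.

Lemma segprodS i j : (i <= j)%N -> P i j.+1 = P i j * a j.
Proof. by move=> ij; rewrite /P big_nat_recr. Qed.

Lemma segprodn i : P i i = 1.
Proof. by rewrite /P big_geq. Qed.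

Lemma segprod1 i : P i i.+1 = a i.
Proof. by rewrite /P big_nat1. Qed.

Lemma opnorm_segprod i j : (i <= j)%N -> opnorm (P i j) <= K ^+ (j - i).
Proof.
move=> ij; rewrite -(subnKC ij); elim: (j - i)%N => [|d IH].
  by rewrite addn0 segprodn subnn opnorm1.
rewrite addnS segprodS ?leq_addr //; apply: le_trans (opnormM _ _) _.
rewrite subSn ?leq_addr // exprSr addKn ler_pM ?opnorm_ge0 //.
by rewrite addKn in IH.
Qed.

Lemma opnorm_segprodV i j : (i <= j)%N -> opnorm (P i j)^-1 <= K ^+ (j - i).
Proof.
move=> ij; rewrite -(subnKC ij); elim: (j - i)%N => [|d IH].
  by rewrite addn0 segprodn subnn invr1 opnorm1.
rewrite addnS segprodS ?leq_addr // invrM ?segprod_unit //.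
apply: le_trans (opnormM _ _) _.
rewrite subSn ?leq_addr // exprS addKn ler_pM ?opnorm_ge0 //.
by rewrite addKn in IH.
Qed.

Let K0 : 0 < K. Proof. exact: lt_le_trans K1. Qed.

Lemma opnorm_segprod_shiftr i m m' : (i <= m <= m')%N ->
  opnorm (P i m) <= K ^+ (m' - m) * opnorm (P i m').
Proof.
move=> /andP[im mm']; rewrite (@segprodM i m m') ?im //.
apply: le_trans (opnorm_mul_ger _ (segprod_unit m m')) _.
rewrite mulrC; apply: ler_wpM2r; first exact: opnorm_ge0.
exact: opnorm_segprodV.
Qed.

Lemma opnorm_segprod_shiftl m m' j : (m <= m' <= j)%N ->
  opnorm (P m j) <= K ^+ (m' - m) * opnorm (P m' j).
Proof.
move=> /andP[mm' m'j]; rewrite (@segprodM m m' j) ?mm' //.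
apply: le_trans (opnormM _ _) _; apply: ler_wpM2r; first exact: opnorm_ge0.
exact: opnorm_segprod.
Qed.

Lemma opnorm_segprod_shiftl' m m' j : (m <= m' <= j)%N ->
  opnorm (P m' j) <= K ^+ (m' - m) * opnorm (P m j).
Proof.
move=> /andP[mm' m'j]; rewrite (@segprodM m m' j) ?mm' //.
apply: le_trans (opnorm_mul_ge _ (segprod_unit m m')) _.
by apply: ler_wpM2r; [exact: opnorm_ge0|exact: opnorm_segprodV].
Qed.

(** Moving the cut by one letter changes each of the two norms in the
denominator by a factor of at most [K]. *)
Lemma tau_shift i m m' j : (i <= m)%N -> (m <= m')%N -> (m' <= j)%N ->
  tau (P i m') (P m' j) <= K ^+ (2 * (m' - m)) * tau (P i m) (P m j).
Proof.
move=> im mm' m'j; have im'j : (i <= m' <= j)%N by lia.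
have imj : (i <= m <= j)%N by lia.
rewrite /tau !mulmxE -(segprodM im'j) -(segprodM imj).
rewrite mulrCA ler_pM2l ?segprod_gt0 // ler_pdivlMr ?mulr_gt0 ?segprod_gt0 //.
rewrite ler_pdivrMl ?mulr_gt0 ?segprod_gt0 //.
have h1 := @opnorm_segprod_shiftr i m m'; have h2 := @opnorm_segprod_shiftl m m' j.
have := ler_pM (opnorm_ge0 _) (opnorm_ge0 _) (h1 _) (h2 _).
rewrite im mm' m'j => /(_ isT isT) /le_trans; apply.
by rewrite mul2n -addnn exprD le_eqVlt; apply/orP; left; apply/eqP; ring.
Qed.

Lemma tau_ge_right i m j : (i <= m <= j)%N ->
  (K ^+ (2 * (j - m)))^-1 <= tau (P i m) (P m j).
Proof.
move=> /andP[im mj]; rewrite /tau mulmxE -segprodM ?im //.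
rewrite ler_pdivlMr ?mulr_gt0 ?segprod_gt0 // ler_pdivrMl ?exprn_gt0 //.
have h1 := @opnorm_segprod_shiftr i m j; have h2 := opnorm_segprod mj.
rewrite im mj in h1.
apply: le_trans (ler_pM (opnorm_ge0 _) (opnorm_ge0 _) (h1 isT) h2) _.
by rewrite mul2n -addnn exprD le_eqVlt; apply/orP; left; apply/eqP; ring.
Qed.

Lemma tau_ge_left i m j : (i <= m <= j)%N ->
  (K ^+ (2 * (m - i)))^-1 <= tau (P i m) (P m j).
Proof.
move=> /andP[im mj]; rewrite /tau mulmxE -segprodM ?im //.
rewrite ler_pdivlMr ?mulr_gt0 ?segprod_gt0 // ler_pdivrMl ?exprn_gt0 //.
have h1 := @opnorm_segprod_shiftl' i m j; have h2 := opnorm_segprod im.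
rewrite im mj in h1.
apply: le_trans (ler_pM (opnorm_ge0 _) (opnorm_ge0 _) h2 (h1 isT)) _.
by rewrite mul2n -addnn exprD le_eqVlt; apply/orP; left; apply/eqP; ring.
Qed.

Section Dominated.
Variables (C r : R).
Hypotheses (C0 : 0 <= C) (r0 : 0 < r) (r1 : r < 1).

Let C1 := 3 * K ^+ 2 * C / (1 - r).

(** Lengthening the left factor letter by letter changes [tau] by the terms of a
geometric series, by [tau_mull_dist]. *)
Lemma tau_prefix i i' m q : (i <= i' <= m)%N -> q \is a GRing.unit ->
  (forall l, (i <= l <= m)%N -> almost_rank1 (P l m) (C * r ^+ (m - l))) ->
  `|tau (P i m) q - tau (P i' m) q| <= C1 * r ^+ (m - i').
Proof.
move=> /andP[ii' i'm] qu dom.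
suff h d : (d <= i' - i)%N ->
    `|tau (P (i' - d) m) q - tau (P i' m) q| <=
      C1 * (r ^+ (m - i') - r ^+ (m - (i' - d))).
  have := h (i' - i)%N (leqnn _); rewrite subKn // => /le_trans; apply.
  apply: ler_wpM2l; last by rewrite gerBl exprn_ge0 // ltW.
  by rewrite /C1 divr_ge0 ?subr_ge0 ?(ltW r1) // !mulr_ge0 ?exprn_ge0 // ltW.
elim: d => [|d IH] dle; first by rewrite subn0 !subrr normr0 mulr0.
have /IH {}IH : (d <= i' - i)%N by exact: ltnW.
set l := (i' - d.+1)%N in IH *.
have lS : (i' - d)%N = l.+1 by rewrite /l; lia.
rewrite lS in IH.
have lm : (l < m)%N by rewrite /l; lia.
have Pl : P l m = a l * P l.+1 m.
  by rewrite (@segprodM l l.+1 m) ?segprod1 // leqnSn.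
have st : `|tau (P l m) q - tau (P l.+1 m) q| <=
    3 * K ^+ 2 * (C * r ^+ (m - l.+1)).
  rewrite Pl; apply: tau_mull_dist => //; first exact: segprod_unit.
    by rewrite mulr_ge0 // exprn_ge0 // ltW.
  by apply: dom; rewrite lm andbT /l; lia.
have -> : tau (P l m) q - tau (P i' m) q =
  (tau (P l m) q - tau (P l.+1 m) q) + (tau (P l.+1 m) q - tau (P i' m) q).
  by ring.
apply: le_trans (ler_normD _ _) _; apply: le_trans (lerD st IH) _.
rewrite (_ : (m - l)%N = (m - l.+1).+1); last by lia.
rewrite [r ^+ _.+1]exprS /C1 le_eqVlt; apply/orP; left; apply/eqP; field.
by rewrite gt_eqF // subr_gt0.
Qed.

Lemma tau_suffix m j' j p : (m <= j' <= j)%N -> p \is a GRing.unit ->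
  (forall l, (m <= l <= j)%N -> almost_rank1 (P m l) (C * r ^+ (l - m))) ->
  `|tau p (P m j) - tau p (P m j')| <= C1 * r ^+ (j' - m).
Proof.
move=> /andP[mj' j'j] pu dom.
suff h d : (d <= j - j')%N ->
    `|tau p (P m (j' + d)) - tau p (P m j')| <=
      C1 * (r ^+ (j' - m) - r ^+ (j' + d - m)).
  have := h (j - j')%N (leqnn _); rewrite subnKC // => /le_trans; apply.
  apply: ler_wpM2l; last by rewrite gerBl exprn_ge0 // ltW.
  by rewrite /C1 divr_ge0 ?subr_ge0 ?(ltW r1) // !mulr_ge0 ?exprn_ge0 // ltW.
elim: d => [|d IH] dle; first by rewrite addn0 !subrr normr0 mulr0.
have /IH {}IH : (d <= j - j')%N by exact: ltnW.
set l := (j' + d)%N in IH *.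
rewrite addnS -/l.
have ml : (m <= l)%N by rewrite /l; lia.
have st : `|tau p (P m l.+1) - tau p (P m l)| <= 3 * K ^+ 2 * (C * r ^+ (l - m)).
  rewrite segprodS //; apply: tau_mulr_dist => //; first exact: segprod_unit.
    by rewrite mulr_ge0 // exprn_ge0 // ltW.
  by apply: dom; rewrite ml /= /l; lia.
have -> : tau p (P m l.+1) - tau p (P m j') =
  (tau p (P m l.+1) - tau p (P m l)) + (tau p (P m l) - tau p (P m j')).
  by ring.
apply: le_trans (ler_normD _ _) _; apply: le_trans (lerD st IH) _.
rewrite subSn // [r ^+ _.+1]exprS /C1 le_eqVlt; apply/orP; left; apply/eqP; field.
by rewrite gt_eqF // subr_gt0.
Qed.

End Dominated.

(** If cutting in the middle always loses a factor [B rho ^ (2 t)], then each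
doubling of the length multiplies the exponential growth rate by [rho]: the
inductive estimate for the length [2 ^ j] is squared and gains [rho ^ (2 t)] with
[t = 2 ^ j]. *)
Lemma opnorm_dyadic (B rho : R) (x W : nat) : 1 <= B -> 0 < rho ->
  (forall m t, (x + t <= m)%N -> (m + t <= x + W)%N ->
     tau (P (m - t) m) (P m (m + t)) <= B * (rho ^+ 2) ^+ t) ->
  forall j i, (x <= i)%N -> (i + 2 ^ j <= x + W)%N ->
    B * opnorm (P i (i + 2 ^ j)) <= (K * B * rho ^+ j) ^+ (2 ^ j).
Proof.
move=> B1 rho0 tauB; elim=> [|j IH] i xi iW.
  rewrite addn1 segprod1 expr0 mulr1 expr1 mulrC ler_wpM2r //.
  exact: le_trans B1.
set t := (2 ^ j)%N in IH *.
have tE : (2 ^ j.+1)%N = (t + t)%N by rewrite expnS mul2n addnn.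
rewrite tE in iW *.
have h1 := IH i xi; have h2 := IH (i + t)%N.
have h3 := tauB (i + t)%N t.
rewrite addnK -addnA in h3.
have {}h3 : opnorm (P i (i + (t + t))) <= B * (rho ^+ 2) ^+ t *
    (opnorm (P i (i + t)) * opnorm (P (i + t) (i + (t + t)))).
  rewrite -ler_pdivrMr ?mulr_gt0 ?segprod_gt0 //.
  have := h3; rewrite /tau mulmxE -segprodM; last by lia.
  by apply; lia.
have B0 : 0 < B by lra.
apply: le_trans (_ : B * (B * (rho ^+ 2) ^+ t *
    (opnorm (P i (i + t)) * opnorm (P (i + t) (i + (t + t))))) <= _).
  by rewrite ler_pM2l.
have -> : B * (B * (rho ^+ 2) ^+ t *
    (opnorm (P i (i + t)) * opnorm (P (i + t) (i + (t + t))))) =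
   (rho ^+ 2) ^+ t * ((B * opnorm (P i (i + t))) *
     (B * opnorm (P (i + t) (i + (t + t))))) by ring.
have -> : (K * B * rho ^+ j.+1) ^+ (t + t) = (rho ^+ 2) ^+ t *
   ((K * B * rho ^+ j) ^+ t * (K * B * rho ^+ j) ^+ t).
  rewrite exprS (_ : K * B * (rho * rho ^+ j) = rho * (K * B * rho ^+ j)).
    by rewrite exprMn !exprD -exprM mul2n -addnn exprD.
  by ring.
apply: ler_wpM2l; first by rewrite !exprn_ge0 // ltW.
rewrite addnA; apply: ler_pM; rewrite ?mulr_ge0 ?opnorm_ge0 ?(ltW B0) //.
  by apply: h1; lia.
by apply: h2; lia.
Qed.

End Segments.

(** Suppose that [tau] is very small at some cut [m].  It is then still small at
all cuts in a long interval starting at [m], since moving the cut by one step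
changes it by a bounded factor.  Shortening the two segments on the sides of the
cut adds exponentially small errors only, so inside that interval [tau] is at most
[B r ^ t] for segments of length [t].  By [opnorm_dyadic] the norms of the segments
inside the interval then decay faster than any given exponential rate, which
invertible factors with bounded inverses do not allow. *)
Lemma dominated_tau_ge {R : realType} (k : nat) (K C r : R) :
  1 <= K -> 0 <= C -> 0 < r < 1 ->
  exists2 t0 : R, 0 < t0 & forall (a : nat -> 'M[R]_k.+1) (n : nat),
    (forall l, a l \is a GRing.unit) -> (forall l, opnorm (a l) <= K) ->
    (forall l, opnorm (a l)^-1 <= K) ->
    (forall i j, (i <= j <= n)%N ->
       almost_rank1 (segprod a i j) (C * r ^+ (j - i))) ->
    forall i m j, (i <= m)%N -> (m <= j <= n)%N ->
      t0 <= tau (segprod a i m) (segprod a m j).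
Proof.
move=> K1 C0 /andP[r0 r1].
have K0 : 0 < K by lra.
pose C1 := 3 * K ^+ 2 * C / (1 - r).
have C10 : 0 <= C1.
  by rewrite /C1 divr_ge0 ?subr_ge0 ?(ltW r1) // !mulr_ge0 ?exprn_ge0 // ltW.
pose B := 1 + 2 * C1.
have B1 : 1 <= B by rewrite /B; lra.
pose rho := Num.sqrt r.
have rho0 : 0 < rho by rewrite sqrtr_gt0.
have rho2 : rho ^+ 2 = r by rewrite sqr_sqrtr // ltW.
have rho1 : rho < 1 by rewrite -(@ltr_pXn2r _ 2) ?nnegrE ?ltW // rho2 expr1n.
(* 2 ^ J steps are enough for the dyadic estimate to beat the trivial lower bound
K ^ (- 2 ^ J) for the norm of a segment of that length. *)
have [J hJ] : exists J, K ^+ 2 * B * rho ^+ J < 1.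
  have : rho ^+ l @[l --> \oo] --> (0 : R).
    by apply: cvg_expr; rewrite ger0_norm // ltW.
  move/cvgr0_norm_lt => /(_ (K ^+ 2 * B)^-1).
  have KB : 0 < K ^+ 2 * B by rewrite mulr_gt0 ?exprn_gt0 //; lra.
  rewrite invr_gt0 => /(_ KB) [J _ /(_ J (leqnn J)) /= hJ].
  exists J; rewrite mulrC -ltr_pdivlMr // mul1r.
  by apply: le_lt_trans hJ; exact: ler_norm.
have [W WE] : exists W, W = (2 ^ J)%N by exists (2 ^ J)%N.
(* The factor K ^ (2 W) pays for moving the cut by at most W steps. *)
pose t0 := r ^+ W / K ^+ (2 * W).
have t00 : 0 < t0 by rewrite divr_gt0 ?exprn_gt0.
exists t0 => // a n au aK aVK dom i m j im /andP[mj jn].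
have [jW|Wj] := ltnP (j - m) W.
  have imj : (i <= m <= j)%N by rewrite im.
  apply: le_trans (tau_ge_right au aK aVK K1 imj).
  apply: (@le_trans _ _ (1 * (K ^+ (2 * W))^-1)).
    apply: ler_wpM2r; first by rewrite invr_ge0 exprn_ge0 // ltW.
    by apply: exprn_ile1; exact: ltW.
  rewrite mul1r lef_pV2 ?posrE ?exprn_gt0 //.
  by apply: ler_weXn2l => //; rewrite leq_mul2l /= ltnW.
rewrite leNgt; apply/negP => taus.
have tB m' t : (m + t <= m')%N -> (m' + t <= m + W)%N ->
   tau (segprod a (m' - t) m') (segprod a m' (m' + t)) <= B * (rho ^+ 2) ^+ t.
  move=> mt tW; rewrite rho2.
  have e1 := @tau_prefix _ _ a K au aK aVK K1 C r C0 r0 r1 i (m' - t) m'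
    (segprod a m' (m' + t)).
  have e2 := @tau_suffix _ _ a K au aK aVK K1 C r C0 r0 r1 m' (m' + t) j
    (segprod a i m').
  have e3 := @tau_shift _ _ a K au aK aVK K1 i m m' j.
  have {}e1 : `|tau (segprod a i m') (segprod a m' (m' + t)) -
     tau (segprod a (m' - t) m') (segprod a m' (m' + t))| <= C1 * r ^+ t.
    have tt : (m' - (m' - t))%N = t by clear -mt; lia.
    rewrite tt in e1.
    apply: e1.
    - by clear -im mt; lia.
    - exact: segprod_unit.
    move=> l lm'; apply: dom.
    by clear -lm' tW Wj mj jn; lia.
  have {}e2 : `|tau (segprod a i m') (segprod a m' j) -
     tau (segprod a i m') (segprod a m' (m' + t))| <= C1 * r ^+ t.
    rewrite addKn in e2; apply: e2.
    - by clear -im mt tW Wj mj jn; lia.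
    - exact: segprod_unit.
    move=> l lm'; apply: dom.
    by clear -lm' tW Wj mj jn; lia.
  have {}e3 : tau (segprod a i m') (segprod a m' j) <= r ^+ t.
    apply: le_trans (e3 _ _ _) _ => //.
    - by clear -mt; lia.
    - by clear -tW Wj mj; lia.
    apply: le_trans (_ : K ^+ (2 * W) * t0 <= _).
      apply: ler_pM; rewrite ?exprn_ge0 ?tau_ge0 ?(ltW K0) ?(ltW taus) //.
      by rewrite ler_weXn2l // leq_mul2l /=; clear -tW; lia.
    rewrite /t0 mulrCA divff ?mulr1 ?expf_neq0 ?gt_eqF //.
    by apply: ler_wiXn2l; rewrite ?(ltW r0) ?(ltW r1) //; clear -tW mt; lia.
  move: e1 e2 e3; rewrite !ler_norml /B => /andP[e1 e1'] /andP[e2 e2'] e3.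
  lra.
have mW : (m + 2 ^ J <= m + W)%N by rewrite WE.
have := opnorm_dyadic au aK K1 B1 rho0 tB (leqnn m) mW.
rewrite -WE leNgt => /negP; apply.
have h : 1 <= K ^+ W * opnorm (segprod a m (m + W)).
  have := @opnorm_segprod_shiftl' _ _ a K au aVK m (m + W) (m + W).
  by rewrite segprodn opnorm1 addKn; apply; rewrite leq_addr leqnn.
apply: lt_le_trans (_ : (K ^+ W)^-1 <= _); last first.
  rewrite -div1r ler_pdivrMr ?exprn_gt0 //; apply: le_trans h _.
  rewrite mulrC -mulrA (mulrC _ (K ^+ W)) ler_peMl //.
  by rewrite mulr_ge0 ?exprn_ge0 ?opnorm_ge0 // ltW.
rewrite -exprVn ltrXn2r ?WE -?lt0n ?expn_gt0 //.
  by rewrite !mulr_ge0 ?exprn_ge0 // ?(ltW K0) ?(ltW rho0) //; lra.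
by rewrite -div1r ltr_pdivlMr // mulrC !mulrA -expr2.
Qed.

(** * Singular values and rank-one approximation *)

Section Diag.
Context {R : realType} {k : nat}.
Local Notation M := 'M[R]_k.+1.
Implicit Types (U V g : M) (d s : 'rV[R]_k.+1).

Lemma enorm_diag_le d b (w : 'cV[R]_k.+1) :
  (forall i, `|d 0 i| <= b) -> enorm (diag_mx d *m w) <= b * enorm w.
Proof.
move=> db; have b0 : 0 <= b by exact: le_trans (db 0).
rewrite -(@ler_pXn2r _ 2) ?nnegrE ?mulr_ge0 ?enorm_ge0 // exprMn !enorm_sqr.
rewrite !dotE big_distrr /=; apply: ler_sum => i _.
rewrite mul_diag_mx mxE -!expr2 exprMn; apply: ler_wpM2r; first exact: sqr_ge0.
by rewrite -real_normK ?num_real // ler_pXn2r ?nnegrE.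
Qed.

Lemma opnorm_diag_le U V d b : U *m U^T = 1%:M -> V *m V^T = 1%:M ->
  (forall i, `|d 0 i| <= b) -> opnorm (U *m diag_mx d *m V^T) <= b.
Proof.
move=> oU oV db; have b0 : 0 <= b by exact: le_trans (db 0).
apply: opnorm_le => // w; rewrite -!mulmxA enormM1; last exact: orth_trC.
apply: le_trans (enorm_diag_le _ db) _.
by rewrite enormM1 ?trmxK.
Qed.

Lemma orth_dot_col U i j : U *m U^T = 1%:M ->
  dot (col i U) (col j U) = (i == j)%:R.
Proof.
move=> /orth_trC /(congr1 (fun A : M => A i j)); rewrite !mxE dotE => <-.
by apply: eq_bigr => l _; rewrite !mxE.
Qed.

Lemma enorm_orth_col U i : U *m U^T = 1%:M -> enorm (col i U) = 1.
Proof. by move=> oU; rewrite /enorm orth_dot_col // eqxx sqrtr1. Qed.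

Lemma col_mul_tr U V i j : col i U *m (col j V)^T = U *m delta_mx i j *m V^T.
Proof.
by rewrite !colE trmx_mul trmx_delta mulmxA -(mulmxA U) mul_delta_mx.
Qed.

Lemma diag_mx_delta i : diag_mx (delta_mx 0 i) = delta_mx i i :> M.
Proof.
apply/matrixP => x y; rewrite !mxE eqxx /=.
have [->|xy] := eqVneq x y; first by rewrite mulr1n andbb.
rewrite mulr0n; case: (x =P i) => //= xi.
by rewrite -xi eq_sym (negbTE xy).
Qed.

Lemma svd_mul_col U V d i : V *m V^T = 1%:M ->
  U *m diag_mx d *m V^T *m col i V = d 0 i *: col i U.
Proof.
move=> oV; rewrite !colE mulmxA -(mulmxA _ V^T) orth_trC // mulmx1.
rewrite -mulmxA (_ : diag_mx d *m _ = d 0 i *: delta_mx i 0) ?scalemxAr //.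
apply/matrixP => x y; rewrite mul_diag_mx !mxE.
by case: eqVneq => [->|] //=; rewrite !mulr0.
Qed.

Lemma opnorm_diag U V d i0 : U *m U^T = 1%:M -> V *m V^T = 1%:M ->
  (forall i, `|d 0 i| <= d 0 i0) -> opnorm (U *m diag_mx d *m V^T) = d 0 i0.
Proof.
move=> oU oV dd; apply/le_anti; rewrite opnorm_diag_le //=.
have := enorm_mulmx (U *m diag_mx d *m V^T) (col i0 V).
rewrite svd_mul_col // enormZ !enorm_orth_col // !mulr1.
by apply: le_trans; rewrite ler_norm.
Qed.

Lemma opnorm_diag_rank1 U V d i0 e : U *m U^T = 1%:M -> V *m V^T = 1%:M ->
  0 <= e -> (forall i, i != i0 -> `|d 0 i| <= e) ->
  opnorm (U *m diag_mx d *m V^T - d 0 i0 *: (col i0 U *m (col i0 V)^T)) <= e.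
Proof.
move=> oU oV e0 de; pose d' := d - d 0 i0 *: delta_mx 0 i0.
rewrite (_ : _ - _ = U *m diag_mx d' *m V^T).
  apply: opnorm_diag_le => // i; rewrite !mxE eqxx /=.
  have [->|/de ile] := eqVneq i i0; first by rewrite mulr1 subrr normr0.
  by rewrite mulr0 subr0.
have -> : diag_mx d' = diag_mx d - d 0 i0 *: delta_mx i0 i0.
  by rewrite /d' linearB /= linearZ /= diag_mx_delta.
by rewrite col_mul_tr mulmxBr mulmxBl -scalemxAr -scalemxAl.
Qed.

Lemma almost_rank1_diag U V d i0 e : U *m U^T = 1%:M -> V *m V^T = 1%:M ->
  0 <= e -> e <= 1 -> (forall i, i != i0 -> `|d 0 i| <= e * d 0 i0) -> 0 <= d 0 i0 ->
  almost_rank1 (U *m diag_mx d *m V^T) e.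
Proof.
move=> oU oV e0 e1 de d0; exists (col i0 U), (col i0 V).
rewrite !enorm_orth_col // (@opnorm_diag _ _ _ i0) // => [|i].
  by split => //; apply: opnorm_diag_rank1 => //; rewrite mulr_ge0.
have [->|/de ile] := eqVneq i i0; first by rewrite ger0_norm.
by apply: le_trans ile _; rewrite ler_piMl.
Qed.

End Diag.

Section SingularValues.
Context {R : realType} {k : nat}.
Local Notation M := 'M[R]_k.+1.
Variable g : M.
Hypothesis detg : \det g = 1.
Hypothesis hk : (1 <= k)%N.

Lemma singular_valuesP : exists U V, is_svd g U V (singular_values g).
Proof.
have [U [V [s UVs]]] := svd_exists g.
by apply: (@xgetPex _ 0 [set s | exists U V, is_svd g U V s]); exists s, U, V.
Qed.

Variables (U V : M) (s : 'rV[R]_k.+1).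
Hypothesis svdg : is_svd g U V s.

Let oU : U *m U^T = 1%:M. Proof. by case: svdg. Qed.
Let oV : V *m V^T = 1%:M. Proof. by case: svdg. Qed.
Let gE : g = U *m diag_mx s *m V^T. Proof. by case: svdg. Qed.
Let s_ge0 i : 0 <= s 0 i. Proof. by case: svdg. Qed.
Let s_sorted (i j : 'I_k.+1) : (i <= j)%N -> s 0 j <= s 0 i.
Proof. by case: svdg => _ _ _ + _; apply. Qed.

Lemma svd_prod : \prod_i s 0 i = 1.
Proof.
have : `|\det g| = 1 by rewrite detg normr1.
have d1 (A : M) : A *m A^T = 1%:M -> `|\det A| = 1.
  move=> /(congr1 (fun B => \det B)); rewrite det_mulmx det_tr det1 => h.
  apply/eqP; rewrite -(@eqrXn2 _ 2) // real_normK ?num_real // expr1n expr2.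
  by rewrite h.
rewrite gE !det_mulmx !normrM det_tr (d1 U) // (d1 V) // mul1r mulr1 det_diag.
by rewrite ger0_norm // prodr_ge0.
Qed.

Lemma svd_gt0 i : 0 < s 0 i.
Proof.
rewrite lt_def s_ge0 andbT; apply/eqP => si.
have := svd_prod; rewrite (bigD1 i) //= si mul0r => /esym/eqP.
by rewrite oner_eq0.
Qed.

Lemma opnorm_svd : opnorm g = s 0 ord0.
Proof.
by rewrite gE; apply: opnorm_diag => // i; rewrite ger0_norm // s_sorted.
Qed.

Let sV : 'rV[R]_k.+1 := \row_i (s 0 i)^-1.

(** Passing to the inverse transpose keeps [U] and [V] and is multiplicative, unlike
the inverse, which reverses products: facts on products of inverses are obtained
from this homomorphism. *)
Lemma svd_trV : (g^T)^-1 = U *m diag_mx sV *m V^T.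
Proof.
have gu : g^T \is a GRing.unit by rewrite unitmxE det_tr detg unitr1.
apply: (mulrI gu); rewrite mulrV // {1}gE -mulmxE !trmx_mul trmxK tr_diag_mx.
rewrite !mulmxA -(mulmxA (V *m _)) orth_trC // mulmx1.
rewrite -(mulmxA V) (_ : diag_mx s *m diag_mx sV = 1%:M) ?mulmx1 ?oV //.
apply/matrixP => i j; rewrite mul_diag_mx !mxE; case: eqVneq => [->|_].
  by rewrite !mulr1n divff // gt_eqF // svd_gt0.
by rewrite !mulr0n mulr0.
Qed.

Let sV_norm i : `|sV 0 i| <= sV 0 ord_max.
Proof.
rewrite !mxE ger0_norm ?invr_ge0 // lef_pV2 ?posrE ?svd_gt0 // s_sorted //.
by rewrite -ltnS.
Qed.

Lemma opnorm_svdV : opnorm g^-1 = (s 0 ord_max)^-1.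
Proof.
rewrite -opnorm_tr -[g^-1]/(invmx g) trmx_inv -[invmx _]/(g^T)^-1 svd_trV.
by rewrite (opnorm_diag oU oV sV_norm) mxE.
Qed.

Let gap1 := s 0 (inord 1) / s 0 ord0.
Let gap2 := s 0 ord_max / s 0 (inord k.-1).

Lemma svd_rank1 : opnorm (g - opnorm g *: (col ord0 U *m (col ord0 V)^T)) <=
  gap1 * opnorm g.
Proof.
rewrite opnorm_svd gE; apply: opnorm_diag_rank1 => // [|i i0].
  by rewrite mulr_ge0 ?divr_ge0.
rewrite /gap1 divfK ?gt_eqF ?svd_gt0 // ger0_norm // s_sorted //.
rewrite inordK ?lt0n //.
Qed.

Lemma gap2_le1 : gap2 <= 1.
Proof.
rewrite ler_pdivrMr ?svd_gt0 // mul1r s_sorted // inordK //=; last by lia.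
exact: leq_pred.
Qed.

Lemma almost_rank1_svd : almost_rank1 g gap1.
Proof.
exists (col ord0 U), (col ord0 V); rewrite !enorm_orth_col //; split => //.
exact: svd_rank1.
Qed.

Lemma almost_rank1_svd_trV : almost_rank1 (g^T)^-1 gap2.
Proof.
rewrite svd_trV; apply: (@almost_rank1_diag _ _ _ _ _ ord_max) => //.
- by rewrite divr_ge0.
- exact: gap2_le1.
- move=> i im; rewrite !mxE ger0_norm ?invr_ge0 // /gap2 mulrAC divff.
    rewrite mul1r lef_pV2 ?posrE ?svd_gt0 // s_sorted // inordK; last by lia.
    have := ltn_ord i; move/eqP: im => im im'.
    have : i != k :> nat by apply/eqP => ik; apply: im; exact: val_inj.
    by lia.
  by rewrite gt_eqF // svd_gt0.
- by rewrite mxE invr_ge0.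
Qed.

(** Since the singular values have product 1, a large gap forces a large
norm. *)
Lemma svd_gap_le : gap1^-1 <= s 0 ord0 ^+ k.+1.
Proof.
have s1 : 0 < s 0 (inord 1) by exact: svd_gt0.
rewrite /gap1 invf_div ler_pdivrMr // exprSr mulrAC.
have : 1 <= s 0 ord0 ^+ k * s 0 (inord 1).
  rewrite -svd_prod (bigD1 (inord 1)) //= mulrC; apply: ler_wpM2r => //.
  rewrite -[leRHS]mulr1 (_ : s 0 ord0 ^+ k = \prod_(i < k.+1 | i != inord 1) s 0 ord0).
    by rewrite mulr1; apply: ler_prod => i _; rewrite s_ge0 s_sorted.
  by rewrite prodr_const cardC1 card_ord.
move=> h; rewrite -[leLHS]mul1r; apply: ler_wpM2r => //.
Qed.

End SingularValues.

Section Gap.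
Context {R : realType} {k : nat}.
Local Notation M := 'M[R]_k.+1.
Hypothesis hk : (1 <= k)%N.
Variable g : M.
Hypothesis detg : \det g = 1.

Let svd : exists U V, is_svd g U V (singular_values g).
Proof. exact: singular_valuesP. Qed.

Let s_gt0 i : 0 < singular_values g 0 i.
Proof. by have [U [V h]] := svd; exact: (svd_gt0 detg h). Qed.

Lemma sigma1E : sigma 1 g = ln (opnorm g).
Proof.
have [U [V h]] := svd; rewrite /sigma (opnorm_svd h); congr (ln (_ 0 _)).
by apply: val_inj; rewrite /= inordK.
Qed.

Lemma sigma_lastE : sigma k.+1 g = - ln (opnorm g^-1).
Proof.
have [U [V h]] := svd; rewrite /sigma (opnorm_svdV detg h) lnV ?posrE ?s_gt0 //.
by rewrite opprK; congr (ln (_ 0 _)); apply: val_inj; rewrite /= inordK.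
Qed.

Lemma sigma_le i j : (0 < i)%N -> (i <= j)%N -> (j <= k.+1)%N ->
  sigma j g <= sigma i g.
Proof.
move=> i0 ij jk; rewrite /sigma ler_ln ?posrE ?s_gt0 //.
by have [U [V [_ _ _ + _]]] := svd; apply; rewrite !inordK; lia.
Qed.

Lemma sigma_gap_ge0 : 0 <= sigma_gap g.
Proof. by rewrite le_min !subr_ge0 !sigma_le. Qed.

Lemma sigma_gap_le : sigma_gap g <= sigma 1 g - sigma k.+1 g.
Proof.
rewrite ge_min; apply/orP; left; rewrite lerD2l lerN2.
by apply: sigma_le.
Qed.

Let ln_ratio i j : singular_values g 0 i / singular_values g 0 j =
  expR (- (ln (singular_values g 0 j) - ln (singular_values g 0 i))).
Proof. by rewrite opprB expRB !lnK ?posrE. Qed.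

Let gap1_le : singular_values g 0 (inord 1) / singular_values g 0 ord0 <=
  expR (- sigma_gap g).
Proof.
rewrite ln_ratio ler_expR lerN2 ge_min; apply/orP; left.
by rewrite lerD2r /sigma (_ : inord 1.-1 = ord0) //; apply: val_inj; rewrite /= inordK.
Qed.

Let gap2_le : singular_values g 0 ord_max / singular_values g 0 (inord k.-1) <=
  expR (- sigma_gap g).
Proof.
rewrite ln_ratio ler_expR lerN2 ge_min; apply/orP; right.
rewrite lerD2l lerN2 /sigma (_ : inord k.+1.-1 = ord_max) //.
by apply: val_inj; rewrite /= inordK.
Qed.

Lemma almost_rank1_le (h : M) e e' : e <= e' -> almost_rank1 h e -> almost_rank1 h e'.
Proof.
move=> ee' [u [v [u1 v1 uv]]]; exists u, v; split => //; apply: le_trans uv _.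
by apply: ler_wpM2r => //; exact: opnorm_ge0.
Qed.

Lemma almost_rank1_gap : almost_rank1 g (expR (- sigma_gap g)).
Proof.
have [U [V h]] := svd; apply: almost_rank1_le gap1_le _.
exact: (almost_rank1_svd detg hk h).
Qed.

Lemma almost_rank1_gap_trV : almost_rank1 (g^T)^-1 (expR (- sigma_gap g)).
Proof.
have [U [V h]] := svd; apply: almost_rank1_le gap2_le _.
exact: (almost_rank1_svd_trV detg hk h).
Qed.

Lemma sigma_gap_le_ln : sigma_gap g <= k.+1%:R * ln (opnorm g).
Proof.
have [U [V h]] := svd.
have g0 : 0 < opnorm g by rewrite (opnorm_svd h).
rewrite -ler_expR mulrC expRM_natr lnK ?posrE // -(opprK (sigma_gap g)) expRN.
rewrite (opnorm_svd h); apply: le_trans (svd_gap_le detg h).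
by rewrite lef_pV2 ?posrE ?expR_gt0 ?divr_gt0.
Qed.

(** The approximating rank-one matrix is built from the first columns of a
decomposition; the first column of [U] spans the line of the Cartan flag. *)
Lemma svd_top : exists U V, [/\ is_svd g U V (singular_values g) &
   opnorm (g - opnorm g *: (col ord0 U *m (col ord0 V)^T)) <=
     expR (- sigma_gap g) * opnorm g].
Proof.
have [U [V h]] := svd; exists U, V; split => //.
apply: le_trans (svd_rank1 detg hk h) _.
by apply: ler_wpM2r; [exact: opnorm_ge0|exact: gap1_le].
Qed.

End Gap.

(** * Word length and norms in an Anosov group *)

Section Words.
Context {R : realType} {k : nat}.
Local Notation M := 'M[R]_k.+1.
Variables (Gam : set M) (S : seq M).
Hypothesis hGam : SL_subgroup Gam.
Hypothesis hS : generates Gam S.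

Lemma SL_det g : Gam g -> \det g = 1. Proof. by case: hGam => + _ _ _; apply. Qed.
Lemma SL_1 : Gam 1. Proof. by case: hGam. Qed.
Lemma SL_mul g h : Gam g -> Gam h -> Gam (g * h).
Proof. by case: hGam => _ _ + _; apply. Qed.
Lemma SL_inv g : Gam g -> Gam g^-1. Proof. by case: hGam => _ _ _; apply. Qed.

Lemma SL_unit g : Gam g -> g \is a GRing.unit.
Proof. by move=> /SL_det dg; rewrite unitmxE dg unitr1. Qed.

Lemma letter_in w x : is_word S w -> x \in w -> Gam x.
Proof.
move=> /allP ww /ww /orP[|] xS; first exact: hS.1.
by rewrite -(invrK x); apply/SL_inv/hS.1.
Qed.

Lemma word_in w : is_word S w -> Gam (\prod_(a <- w) a).
Proof.
move=> ww; rewrite big_seq; elim/big_ind: _ => [|g h|x]; first exact: SL_1.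
  exact: SL_mul.
exact: letter_in.
Qed.

Let lengths g := [set r : R | exists2 w, is_word S w &
  \prod_(a <- w) a = g /\ r = (size w)%:R].

Let lengths_lb g : has_lbound (lengths g).
Proof. by exists 0 => _ [w _ [_ ->]]. Qed.

Lemma word_length_le w : is_word S w ->
  word_length S (\prod_(a <- w) a) <= (size w)%:R.
Proof. by move=> ww; apply: (ge_inf (lengths_lb _)); exists w. Qed.

Definition geodesic w : Prop :=
  is_word S w /\ word_length S (\prod_(a <- w) a) = (size w)%:R.

Lemma geodesic_exists g : Gam g -> exists2 w, geodesic w & \prod_(a <- w) a = g.
Proof.
move=> Gg; pose Q n := `[< exists2 w, is_word S w &
  \prod_(a <- w) a = g /\ size w = n >].
have exQ : exists n, Q n.
  by have [w ww wg] := hS.2 _ Gg; exists (size w); apply/asboolP; exists w.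
case: (ex_minnP exQ) => n /asboolP[w ww [wg wn]] nmin.
exists w => //; split => //; apply/le_anti; rewrite word_length_le //=.
apply: lb_le_inf; first by exists (size w)%:R, w.
move=> _ [w' ww' [w'g ->]]; rewrite ler_nat wn; apply: nmin; apply/asboolP.
by exists w' => //; split => //; rewrite w'g.
Qed.

Lemma is_word_cat w w' : is_word S (w ++ w') = is_word S w && is_word S w'.
Proof. exact: all_cat. Qed.

(** A shorter word for the middle part would give a shorter word for the whole. *)
Lemma geodesic_infix w1 w2 w3 : geodesic (w1 ++ w2 ++ w3) -> geodesic w2.
Proof.
move=> [ww len]; move: (ww); rewrite !is_word_cat => /and3P[ww1 ww2 ww3].
split => //; apply/le_anti; rewrite word_length_le //=.
have [w [ww' len'] wE] := geodesic_exists (word_in ww2).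
rewrite -wE len' ler_nat leqNgt; apply/negP => lt.
have wwN : is_word S (w1 ++ w ++ w3) by rewrite !is_word_cat ww1 ww' ww3.
have := word_length_le wwN; rewrite !big_cat /= wE -!big_cat len ler_nat.
by rewrite !size_cat leq_add2l leq_add2r leqNgt lt.
Qed.

Lemma geodesic_take i w : geodesic w -> geodesic (take i w).
Proof. by rewrite -{1}(cat_take_drop i w) => /(@geodesic_infix [::]). Qed.

Lemma geodesic_drop i w : geodesic w -> geodesic (drop i w).
Proof.
rewrite -{1}(cat_take_drop i w) -{1}(cats0 (drop i w)).
exact: geodesic_infix.
Qed.

Lemma segprod_word (w : seq M) i j : (j <= size w)%N ->
  segprod (nth 1 w) i j = \prod_(a <- take (j - i) (drop i w)) a.
Proof.
move=> jw; have [ji|ij] := leqP j i.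
  by rewrite /segprod big_geq // (eqP ji) take0 big_nil.
rewrite (big_nth 1) size_takel ?size_drop ?leq_sub2r // /segprod.
rewrite -{1}(add0n i) big_addn; apply: eq_big_nat => l /andP[_ lt].
by rewrite nth_take // nth_drop addnC.
Qed.

(** The summand 2 makes the logarithm of the bound positive. *)
Definition letter_bound : R := 2 + \sum_(x <- S) (opnorm x + opnorm x^-1).
Local Notation K := letter_bound.

Lemma letter_bound_ge2 : 2 <= K.
Proof.
by rewrite lerDl sumr_ge0 // => x _; rewrite addr_ge0 ?opnorm_ge0.
Qed.

Lemma letter_bound_ge1 : 1 <= K.
Proof. by apply: le_trans letter_bound_ge2; rewrite ler1n. Qed.

Let letter_boundP x : x \in S -> opnorm x <= K /\ opnorm x^-1 <= K.
Proof.
move=> xS; rewrite /letter_bound (big_rem x) //=.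
have : 0 <= \sum_(y <- rem x S) (opnorm y + opnorm y^-1).
  by apply: sumr_ge0 => y _; rewrite addr_ge0 ?opnorm_ge0.
have := opnorm_ge0 x; have := opnorm_ge0 x^-1; lra.
Qed.

Section word.
Variable w : seq M.
Hypothesis ww : is_word S w.

Lemma nth_word_unit l : nth 1 w l \is a GRing.unit.
Proof.
have [lw|lw] := ltnP l (size w); last by rewrite nth_default ?unitr1.
exact/SL_unit/(letter_in ww)/mem_nth.
Qed.

Let nth_bound l : opnorm (nth 1 w l) <= K /\ opnorm (nth 1 w l)^-1 <= K.
Proof.
have [lw|lw] := ltnP l (size w); last first.
  by rewrite nth_default // invr1 opnorm1; split; exact: letter_bound_ge1.
move/allP: ww => /(_ _ (mem_nth 1 lw)) /orP[/letter_boundP//|/letter_boundP[]].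
by rewrite invrK.
Qed.

Lemma nth_word_le l : opnorm (nth 1 w l) <= K. Proof. by case: (nth_bound l). Qed.
Lemma nth_wordV_le l : opnorm (nth 1 w l)^-1 <= K. Proof. by case: (nth_bound l). Qed.

End word.

Lemma opnorm_word_length g : Gam g ->
  ln (opnorm g) <= ln K * word_length S g.
Proof.
move=> /geodesic_exists[w [ww len] <-]; rewrite len mulrC mulr_natl.
have K0 : 0 < K by apply: lt_le_trans letter_bound_ge1.
rewrite -lnXn // ler_ln ?posrE ?exprn_gt0 ?opnorm_gt0 ?SL_unit ?word_in //.
have := opnorm_segprod (nth_word_le ww) (leq0n (size w)).
by rewrite segprod_word // subn0 drop0 take_size.
exact: word_in.
Qed.

End Words.

Section Anosov.
Context {R : realType} {k : nat}.
Local Notation M := 'M[R]_k.+1.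
Variables (Gam : set M) (S : seq M).
Hypothesis hk : (1 <= k)%N.
Hypothesis hGam : SL_subgroup Gam.
Hypothesis hS : generates Gam S.
Hypothesis hQI : orbit_map_qi_embedding Gam S 1.
Hypothesis hgap : forall gam : nat -> M, injective gam -> (forall n, Gam (gam n)) ->
  (0 < limn_einf (fun n => (sigma_gap (gam n) / sigma_norm (gam n))%:E))%E.

Local Notation wl := (word_length S).

Lemma sigma_norm_ge_length : exists L C : R, [/\ 1 <= L, 0 <= C &
  forall g, Gam g -> L^-1 * wl g - C <= sigma_norm g].
Proof.
have [L [C [L1 C0 qi]]] := hQI; exists L, C; split => // g Gg.
have [+ _] := qi 1 g (SL_1 hGam) Gg.
by rewrite /word_dist /symspace_dist !invr1 !mul1r !mulr1 invr1 mul1r.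
Qed.

(** Otherwise some sequence of longer and longer elements would have a ratio of gap
to norm that tends to 0. *)
Let gap_vs_norm : exists m N : nat, forall g, Gam g -> N%:R <= wl g ->
  sigma_norm g <= m.+1%:R * sigma_gap g.
Proof.
apply/not_existsP => nex.
have ex m N : exists g, [/\ Gam g, N%:R <= wl g & m.+1%:R * sigma_gap g < sigma_norm g].
  apply/not_existsP => nex'; apply: (nex m); exists N => g Gg Ng.
  by rewrite leNgt; apply/negP => lt; apply: (nex' g).
have /boolp.choice[F FP] : forall mN : nat * nat, exists g,
    [/\ Gam g, mN.2%:R <= wl g & mN.1.+1%:R * sigma_gap g < sigma_norm g].
  by move=> [m N]; exact: ex.
(* Word lengths are made to increase strictly, so that the sequence is injective. *)
pose gam := fix gam n := if n is n'.+1 then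
  F (n'.+1, (Num.truncn (wl (gam n'))).+1) else F (0, 0)%N.
have gamP n : [/\ Gam (gam n) & n.+1%:R * sigma_gap (gam n) < sigma_norm (gam n)].
  by case: n => [|n] /=; [have [] := FP (0, 0)%N|
    have [] := FP (n.+1, (Num.truncn (wl (gam n))).+1)].
have incS n : wl (gam n) < wl (gam n.+1).
  have [_ + _] := FP (n.+1, (Num.truncn (wl (gam n))).+1).
  by apply: lt_le_trans; rewrite /= truncnS_gt.
have inc : {homo (fun n => wl (gam n)) : m n / (m < n)%N >-> m < n}.
  by apply: homo_ltn => // x y z; exact: lt_trans.
have inj : injective gam.
  move=> m n e; case: (ltngtP m n) => // /inc /=; rewrite e ltxx //.
have := hgap inj (fun n => (gamP n).1).
suff h : (sigma_gap (gam n) / sigma_norm (gam n))%:E @[n --> \oo] --> (0%:E : \bar R).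
  rewrite (cvg_limn_einf_sup h).1 ltxx //.
apply: cvg_EFin; first by near=> n.
apply: (@squeeze_cvgr _ _ _ _ (fun=> 0) (fun n => n.+1%:R^-1)); last 2 first.
- exact: cvg_cst.
- exact: cvg_harmonic.
near=> n; have [Gn gn] := gamP n.
have g0 := sigma_gap_ge0 hk (SL_det hGam Gn).
have n0 : 0 < sigma_norm (gam n) by apply: le_lt_trans gn; rewrite mulr_ge0.
rewrite divr_ge0 ?(ltW n0) //= ler_pdivrMr // ler_pdivlMl //.
exact: ltW.
Unshelve. all: by end_near. Qed.

Lemma gap_ge_length : exists c D : R, [/\ 0 < c, 0 <= D &
  forall g, Gam g -> c * wl g - D <= sigma_gap g].
Proof.
have [L [C [L1 C0 qi]]] := sigma_norm_ge_length.
have [m [N mN]] := gap_vs_norm.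
have L0 : 0 < L by lra.
have m0 : 0 < m.+1%:R :> R by rewrite ltr0n.
have [c cE] : exists c, c = L^-1 / m.+1%:R by exists (L^-1 / m.+1%:R).
have c0 : 0 < c by rewrite cE divr_gt0 ?invr_gt0.
have Cm : 0 <= C / m.+1%:R by rewrite divr_ge0 // ltW.
have cN : 0 <= c * N%:R by rewrite mulr_ge0 // ltW.
exists c, (C / m.+1%:R + c * N%:R); split => //; first exact: addr_ge0.
move=> g Gg; have [/(mN g Gg) h|/ltW lt] := leP N%:R (wl g).
  have : (L^-1 * wl g - C) / m.+1%:R <= sigma_gap g.
    by rewrite ler_pdivrMr // mulrC (mulrC (sigma_gap g)); apply: le_trans h; rewrite mulrC qi.
  have -> : (L^-1 * wl g - C) / m.+1%:R = c * wl g - C / m.+1%:R.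
    by rewrite cE; field; rewrite !gt_eqF.
  by apply: le_trans; rewrite lerD2l lerN2 lerDl.
have : c * wl g <= c * N%:R by rewrite ler_pM2l.
move=> h; apply: le_trans (sigma_gap_ge0 hk (SL_det hGam Gg)).
by rewrite subr_le0; apply: le_trans h _; rewrite lerDr.
Qed.

Lemma gap_decay : exists C r : R, [/\ 0 <= C, 0 < r < 1 &
  forall g n, Gam g -> n%:R <= wl g -> expR (- sigma_gap g) <= C * r ^+ n].
Proof.
have [c [D [c0 D0 h]]] := gap_ge_length.
exists (expR D), (expR (- c)); split.
- exact: expR_ge0.
- by rewrite expR_gt0 -[X in _ < X]expR0 ltr_expR oppr_lt0.
move=> g n Gg ng; rewrite -expRM_natr -expRD ler_expR.
have : c * n%:R <= c * wl g by rewrite ler_pM2l.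
by have := h g Gg; lra.
Qed.

Lemma ln_opnorm_ge_length : exists c D : R, [/\ 0 < c, 0 <= D &
  forall g, Gam g -> c * wl g - D <= ln (opnorm g)].
Proof.
have [c [D [c0 D0 h]]] := gap_ge_length.
have k0 : 0 < k.+1%:R :> R by rewrite ltr0n.
exists (c / k.+1%:R), (D / k.+1%:R); split; rewrite ?divr_gt0 ?divr_ge0 //.
move=> g Gg; have := sigma_gap_le_ln (SL_det hGam Gg); have := h g Gg => h1 h2.
rewrite (_ : _ - _ = (c * wl g - D) / k.+1%:R); last by field; rewrite gt_eqF.
rewrite ler_pdivrMr //; apply: le_trans h1 _; by rewrite mulrC.
Qed.

Local Notation K := (letter_bound S).


Let geo_seg w i j : geodesic S w -> (i <= j <= size w)%N ->
  Gam (segprod (nth 1 w) i j) /\ (j - i)%:R <= wl (segprod (nth 1 w) i j).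
Proof.
move=> gw /andP[ij jw]; rewrite segprod_word //.
have [ww len] := geodesic_take hGam hS (j - i) (geodesic_drop hGam hS i gw).
by split; [exact: (word_in hGam hS)|rewrite len size_takel // size_drop leq_sub2r].
Qed.

Let dominated_seg C r : (forall g n, Gam g -> n%:R <= wl g ->
    expR (- sigma_gap g) <= C * r ^+ n) ->
  forall w, geodesic S w -> forall i j, (i <= j <= size w)%N ->
    almost_rank1 (segprod (nth 1 w) i j) (C * r ^+ (j - i)).
Proof.
move=> dec w gw i j ijw; have [Gij lij] := geo_seg gw ijw.
apply: almost_rank1_le (dec _ _ Gij lij) _.
by have := almost_rank1_gap hk (SL_det hGam Gij).
Qed.

(** Segments of a geodesic word are geodesic, so the gap hypothesis makes all of
them exponentially close to rank one and [dominated_tau_ge] applies. *)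
Lemma geodesic_tau : exists2 t0 : R, 0 < t0 & forall w i, geodesic S w ->
  (i <= size w)%N -> t0 <= tau (\prod_(a <- take i w) a) (\prod_(a <- drop i w) a).
Proof.
have [C [r [C0 r01 dec]]] := gap_decay.
have [t0 t00 ht] := dominated_tau_ge k (letter_bound_ge1 S) C0 r01.
exists t0 => // w i gw iw; have ww := gw.1.
have := ht _ (size w) (nth_word_unit hGam hS ww) (nth_word_le ww)
  (nth_wordV_le ww) (dominated_seg dec gw) 0 i (size w) (leq0n i).
rewrite iw leqnn => /(_ isT); rewrite !segprod_word // subn0 drop0.
by rewrite -size_drop take_size.
Qed.

(** For elements of the group this is [sigma 1 g - sigma k.+1 g], see [omegaE]. *)
Definition omega (g : M) : R := ln (opnorm g) + ln (opnorm g^-1).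

(** The hypothesis controls the largest singular value of [g h], and the conclusion
also the smallest one.  The link is the geometry of the group: the concatenation of
geodesic words for [g] and [h] is a quasigeodesic, because [tau] stays bounded
below when the two words are shortened, so that every subword has exponentially
large norm and hence word length linear in its number of letters.  All subwords
therefore have a large gap, and so do their inverse transposes, to which
[dominated_tau_ge] applies as well. *)
Lemma omega_superadd (tau0 : R) : 0 < tau0 ->
  exists C : R, forall g h, Gam g -> Gam h -> tau0 <= tau g h ->
    omega g + omega h - C <= omega (g * h).
Proof.
move=> tau00.
have [C [r [C0 r01 dec]]] := gap_decay.
have [c [D [c0 D0 lnge]]] := ln_opnorm_ge_length.
have [c' [D' [c'0 D'0 gapge]]] := gap_ge_length.
have /andP[r0 r1] := r01.
have K1 := letter_bound_ge1 S; have K2 := letter_bound_ge2 S.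
have K0 : 0 < K by apply: lt_le_trans K1.
have lnK0 : 0 < ln K by rewrite ln_gt0 //; apply: lt_le_trans K2; rewrite ltr1n.
pose C1 := 3 * K ^+ 2 * C / (1 - r).
have C10 : 0 <= C1.
  by rewrite /C1 divr_ge0 ?subr_ge0 ?(ltW r1) // !mulr_ge0 ?exprn_ge0 // ltW.
have [N hN] : exists N, 2 * C1 * r ^+ N <= tau0 / 2.
  have : (fun l => 2 * C1 * r ^+ l) @ \oo --> (2 * C1 * 0 : R).
    by apply: cvgM; [exact: cvg_cst|apply: cvg_expr; rewrite ger0_norm // ltW].
  rewrite mulr0 => /cvgr0_norm_le /(_ (tau0 / 2)) [].
    by rewrite divr_gt0.
  move=> N _ /(_ N (leqnn N)) h; exists N; apply: le_trans h; exact: ler_norm.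
(* If both remaining factors have at least N letters, tau is still tau0 / 2;
otherwise the trivial bound for a factor with fewer than N letters is used. *)
pose tau1 := Num.min (tau0 / 2) (K ^+ (2 * N))^-1.
have tau10 : 0 < tau1 by rewrite lt_min divr_gt0 //= invr_gt0 exprn_gt0.
(* Quasigeodesic constants: the minimum with 1 covers the subwords that stay in
one of the two geodesic words. *)
pose c2 := Num.min 1 (c / ln K).
have c20 : 0 < c2 by rewrite lt_min ltr01 divr_gt0.
pose D2 := Num.max 0 ((2 * D - ln tau1) / ln K).
have D20 : 0 <= D2 by rewrite le_max lexx.
pose C' := expR (D' + c' * D2); pose r' := expR (- (c' * c2)).
have C'0 : 0 <= C' by exact: expR_ge0.
have r'01 : 0 < r' < 1.
  by rewrite expR_gt0 -[X in _ < X]expR0 ltr_expR oppr_lt0 mulr_gt0.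
have [t0 t00 ht] := dominated_tau_ge k K1 C'0 r'01.
exists (- ln tau0 - ln t0) => g h Gg Gh tgh.
have [wg gwg wgE] := geodesic_exists hS Gg.
have [wh gwh whE] := geodesic_exists hS Gh.
pose w := wg ++ wh; pose p := size wg; pose n := size w.
have ww : is_word S w by rewrite is_word_cat gwg.1 gwh.1.
have pn : (p <= n)%N by rewrite /n /w size_cat leq_addr.
pose a := nth 1 w.
have au := nth_word_unit hGam hS ww.
have aK := nth_word_le ww; have aVK := nth_wordV_le ww.
have segl i j : (j <= p)%N -> segprod a i j = segprod (nth 1 wg) i j.
  move=> jp; apply: eq_big_nat => l /andP[_ lj].
  by rewrite /a /w nth_cat (leq_trans lj jp).
have segr i j : segprod a (p + i) (p + j) = segprod (nth 1 wh) i j.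
  rewrite /segprod (addnC p i) (addnC p j) big_addn addnK.
  by apply: eq_bigr => l _; rewrite /a /w nth_cat ltnNge leq_addl /= addnK.
have sP i j : segprod a i j = \prod_(i <= l < j) a l by [].
have geol i j : (i <= j <= p)%N ->
    Gam (segprod a i j) /\ (j - i)%:R <= wl (segprod a i j).
  by move=> /andP[ij jp]; rewrite segl //; apply: geo_seg => //; rewrite ij.
have geor i j : (p <= i)%N -> (i <= j <= n)%N ->
    Gam (segprod a i j) /\ (j - i)%:R <= wl (segprod a i j).
  move=> pi /andP[ij jn].
  rewrite -(subnKC pi) -(subnKC (leq_trans pi ij)) segr subnDl.
  apply: geo_seg => //; rewrite leq_sub2r //= leq_subLR.
  by rewrite /n /w size_cat in jn.
have domgeo i j : Gam (segprod a i j) -> (j - i)%:R <= wl (segprod a i j) ->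
    almost_rank1 (segprod a i j) (C * r ^+ (j - i)).
  move=> Gij lij; apply: almost_rank1_le (dec _ _ Gij lij) _.
  by have := almost_rank1_gap hk (SL_det hGam Gij).
have gE : g = segprod a 0 p.
  by rewrite segl // segprod_word // subn0 drop0 take_size.
have hE : h = segprod a p n.
  have := segr 0 (size wh); rewrite addn0 -size_cat => ->.
  by rewrite segprod_word // subn0 drop0 take_size.
have tau1_le i j : (i <= p)%N -> (p <= j <= n)%N ->
    tau1 <= tau (segprod a i p) (segprod a p j).
  move=> ip /andP[pj jn].
  have small d : (d < N)%N -> (K ^+ (2 * N))^-1 <= (K ^+ (2 * d))^-1.
    move=> dN; rewrite lef_pV2 ?posrE ?exprn_gt0 //.
    by apply: ler_weXn2l => //; rewrite leq_mul2l /= ltnW.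
  have ipj : (i <= p <= j)%N by rewrite ip.
  rewrite ge_min; have [/small st|Nl] := ltnP (p - i) N.
    by apply/orP; right; apply: le_trans st _; exact: (tau_ge_left au aK aVK K1).
  have [/small st|Nr] := ltnP (j - p) N.
    by apply/orP; right; apply: le_trans st _; exact: (tau_ge_right au aK aVK K1).
  apply/orP; left.
  have e1 : `|tau (segprod a 0 p) (segprod a p j) -
      tau (segprod a i p) (segprod a p j)| <= C1 * r ^+ (p - i).
    apply: (tau_prefix au aK aVK K1 C0 r0 r1) => //; first exact: (segprod_unit au).
    by move=> l /andP[_ lp]; have [? ?] := geol l p ltac:(by rewrite lp leqnn); exact: domgeo.
  have e2 : `|tau (segprod a 0 p) (segprod a p n) -
      tau (segprod a 0 p) (segprod a p j)| <= C1 * r ^+ (j - p).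
    apply: (tau_suffix au aK aVK K1 C0 r0 r1); first by rewrite pj.
      exact: (segprod_unit au).
    by move=> l pln; have [? ?] := geor p l (leqnn p) pln; exact: domgeo.
  have rN d : (N <= d)%N -> C1 * r ^+ d <= C1 * r ^+ N.
    move=> Nd; apply: ler_wpM2l => //.
    by apply: ler_wiXn2l; rewrite ?(ltW r0) ?(ltW r1).
  have e3 := rN _ Nl; have e4 := rN _ Nr.
  have tgh' : tau0 <= tau (segprod a 0 p) (segprod a p n) by rewrite -gE -hE.
  move: e1 e2; rewrite !ler_norml => /andP[_ e1] /andP[_ e2].
  move: hN; rewrite -mulrA; lra.
have Gseg i j : Gam (segprod a i j).
  rewrite /segprod; elim/big_ind: _ => [|x y|l _]; first exact: (SL_1 hGam).
    exact: (SL_mul hGam).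
  have [lw|lw] := ltnP l (size w); last by rewrite /a nth_default //; exact: (SL_1 hGam).
  by apply: (letter_in hGam hS ww); exact: mem_nth.
have len i j : (i <= j <= n)%N -> c2 * (j - i)%:R - D2 <= wl (segprod a i j).
  move=> /andP[ij jn].
  have triv : (j - i)%:R <= wl (segprod a i j) ->
      c2 * (j - i)%:R - D2 <= wl (segprod a i j).
    apply: le_trans; rewrite lerBlDr; apply: (@le_trans _ _ (1 * (j - i)%:R)).
      by apply: ler_wpM2r => //; rewrite ge_min lexx.
    by rewrite mul1r lerDl.
  have [jp|pj] := leqP j p; first by apply/triv/(geol i j _).2; rewrite ij.
  have [pi|ip] := leqP p i; first by apply/triv/(geor i j _ _).2; rewrite ?ij.
  have [_ l1] := geol i p ltac:(by rewrite (ltnW ip) leqnn).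
  have [_ l2] := geor p j (leqnn p) ltac:(by rewrite (ltnW pj) jn).
  have Pij : segprod a i j = segprod a i p * segprod a p j.
    by apply: segprodM; rewrite (ltnW ip) ltnW.
  have t1 := tau1_le i j (ltnW ip) ltac:(by rewrite (ltnW pj) jn).
  have n1 := segprod_gt0 au i p; have n2 := segprod_gt0 au p j.
  have h1 := lnge _ (Gseg i p); have h2 := lnge _ (Gseg p j).
  have h3 := opnorm_word_length hGam hS (Gseg i j).
  have h4 : ln tau1 + (ln (opnorm (segprod a i p)) + ln (opnorm (segprod a p j)))
      <= ln (opnorm (segprod a i j)).
    rewrite -!lnM ?posrE ?mulr_gt0 // ler_ln ?posrE ?mulr_gt0 ?(segprod_gt0 au) //.
    by rewrite -ler_pdivlMr ?mulr_gt0 // Pij.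
  have h5 : c * (p - i)%:R <= c * wl (segprod a i p) by rewrite ler_pM2l.
  have h6 : c * (j - p)%:R <= c * wl (segprod a p j) by rewrite ler_pM2l.
  have h7 : (j - i)%:R = (p - i)%:R + (j - p)%:R :> R.
    by rewrite -natrD; congr (_%:R); clear -ip pj; lia.
  have h8 : c / ln K * (j - i)%:R - (2 * D - ln tau1) / ln K <=
      wl (segprod a i j).
    rewrite (_ : _ - _ = (c * (j - i)%:R - (2 * D - ln tau1)) / ln K); last first.
      by field; rewrite gt_eqF.
    rewrite ler_pdivrMr // (mulrC (wl _)); apply: le_trans h3; rewrite h7 mulrDr.
    by move: h1 h2 h4 h5 h6; lra.
  apply: le_trans h8; apply: lerB.
    by apply: ler_wpM2r => //; rewrite ge_min lexx orbT.
  by rewrite le_max lexx orbT.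
pose b l := ((a l)^T)^-1.
have trV_unit (x : M) : x \is a GRing.unit -> (x^T)^-1 \is a GRing.unit.
  by move=> xu; rewrite unitrV unitmx_tr.
have trVM (x y : M) : x \is a GRing.unit -> y \is a GRing.unit ->
    ((x * y)^T)^-1 = (x^T)^-1 * (y^T)^-1.
  by move=> xu yu; rewrite -mulmxE trmx_mul mulmxE invrM ?unitmx_tr.
have opn_trV (x : M) : opnorm (x^T)^-1 = opnorm x^-1.
  by rewrite -[(x^T)^-1]/(invmx x^T) -trmx_inv opnorm_tr.
have bseg i j : segprod b i j = ((segprod a i j)^T)^-1.
  rewrite /segprod; elim: (index_iota i j) => [|l s IH].
    by rewrite !big_nil trmx1 invr1.
  rewrite !big_cons (trVM _ _ (au l)) ?IH //.
  by apply: rpred_prod => m _; exact: au.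
have bu l : b l \is a GRing.unit by apply: trV_unit; exact: au.
have bK l : opnorm (b l) <= K by rewrite opn_trV; exact: aVK.
have bVK l : opnorm (b l)^-1 <= K.
  by rewrite /b invrK opnorm_tr; exact: aK.
have bdom i j : (i <= j <= n)%N ->
    almost_rank1 (segprod b i j) (C' * r' ^+ (j - i)).
  move=> ijn; rewrite bseg.
  apply: almost_rank1_le (almost_rank1_gap_trV hk (SL_det hGam (Gseg i j))).
  rewrite /C' /r' -expRM_natr -expRD ler_expR.
  have h1 := gapge _ (Gseg i j).
  have h2 : c' * (c2 * (j - i)%:R - D2) <= c' * wl (segprod a i j).
    by rewrite ler_pM2l // len.
  by move: h1 h2; lra.
have tb : t0 <= tau (segprod b 0 p) (segprod b p n).
  by apply: (ht b n bu bK bVK bdom); rewrite ?pn ?leqnn.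
have gu := SL_unit hGam Gg; have hu := SL_unit hGam Gh.
have gV : g^-1 \is a GRing.unit by rewrite unitrV.
have hV : h^-1 \is a GRing.unit by rewrite unitrV.
have tV : t0 * (opnorm g^-1 * opnorm h^-1) <= opnorm (g * h)^-1.
  rewrite -ler_pdivlMr ?mulr_gt0 ?opnorm_gt0 //; apply: le_trans tb _.
  by rewrite !bseg -gE -hE /tau mulmxE -trVM // !opn_trV.
have tM : tau0 * (opnorm g * opnorm h) <= opnorm (g * h).
  by rewrite -ler_pdivlMr ?mulr_gt0 ?opnorm_gt0.
have ghu : g * h \is a GRing.unit by rewrite unitrMr.
have ghV : (g * h)^-1 \is a GRing.unit by rewrite unitrV.
have l1 : ln tau0 + (ln (opnorm g) + ln (opnorm h)) <= ln (opnorm (g * h)).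
  by rewrite -!lnM ?posrE ?mulr_gt0 ?opnorm_gt0 // ler_ln ?posrE ?mulr_gt0 ?opnorm_gt0.
have l2 : ln t0 + (ln (opnorm g^-1) + ln (opnorm h^-1)) <= ln (opnorm (g * h)^-1).
  by rewrite -!lnM ?posrE ?mulr_gt0 ?opnorm_gt0 // ler_ln ?posrE ?mulr_gt0 ?opnorm_gt0.
by rewrite /omega; lra.
Qed.

End Anosov.

(** * Lines, flags and the limit set *)

Section OrthProj.
Context {R : realType} {k : nat}.
Local Notation M := 'M[R]_k.+1.
Local Notation VS := {vspace 'cV[R]_k.+1}.
Implicit Types (P U : M) (W : VS) (Q : pred 'I_k.+1).

Lemma mulmx_ext (A B : M) : (forall w : 'cV[R]_k.+1, A *m w = B *m w) -> A = B.
Proof.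
move=> AB; apply/matrixP => i j.
by have /colP/(_ i) := AB (delta_mx j 0); rewrite -!colE !mxE.
Qed.

Lemma lin_actE (g : M) w : lin_act g w = g *m w.
Proof. by rewrite lfunE. Qed.

(** Two symmetric idempotents with the same image absorb each other on either
side, by transposition, and are therefore equal. *)
Lemma orthproj_eq W P :
  P^T = P -> P *m P = P -> limg (lin_act P) = W -> orthproj W = P.
Proof.
move=> PT PP PW.
have [PT' PP' PW'] : [/\ (orthproj W)^T = orthproj W,
    orthproj W *m orthproj W = orthproj W & limg (lin_act (orthproj W)) = W].
  apply: (@xgetPex _ 0 [set P | [/\ P^T = P, P *m P = P & limg (lin_act P) = W]]).
  by exists P.
have absorb A B : A *m A = A -> limg (lin_act A) = W -> limg (lin_act B) = W ->
    A *m B = B.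
  move=> AA AW BW; apply: mulmx_ext => w; rewrite -mulmxA.
  have : lin_act B w \in limg (lin_act A) by rewrite AW -BW memv_img ?memvf.
  by move=> /memv_imgP[z _]; rewrite !lin_actE => ->; rewrite mulmxA AA.
rewrite -{1}(absorb _ _ PP PW PW') -[in LHS]PT -{1}PT' -trmx_mul.
by rewrite (absorb _ _ PP' PW' PW) PT.
Qed.

(** The line and the hyperplane of a Cartan flag are both spanned by some of the
columns of an orthogonal matrix; the predicate [Q] selects them. *)
Definition colproj U Q : M := U *m diag_mx (\row_i (Q i)%:R) *m U^T.

Definition colspan U Q : VS := (\sum_(i < k.+1 | Q i) <[col i U]>)%VS.

Section orth.
Variables (U : M) (Q : pred 'I_k.+1).
Hypothesis oU : U *m U^T = 1%:M.

Lemma colproj_col i : colproj U Q *m col i U = (Q i)%:R *: col i U.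
Proof. by rewrite /colproj svd_mul_col // mxE. Qed.

Lemma colprojE w : colproj U Q *m w = \sum_(i | Q i) dot (col i U) w *: col i U.
Proof.
apply/colP => x; rewrite /colproj -!mulmxA mxE summxE [RHS]big_mkcond /=.
apply: eq_bigr => i _; rewrite mul_diag_mx !mxE.
rewrite dotE; under [in RHS]eq_bigr do rewrite mxE.
case: (Q i); last by rewrite mul0r mulr0.
rewrite mul1r mulrC; congr (_ * _).
by apply: eq_bigr => j _; rewrite mxE.
Qed.

Lemma orthproj_colspan : orthproj (colspan U Q) = colproj U Q.
Proof.
apply: orthproj_eq.
- by rewrite /colproj !trmx_mul trmxK tr_diag_mx mulmxA.
- apply: mulmx_ext => w; rewrite -mulmxA (colprojE w) mulmx_sumr.
  by apply: eq_bigr => i Qi; rewrite -scalemxAr colproj_col Qi scale1r.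
apply/vspaceP => w; apply/idP/idP.
  move=> /memv_imgP[z _ ->]; rewrite lin_actE colprojE.
  by apply: memv_sumr => i Qi; rewrite memvZ ?memv_line.
move=> /memv_sumP[f fi ->]; apply: memv_suml => i Qi.
have /vlineP[a ->] := fi i Qi; rewrite memvZ //.
have <- : lin_act (colproj U Q) (col i U) = col i U.
  by rewrite lin_actE colproj_col Qi scale1r.
by rewrite memv_img ?memvf.
Qed.

Lemma orth_expand w : \sum_i dot (col i U) w *: col i U = w.
Proof.
apply/colP => x; rewrite -[in RHS](mul1mx w) -oU -mulmxA mxE summxE.
apply: eq_bigr => i _; rewrite !mxE dotE mulrC; congr (_ * _).
by apply: eq_bigr => j _; rewrite !mxE.
Qed.

(** The selected columns and the remaining ones together span the whole space, so
neither of the two spans can be smaller than expected. *)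
Lemma dim_colspan : \dim (colspan U Q) = #|Q|.
Proof.
have col0 i : col i U != 0 by rewrite -enorm_gt0 enorm_orth_col.
have le1 (T : pred 'I_k.+1) : (\dim (\sum_(i < k.+1 | T i) <[col i U]>) <= #|T|)%N.
  apply: leq_trans (dimv_leq_sum _ _ _) _; rewrite -sum1_card.
  by apply: eq_leq; apply: eq_bigr => i _; rewrite dim_vline col0.
apply/eqP; rewrite eqn_leq le1 /=.
have full : (fullv <= colspan U Q + \sum_(i < k.+1 | ~~ Q i) <[col i U]>)%VS.
  apply/subvP => w _.
  have -> : w = colproj U Q *m w + \sum_(i | ~~ Q i) dot (col i U) w *: col i U.
    by rewrite colprojE -[LHS]orth_expand (bigID Q).
  apply: memv_add; first by rewrite colprojE; apply: memv_sumr => i _; rewrite memvZ ?memv_line.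
  by apply: memv_sumr => i _; rewrite memvZ ?memv_line.
have := leq_trans (dimvS full) (leq_trans (dimv_add_leqif _ _) (leq_add (leqnn _) (le1 (predC Q)))).
rewrite dimvf /dim /= muln1 => h2.
by move: h2; rewrite -[X in (X <= _)%N]card_ord -(cardC Q) leq_add2r.
Qed.

End orth.

Lemma mxcvg_colproj (U : nat -> M) U0 Q : mxcvg U U0 ->
  mxcvg (fun n => colproj (U n) Q) (colproj U0 Q).
Proof.
move=> UU; apply: mxcvg_mul (mxcvg_tr UU).
by apply: mxcvg_mul => //; exact: mxcvg_cst.
Qed.

Lemma colspan_line U : colspan U (pred1 ord0) = <[col ord0 U]>%VS.
Proof. by rewrite /colspan big_pred1_eq. Qed.

Lemma col_flag_exists U : (1 <= k)%N -> U *m U^T = 1%:M -> exists F : flag R k,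
  (val F).1 = <[col ord0 U]>%VS /\
  (val F).2 = (\sum_(i < k.+1 | (i < k)%N) <[col i U]>)%VS.
Proof.
move=> k1 oU.
have d1 : \dim (colspan U (pred1 ord0)) == 1%N by rewrite dim_colspan // card1.
have d2 : \dim (colspan U (fun i => (i < k)%N)) == k.
  rewrite dim_colspan // -[X in _ == X](_ : #|predC1 (@ord_max k)| = k).
    apply/eqP/eq_card => i; rewrite !inE; have := ltn_ord i.
    by rewrite -val_eqE /= unfold_in ltnS leq_eqVlt; case: eqP => [->|]; rewrite ?ltnn.
  by rewrite cardC1 card_ord.
have sub : (colspan U (pred1 ord0) <= colspan U (fun i => (i < k)%N))%VS.
  by rewrite colspan_line; apply: (sumv_sup ord0).
have FP : [&& \dim (colspan U (pred1 ord0)) == 1%N,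
    \dim (colspan U (fun i => (i < k)%N)) == k &
    (colspan U (pred1 ord0) <= colspan U (fun i => (i < k)%N))%VS].
  by rewrite d1 d2 sub.
exists (exist _ (colspan U (pred1 ord0), colspan U (fun i => (i < k)%N)) FP).
by rewrite /= colspan_line.
Qed.

Lemma orthproj_line (x : 'cV[R]_k.+1) : enorm x = 1 ->
  orthproj <[x]>%VS = x *m x^T.
Proof.
move=> x1; have xx : x^T *m x = 1%:M.
  by rewrite [_ *m _]mx11_scalar -/(dot x x) -enorm_sqr x1 expr1n.
apply: orthproj_eq; first by rewrite trmx_mul trmxK.
  by rewrite mulmxA -(mulmxA x) xx mulmx1.
apply/vspaceP => w; apply/idP/idP.
  move=> /memv_imgP[z _ ->]; rewrite lin_actE mulmx_dot.
  by rewrite memvZ ?memv_line.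
move=> /vlineP[a ->]; rewrite memvZ //.
have xl : x = lin_act (x *m x^T) x by rewrite lin_actE -mulmxA xx mulmx1.
by rewrite {1}xl memv_img ?memvf.
Qed.

Lemma line_vline (W : VS) x : \dim W = 1%N -> x != 0 -> x \in W -> W = <[x]>%VS.
Proof.
move=> d1 x0 xW; apply/esym/eqP.
by rewrite eqEdim -memvE xW d1 dim_vline x0.
Qed.

End OrthProj.

Section Chord.
Context {R : realType} {n : nat}.
Implicit Types x y z : 'cV[R]_n.

(** The chordal distance of projective space, written with unit vectors that are
only determined up to sign by the lines that they span. *)
Definition chord x y : R := Num.min (enorm (x - y)) (enorm (x + y)).

Lemma chord_sign x y : exists b : bool, chord x y = enorm (x - (-1) ^+ b *: y).
Proof.
rewrite /chord; case: leP => _; first by exists false; rewrite expr0 scale1r.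
by exists true; rewrite expr1 scaleN1r opprK.
Qed.

Lemma chord_le x y (b : bool) : chord x y <= enorm (x - (-1) ^+ b *: y).
Proof.
rewrite /chord ge_min; case: b; last by rewrite expr0 scale1r lexx.
by rewrite expr1 scaleN1r opprK lexx orbT.
Qed.

Lemma chordC x y : chord x y = chord y x.
Proof. by rewrite /chord enorm_distC (addrC x). Qed.

Lemma chord_ge0 x y : 0 <= chord x y.
Proof. by rewrite le_min !enorm_ge0. Qed.

Lemma enorm_sign (b : bool) x : enorm ((-1) ^+ b *: x) = enorm x.
Proof. by rewrite enormZ normr_sign mul1r. Qed.

Lemma chord_trans x y z : chord x z <= chord x y + chord y z.
Proof.
have [b ->] := chord_sign x y; have [c ->] := chord_sign y z.
have := chord_le x z (b (+) c); rewrite signr_addb -scalerA => /le_trans; apply.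
have -> : x - (-1) ^+ b *: ((-1) ^+ c *: z) =
  (x - (-1) ^+ b *: y) + (-1) ^+ b *: (y - (-1) ^+ c *: z).
  by rewrite scalerBr addrA subrK.
by apply: le_trans (enormD _ _) _; rewrite enorm_sign.
Qed.

(** Evaluating the difference of the two projections at [x] gives
[1 - (dot x y) ^ 2], which dominates half of the squared chordal distance. *)
Lemma chord_sqr_le x y : enorm x = 1 -> enorm y = 1 ->
  chord x y ^+ 2 <= 2 * n%:R ^+ 2 * `|x *m x^T - y *m y^T|.
Proof.
move=> x1 y1.
have xx : dot x x = 1 by rewrite -enorm_sqr x1 expr1n.
have yy : dot y y = 1 by rewrite -enorm_sqr y1 expr1n.
pose d := `|dot x y|.
have d1 : d <= 1 by have := cauchy_schwarz x y; rewrite x1 y1 mulr1.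
have d0 : 0 <= d by exact: normr_ge0.
have h1 : chord x y ^+ 2 <= 2 - 2 * d.
  pose b := dot x y < 0.
  apply: (@le_trans _ _ (enorm (x - (-1) ^+ b *: y) ^+ 2)).
    by rewrite ler_pXn2r ?nnegrE ?chord_ge0 ?enorm_ge0 // chord_le.
  rewrite enorm_sqr !(dotBl, dotBr, dotZl, dotZr) xx yy (dotC y x).
  rewrite /d /b; case: ltP => [/ltr0_norm|/ger0_norm] ->.
    by rewrite expr1; lra.
  by rewrite expr0; lra.
have h2 : 1 - d ^+ 2 <= n%:R ^+ 2 * `|x *m x^T - y *m y^T|.
  have -> : 1 - d ^+ 2 = dot x ((x *m x^T - y *m y^T) *m x).
    rewrite mulmxBl !mulmx_dot dotBr !dotZr xx (dotC y x) mulr1 /d.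
    by rewrite real_normK ?num_real // expr2.
  rewrite dotE; apply: le_trans (ler_norm _) _.
  apply: le_trans (ler_norm_sum _ _ _) _.
  have le1 i : `|x i 0| <= 1 by rewrite -x1 enorm_coord.
  apply: (@le_trans _ _ (\sum_(i < n) n%:R * `|x *m x^T - y *m y^T|)); last first.
    by rewrite sumr_const card_ord -(mulr_natl (n%:R * _)) mulrA expr2.
  apply: ler_sum => i _; rewrite normrM -[leRHS]mul1r; apply: ler_pM => //.
  rewrite mxE; apply: le_trans (ler_norm_sum _ _ _) _.
  apply: (@le_trans _ _ (\sum_(j < n) `|x *m x^T - y *m y^T|)); last first.
    by rewrite sumr_const card_ord -(mulr_natl `|_|).
  apply: ler_sum => j _; rewrite normrM -[leRHS]mulr1; apply: ler_pM => //.
  rewrite [leRHS]/Num.Def.normr/= mx_normrE.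
  exact: (le_bigmax _ (fun ij => `|(x *m x^T - y *m y^T) ij.1 ij.2|) (i, j)).
have h3 : d ^+ 2 <= d by rewrite expr2 ler_piMl.
by move: h1 h2; rewrite -mulrA; lra.
Qed.

End Chord.

Section Limit.
Context {R : realType} {k : nat}.
Local Notation M := 'M[R]_k.+1.
Variables (Gam : set M).
Hypothesis hk : (1 <= k)%N.
Hypothesis hGam : SL_subgroup Gam.

(** Limit lines are handled through unit vectors. *)
Definition in_limit_line (x : 'cV[R]_k.+1) : Prop :=
  enorm x = 1 /\ exists2 F, limit_set Gam F & x \in (val F).1.

Lemma limit_line_approx x T e : in_limit_line x -> 0 < e ->
  exists g U V s, [/\ Gam g, is_svd g U V s, T <= sigma_gap g &
    chord x (col ord0 U) <= e].
Proof.
move=> [x1 [F [gam [Fn [Ggam gapoo cart dist]]] xF]] e0.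
have FE : (val F).1 = <[x]>%VS.
  apply: line_vline xF; last by rewrite -enorm_gt0 x1.
  by have /and3P[/eqP] := valP F.
pose e' := e ^+ 2 / (2 * k.+1%:R ^+ 2).
have e'0 : 0 < e' by rewrite divr_gt0 ?exprn_gt0 // mulr_gt0 ?exprn_gt0 ?ltr0n.
have [n [hn1 hn2]] : exists n, T <= sigma_gap (gam n) /\ flag_dist (Fn n) F <= e'.
  near \oo => n; exists n; split.
    near: n; move/cvgryPge : gapoo; exact.
  apply: le_trans (ler_norm _) _.
  near: n; move/cvgr0_norm_le : dist; exact.
have [U [V [s [svdg F1 _]]]] := cart n.
exists (gam n), U, V, s; split => //.
have [oU _ _ _ _] := svdg.
have y1 := enorm_orth_col ord0 oU.
rewrite -(@ler_pXn2r _ 2) ?nnegrE ?chord_ge0 ?(ltW e0) //.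
apply: le_trans (chord_sqr_le x1 y1) _.
rewrite -ler_pdivlMl ?mulr_gt0 ?exprn_gt0 ?ltr0n //.
rewrite mulrC -/e'; apply: le_trans hn2.
rewrite /flag_dist F1 FE !orthproj_line // -normrN opprB.
by rewrite lerDl.
Unshelve. all: by end_near. Qed.

(** A subsequence of the left orthogonal factors converges, and the columns of the
limit span a flag to which the Cartan flags converge. *)
Lemma limit_set_compact (gam : nat -> M) (U V : nat -> M) (s : nat -> 'rV[R]_k.+1) :
  (forall n, Gam (gam n)) -> (forall n, is_svd (gam n) (U n) (V n) (s n)) ->
  sigma_gap (gam n) @[n --> \oo] --> +oo ->
  exists f, increasing_seq f /\ exists x, in_limit_line x /\
    chord x (col ord0 (U (f n))) @[n --> \oo] --> (0 : R).
Proof.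
move=> Ggam svdg gapoo.
have oU n : U n *m (U n)^T = 1%:M by case: (svdg n).
have [|f [fi [U0 UU0]]] := @mxcvg_compact R _ _ U 1.
  by move=> n i j; exact: orth_entry.
exists f; split => //.
have oU0 : U0 *m U0^T = 1%:M.
  apply: (mxcvg_unique (mxcvg_mul UU0 (mxcvg_tr UU0))).
  by under eq_fun do rewrite /= oU; exact: mxcvg_cst.
exists (col ord0 U0); split.
  split; first by rewrite enorm_orth_col.
  have [F [F1 F2]] := col_flag_exists hk oU0.
  exists F; last by rewrite F1 memv_line.
  have /boolp.choice[Fn FnP] n := col_flag_exists hk (oU (f n)).
  exists (gam \o f), Fn; split => [n||n|].
  - exact: Ggam.
  - apply: cvg_comp gapoo; apply/cvgnyPge => A.
    by exists A => // n /= An; exact: leq_trans An (increasing_seq_ge n fi).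
  - by exists (U (f n)), (V (f n)), (s (f n)); split; [exact: svdg|case: (FnP n)..].
  have dE n : flag_dist (Fn n) F =
      `|colproj (U (f n)) (pred1 ord0) - colproj U0 (pred1 ord0)| +
      `|colproj (U (f n)) (fun i => (i < k)%N) - colproj U0 (fun i => (i < k)%N)|.
    rewrite /flag_dist (FnP n).1 (FnP n).2 F1 F2 -!colspan_line.
    by rewrite -!/(colspan _ (fun i => (i < k)%N)) !orthproj_colspan.
  under eq_fun do rewrite dE.
  have H1 := mxcvg_norm (mxcvg_colproj (Q := pred1 ord0) UU0).
  have H2 := mxcvg_norm (mxcvg_colproj (Q := fun i : 'I_k.+1 => (i < k)%N) UU0).
  have H3 := cvgD H1 H2; rewrite addr0 in H3; exact: H3.
have hs : \sum_i `|U (f n) i ord0 - U0 i ord0| @[n --> \oo] --> (0 : R).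
  have H i : (fun n => `|U (f n) i ord0 - U0 i ord0|) @ \oo --> (0 : R).
    rewrite -(normr0 R) -(subrr (U0 i ord0)); apply: cvg_norm.
    by apply: cvgB; [exact: UU0|exact: cvg_cst].
  rewrite -[X in _ --> X](_ : \sum_(i < k.+1) 0 = 0); last by rewrite big1.
  exact: cvg_sum_fin.
apply: squeeze_cvgr (cvg_cst 0) hs; near=> n; rewrite chord_ge0 /= chordC.
have := chord_le (col ord0 (U (f n))) (col ord0 U0) false.
rewrite expr0 scale1r => /le_trans; apply; apply: le_trans (enorm_le_sum _) _.
by apply: ler_sum => i _; rewrite !mxE.
Unshelve. all: by end_near. Qed.

End Limit.

(** * Conical limit points and shadows *)

Lemma sum_uniq_subset {R : realType} {T : eqType} (s t : seq T) (f : T -> R) :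
  uniq t -> {subset t <= s} -> (forall x, 0 <= f x) ->
  \sum_(x <- t) f x <= \sum_(x <- s) f x.
Proof.
move=> ut ts f0; apply: (@le_trans _ _ (\sum_(x <- undup s | x \in t) f x)).
  rewrite -[leRHS]big_filter le_eqVlt; apply/orP; left; apply/eqP/perm_big.
  apply: uniq_perm; rewrite ?filter_uniq ?undup_uniq // => x.
  by rewrite mem_filter mem_undup; case: (boolP (x \in t)) => // /ts ->.
rewrite big_mkcond /=; apply: (@le_trans _ _ (\sum_(x <- undup s) f x)).
  by apply: ler_sum => x _; case: ifP.
elim: s {ts} => [|y s IH] /=; first by rewrite !big_nil.
case: ifP => _; rewrite ?big_cons ?lerD2l //.
by apply: le_trans IH _; rewrite lerDr.
Qed.

Section Anosov.
Context {R : realType} {k : nat}.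
Local Notation M := 'M[R]_k.+1.
Variables (Gam : set M) (S : seq M).
Hypothesis hk : (1 <= k)%N.
Hypothesis hGam : SL_subgroup Gam.
Hypothesis hS : generates Gam S.
Hypothesis hQI : orbit_map_qi_embedding Gam S 1.
Hypothesis hgap : forall gam : nat -> M, injective gam -> (forall n, Gam (gam n)) ->
  (0 < limn_einf (fun n => (sigma_gap (gam n) / sigma_norm (gam n))%:E))%E.

Local Notation wl := (word_length S).
Local Notation K := (letter_bound S).

Lemma omegaE g : Gam g -> omega g = sigma 1 g - sigma k.+1 g.
Proof.
by move=> /(SL_det hGam) dg; rewrite sigma1E // sigma_lastE // opprK.
Qed.

Lemma sigma_gap_le_omega g : Gam g -> sigma_gap g <= omega g.
Proof. by move=> Gg; rewrite omegaE // sigma_gap_le // (SL_det hGam Gg). Qed.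

Lemma omega1 : omega (1 : M) = 0.
Proof. by rewrite /omega invr1 opnorm1 ln1 addr0. Qed.

Lemma omegaM (g h : M) : g \is a GRing.unit -> h \is a GRing.unit ->
  omega (g * h) <= omega g + omega h.
Proof.
move=> gu hu; have gV : g^-1 \is a GRing.unit by rewrite unitrV.
have hV : h^-1 \is a GRing.unit by rewrite unitrV.
have lnM (x y : M) : x \is a GRing.unit -> y \is a GRing.unit ->
    ln (opnorm (x * y)) <= ln (opnorm x) + ln (opnorm y).
  move=> xu yu; rewrite -lnM ?posrE ?opnorm_gt0 // ler_ln ?posrE; first exact: opnormM.
    by rewrite opnorm_gt0 // unitrMr.
  by rewrite mulr_gt0 ?opnorm_gt0.
have := lnM _ _ gu hu; have := lnM _ _ hV gV.
by rewrite /omega invrM //; lra.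
Qed.

Lemma opnormV_expR g : Gam g -> opnorm g^-1 = expR (omega g) / opnorm g.
Proof.
move=> Gg; have gu := SL_unit hGam Gg.
have gV : g^-1 \is a GRing.unit by rewrite unitrV.
rewrite /omega expRD !lnK ?posrE ?opnorm_gt0 // mulrC mulrA mulVf ?mul1r //.
by rewrite gt_eqF // opnorm_gt0.
Qed.

Lemma finite_word_length N : finite_set [set g | Gam g /\ wl g <= N].
Proof.
pose letters := S ++ [seq x^-1 | x <- S].
pose W := fix W n : set M := if n is n'.+1 then
  [set x.1 * x.2 | x in [set` letters] `*` W n'] else [set 1].
have Wfin n : finite_set (W n).
  elim: n => [|n IH] /=; first exact: finite_set1.
  by apply: finite_image; apply: finite_setX => //; exact: finite_seq.
have Wword w : is_word S w -> W (size w) (\prod_(a <- w) a).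
  elim: w => [|a w IH] /=; first by rewrite big_nil.
  move=> /andP[aS ww]; rewrite big_cons; exists (a, \prod_(a <- w) a) => //.
  split => /=; last exact: IH.
  rewrite /letters /= mem_cat; case/orP: aS => [->//|aS].
  by apply/orP; right; apply/mapP; exists a^-1 => //; rewrite invrK.
apply: sub_finite_set (_ : finite_set (\bigcup_(n in `I_(Num.truncn N).+1) W n)).
  move=> g /= [Gg gN]; have [w [ww len] wE] := geodesic_exists hS Gg.
  rewrite -wE in gN *; exists (size w); last exact: Wword.
  rewrite /= -(ltr_nat R) -len; apply: le_lt_trans gN _; exact: truncnS_gt.
by apply: bigcup_finite => // n _; exact: Wfin.
Qed.

(** A bound on [omega] bounds the gap, hence the word length. *)
Lemma finite_omega T : finite_set [set g | Gam g /\ omega g <= T].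
Proof.
have [c [D [c0 D0 h]]] := gap_ge_length hk hGam hQI hgap.
apply: sub_finite_set (finite_word_length ((T + D) / c)) => g /= [Gg gT].
split => //; rewrite ler_pdivlMr // mulrC.
have := h g Gg; have := sigma_gap_le_omega Gg; lra.
Qed.

(** Limit points are conical: choose a group element whose top singular line is
within [rho] of the line of [x], follow a geodesic word for it and stop at the prefix [g]
where [omega] reaches [ln rho^-1].  By [geodesic_tau] the inverse of [g] contracts
the top direction of the whole word almost as much as it can, and it maps the
difference between this direction and [x], of norm at most [rho], to a vector of
norm at most [(opnorm g)^-1]. *)
Lemma limit_conical : exists A : R, [/\ 0 <= A & forall x rho,
  in_limit_line Gam x -> 0 < rho <= 1 -> exists g, [/\ Gam g,
    omega g <= ln rho^-1, ln rho^-1 - A <= omega g &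
    enorm (g^-1 *m x) <= A / opnorm g]].
Proof.
have [t0 t00 ht] := geodesic_tau hk hGam hS hQI hgap.
have K1 := letter_bound_ge1 S; have K0 : 0 < K by apply: lt_le_trans K1.
have lnK0 : 0 <= ln K by rewrite ln_ge0.
pose A1 := 2 * ln K; pose A2 := t0^-1 + 1.
have A10 : 0 <= A1 by rewrite mulr_ge0.
have A20 : 0 <= A2 by rewrite addr_ge0 // invr_ge0 ltW.
exists (A1 + A2); split; first by rewrite addr_ge0.
move=> x rho xL /andP[rho0 rho1].
have [gam [U [V [s [Ggam svdg gapT xy]]]]] :=
  limit_line_approx (ln rho^-1 + 1) xL rho0.
have [w gw wE] := geodesic_exists hS Ggam; have ww := gw.1.
pose p j := \prod_(a <- take j w) a.
have Gp j : Gam (p j) by apply: (word_in hGam hS); case: (geodesic_take hGam hS j gw).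
have exj : exists j, ln rho^-1 < omega (p j).
  exists (size w); rewrite /p take_size wE.
  by have := sigma_gap_le_omega Ggam; lra.
case: (ex_minnP exj) => j pj jmin.
have lnrho : 0 <= ln rho^-1 by rewrite ln_ge0 // invf_ge1.
case: j pj jmin => [|j] pj jmin.
  by move: pj; rewrite /p take0 big_nil omega1 ltNge lnrho.
have jw : (j < size w)%N.
  rewrite ltnNge; apply/negP => wj; have := jmin j.
  have -> : p j = p j.+1 by rewrite /p !take_oversize // leqW.
  by move=> /(_ pj); rewrite ltnn.
have gle : omega (p j) <= ln rho^-1.
  by rewrite leNgt; apply/negP => /jmin; rewrite ltnn.
have gu := SL_unit hGam (Gp j).
have gV : (p j)^-1 \is a GRing.unit by rewrite unitrV.
have g0 := opnorm_gt0 gu.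
have au := nth_word_unit hGam hS ww j.
exists (p j); split => //.
  have pS : p j.+1 = p j * nth 1 w j.
    by rewrite /p (take_nth 1) // -cats1 big_cat /= big_seq1.
  have aV : (nth 1 w j)^-1 \is a GRing.unit by rewrite unitrV.
  have a1 : ln (opnorm (nth 1 w j)) <= ln K.
    by rewrite ler_ln ?posrE ?opnorm_gt0 // (nth_word_le ww).
  have a2 : ln (opnorm (nth 1 w j)^-1) <= ln K.
    by rewrite ler_ln ?posrE ?opnorm_gt0 // (nth_wordV_le ww).
  have := omegaM gu au; rewrite -pS => h.
  have : omega (nth 1 w j) <= A1 by rewrite /omega /A1; lra.
  by move: h pj A20; lra.
pose hh := \prod_(a <- drop j w) a.
have gE : gam = p j * hh by rewrite /p /hh -big_cat cat_take_drop.
have Ghh : Gam hh by apply: (word_in hGam hS); case: (geodesic_drop hGam hS j gw).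
have h0 := opnorm_gt0 (SL_unit hGam Ghh).
have gam0 := opnorm_gt0 (SL_unit hGam Ggam).
have tj : t0 * (opnorm (p j) * opnorm hh) <= opnorm gam.
  rewrite -ler_pdivlMr ?mulr_gt0 // gE.
  exact: (ht w j gw (ltnW jw)).
have [oU oV _ _ gsvd] := svdg.
set y := col ord0 U in xy.
pose v := col ord0 V.
have gv : gam *m v = opnorm gam *: y.
  by rewrite (opnorm_svd svdg) {1}gsvd svd_mul_col.
have hy : enorm ((p j)^-1 *m y) <= t0^-1 / opnorm (p j).
  have -> : (p j)^-1 *m y = (opnorm gam)^-1 *: (hh *m v).
    have -> : hh = (p j)^-1 * gam by rewrite gE mulKr.
    rewrite -mulmxE -mulmxA gv -scalemxAr scalerA mulVf ?scale1r //.
    by rewrite gt_eqF.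
  rewrite enormZ ger0_norm ?invr_ge0 ?(ltW gam0) //.
  apply: (@le_trans _ _ ((opnorm gam)^-1 * opnorm hh)).
    apply: ler_wpM2l; first by rewrite invr_ge0 ltW.
    by have := enorm_mulmx hh v; rewrite /v enorm_orth_col // mulr1.
  rewrite ler_pdivrMl //.
  apply: (@le_trans _ _ (t0 * (opnorm (p j) * opnorm hh) * (t0^-1 / opnorm (p j)))).
    by rewrite le_eqVlt; apply/orP; left; apply/eqP; field; rewrite !gt_eqF.
  by apply: ler_wpM2r => //; rewrite divr_ge0 ?invr_ge0 // ltW.
have [b xyb] := chord_sign x y.
have -> : x = (-1) ^+ b *: y + (x - (-1) ^+ b *: y) by rewrite addrC subrK.
rewrite mulmxDr -scalemxAr; apply: le_trans (enormD _ _) _; rewrite enorm_sign.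
have h2 : enorm ((p j)^-1 *m (x - (-1) ^+ b *: y)) <= (opnorm (p j))^-1.
  apply: le_trans (enorm_mulmx _ _) _.
  rewrite -xyb opnormV_expR // mulrAC ler_pdivrMr // mulVf ?gt_eqF //.
  apply: (@le_trans _ _ (expR (ln rho^-1) * rho)).
    by apply: ler_pM => //; rewrite ?expR_ge0 ?chord_ge0 // ler_expR.
  by rewrite lnK ?posrE ?invr_gt0 // mulVf ?gt_eqF.
have : (A1 + A2) / opnorm (p j) =
   A1 / opnorm (p j) + (t0^-1 / opnorm (p j) + (opnorm (p j))^-1).
  by rewrite /A2 !mulrDl mul1r.
have : 0 <= A1 / opnorm (p j) by rewrite divr_ge0 // ltW.
by move: hy h2; lra.
Qed.

(** The vector [y] spans the line of a Cartan flag of [g], and [g] is as close to the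
corresponding matrix of rank one as its gap allows. *)
Definition top_line (g : M) y : Prop := exists U V,
  [/\ is_svd g U V (singular_values g), y = col ord0 U &
   opnorm (g - opnorm g *: (col ord0 U *m (col ord0 V)^T)) <=
     expR (- sigma_gap g) * opnorm g].

(** The prefix [g] of [limit_conical] serves all elements [gam] whose top line is in
a ball around [x] of radius comparable to [rho], provided that their gap is large
enough: [g^-1] still contracts the top line of [gam] strongly, and all other
directions are negligible in [gam].  So [tau g (g^-1 * gam)] is bounded below and
[omega_superadd] applies. *)
Lemma limit_shadow B : 0 <= B -> exists A : R, [/\ 0 <= A & forall x rho,
  in_limit_line Gam x -> 0 < rho <= 1 -> exists g, [/\ Gam g,
    omega g <= ln rho^-1, ln rho^-1 - A <= omega g &
    forall gam y, Gam gam -> top_line gam y -> chord x y <= B * rho ->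
      omega g <= sigma_gap gam ->
      omega g + omega (g^-1 * gam) - A <= omega gam]].
Proof.
move=> B0; have [A [A0 con]] := limit_conical.
pose t := A + B + 1.
have t0 : 0 < t by rewrite /t; lra.
have tV0 : 0 < t^-1 by rewrite invr_gt0.
have [C hC] := omega_superadd hk hGam hS hQI hgap tV0.
exists (Num.max A C); split; first by rewrite le_max A0.
move=> x rho xL rho01; have [g [Gg g1 g2 g3]] := con x rho xL rho01.
have /andP[rho0 rho1] := rho01.
have gu := SL_unit hGam Gg; have g0 := opnorm_gt0 gu.
exists g; split => //.
  by apply: le_trans g2; rewrite lerD2l lerN2 le_max lexx.
move=> gam y Ggam [U [V [[oU oV _ _ _] yE r1]]] xy ggap.
have gam0 := opnorm_gt0 (SL_unit hGam Ggam).
set v := col ord0 V in r1; rewrite -yE in r1.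
have v1 : enorm v = 1 by exact: enorm_orth_col.
have gy : enorm (g^-1 *m y) <= (A + B) / opnorm g.
  have [b xyb] := chord_sign y x; rewrite chordC in xyb.
  have -> : y = (-1) ^+ b *: x + (y - (-1) ^+ b *: x) by rewrite addrC subrK.
  rewrite mulmxDr -scalemxAr; apply: le_trans (enormD _ _) _; rewrite enorm_sign.
  rewrite mulrDl; apply: lerD => //.
  apply: le_trans (enorm_mulmx _ _) _.
  rewrite -xyb opnormV_expR // mulrAC ler_pM2r ?invr_gt0 //.
  apply: (@le_trans _ _ (expR (ln rho^-1) * (B * rho))).
    by apply: ler_pM => //; rewrite ?expR_ge0 ?chord_ge0 // ler_expR.
  by rewrite lnK ?posrE ?invr_gt0 // mulrCA mulVf ?mulr1 // gt_eqF.
have gE : opnorm (g^-1 * gam) <= opnorm gam * (t / opnorm g).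
  pose E := gam - opnorm gam *: (y *m v^T).
  have -> : g^-1 * gam = opnorm gam *: (g^-1 *m y *m v^T) + g^-1 *m E.
    by rewrite /E mulmxBr -scalemxAr mulmxA addrC subrK.
  apply: le_trans (opnormD _ _) _; rewrite opnormZ opnorm_rank1 v1 mulr1.
  rewrite ger0_norm ?(ltW gam0) //.
  have -> : opnorm gam * (t / opnorm g) =
    opnorm gam * ((A + B) / opnorm g) + opnorm gam / opnorm g.
    by rewrite /t; field; rewrite gt_eqF.
  apply: lerD; first by rewrite ler_pM2l.
  apply: le_trans (opnormM _ _) _.
  rewrite opnormV_expR // mulrAC ler_pM2r ?invr_gt0 //.
  apply: (@le_trans _ _ (expR (omega g) * (expR (- sigma_gap gam) * opnorm gam))).
    by rewrite ler_pM2l ?expR_gt0.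
  rewrite mulrA -expRD ler_piMl ?(ltW gam0) // -[leRHS]expR0 ler_expR; lra.
have Gh : Gam (g^-1 * gam) by apply: (SL_mul hGam) => //; exact: (SL_inv hGam).
have ghE : g * (g^-1 * gam) = gam by rewrite mulVKr.
have h0 := opnorm_gt0 (SL_unit hGam Gh).
have := hC g (g^-1 * gam) Gg Gh; rewrite ghE => hC'.
apply: (@le_trans _ _ (omega g + omega (g^-1 * gam) - C)).
  by rewrite lerD2l lerN2 le_max lexx orbT.
apply: hC'; rewrite /tau mulmxE ghE ler_pdivlMr ?mulr_gt0 //.
rewrite ler_pdivrMl // mulrC; apply: le_trans (_ : opnorm g * (opnorm gam * (t / opnorm g)) <= _).
  by rewrite mulrC ler_pM2l.
by rewrite le_eqVlt; apply/orP; left; apply/eqP; field; rewrite gt_eqF.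
Qed.

End Anosov.

(** * Convergence of the Poincare series *)

Section Poincare.
Context {R : realType} {k : nat}.
Local Notation M := 'M[R]_k.+1.
Variables (Gam : set M) (S : seq M).
Hypothesis hk : (1 <= k)%N.
Hypothesis hGam : SL_subgroup Gam.
Hypothesis hS : generates Gam S.
Hypothesis hQI : orbit_map_qi_embedding Gam S 1.
Hypothesis hgap : forall gam : nat -> M, injective gam -> (forall n, Gam (gam n)) ->
  (0 < limn_einf (fun n => (sigma_gap (gam n) / sigma_norm (gam n))%:E))%E.

Local Notation wl := (word_length S).

Definition chord_cover (J : pred nat) (x : nat -> 'cV[R]_k.+1) (rho : nat -> R) :=
  forall u, in_limit_line Gam u -> exists2 i, J i & chord u (x i) <= rho i.

(** Otherwise some sequence of longer and longer elements would avoid more and more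
of the balls, but by [limit_set_compact] a subsequence of their top lines converges
to a limit line, which is in the interior of one of the enlarged balls. *)
Lemma finite_shadow_cover (J : pred nat) x rho :
  (forall i, J i -> 0 < rho i) -> chord_cover J x rho ->
  exists n : nat, forall g y, Gam g -> top_line g y -> n%:R <= wl g ->
    exists i, [/\ (i < n)%N, J i & chord (x i) y <= 2 * rho i].
Proof.
move=> rho0 cov; apply/not_existsP => nex.
have /boolp.choice[F FP] : forall n : nat, exists gUV : M * M * M,
    [/\ Gam gUV.1.1, is_svd gUV.1.1 gUV.1.2 gUV.2 (singular_values gUV.1.1),
      n%:R <= wl gUV.1.1 & forall i, (i < n)%N -> J i ->
        2 * rho i < chord (x i) (col ord0 gUV.1.2)].
  move=> n; apply/not_existsP => nex'; apply: (nex n).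
  move=> g y Gg [U [V [svdg -> _]]] ng; apply/not_existsP => nex2.
  apply: (nex' (g, U, V)); split => //= i ilt Ji.
  by rewrite ltNge; apply/negP => le; apply: (nex2 i).
pose gam n := (F n).1.1; pose U n := (F n).1.2; pose V n := (F n).2.
have Ggam n : Gam (gam n) by case: (FP n).
have svdg n : is_svd (gam n) (U n) (V n) (singular_values (gam n)) by case: (FP n).
have gapoo : sigma_gap (gam n) @[n --> \oo] --> +oo.
  have [c [D [c0 D0 h]]] := gap_ge_length hk hGam hQI hgap.
  apply/cvgryPge => A; near=> n.
  have h1 := h _ (Ggam n); have [_ _ h2 _] := FP n.
  apply: le_trans h1; rewrite lerBrDr -ler_pdivrMl // mulrC.
  apply: le_trans h2; near: n; exact: nbhs_infty_ger.
have [f [fi [u [uL uf]]]] := limit_set_compact hk Ggam svdg gapoo.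
have [i Ji ui] := cov u uL.
have [n [nf un]] : exists n, (i < f n)%N /\ chord u (col ord0 (U (f n))) <= rho i.
  near \oo => n; exists n; split.
    apply: leq_trans (increasing_seq_ge n fi).
    near: n; exact: nbhs_infty_gt.
  apply: le_trans (ler_norm _) _.
  near: n; move/cvgr0_norm_le : uf; apply; exact: rho0.
have [_ _ _ /(_ i nf Ji)] := FP (f n); rewrite ltNge => /negP; apply.
apply: le_trans (chord_trans _ u _) _; rewrite chordC.
by rewrite /U in un; lra.
Unshelve. all: by end_near. Qed.

(** The sum over the elements with [omega <= T] is estimated in terms of itself.  By
[limit_shadow], every element outside a finite set is [g i * h] for one of finitely
many [g i], attached to the balls of the cover, with
[omega (g i * h) >= omega (g i) + omega h - A].  In particular [omega h <= T] once
[omega (g i) >= A], so the sum is at most a constant plus its product with the sum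
of [rho i `^ s] over the balls and a fixed factor, and this product is at most half
of it.  The bound that follows does not depend on [T]. *)
Lemma poincare_bound (s : R) : 0 < s -> exists eta rho0 : R,
  [/\ 0 < eta, 0 < rho0 & forall (J : pred nat) x (rho : nat -> R),
    (forall i, J i -> in_limit_line Gam (x i) /\ 0 < rho i <= rho0) ->
    chord_cover J x rho ->
    (forall n, \sum_(i < n | J i) rho i `^ s <= eta) ->
    exists2 F : R, 0 < F & forall t : seq M, uniq t ->
      (forall g, g \in t -> Gam g) -> \sum_(g <- t) expR (- s * omega g) <= F].
Proof.
move=> s0; have [A [A0 shad]] := limit_shadow hk hGam hS hQI hgap (ler0n R 2).
pose rho0 := expR (- (2 * A)); pose eta := expR (- (2 * s * A)) / 2.
exists eta, rho0; split; rewrite ?divr_gt0 ?expR_gt0 //.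
move=> J x rho Jx cov sumle.
have rho01 : rho0 <= 1 by rewrite -expR0 ler_expR oppr_le0 mulr_ge0.
have rho_gt0 i : J i -> 0 < rho i by move=> /Jx[_ /andP[]].
have [n hn] := finite_shadow_cover rho_gt0 cov.
have /boolp.choice[g gP] : forall i, exists g, J i -> [/\ Gam g,
    omega g <= ln (rho i)^-1, ln (rho i)^-1 - A <= omega g &
    forall gam y, Gam gam -> top_line gam y -> chord (x i) y <= 2 * rho i ->
      omega g <= sigma_gap gam ->
      omega g + omega (g^-1 * gam) - A <= omega gam].
  move=> i; have [Ji|nJi] := boolP (J i); last by exists 1.
  have [xL /andP[r0 r1]] := Jx i Ji.
  have [|g gP] := shad (x i) (rho i) xL; first by rewrite r0 (le_trans r1).
  by exists g.
have [c [D [c0 D0 gapge]]] := gap_ge_length hk hGam hQI hgap.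
(* The finite exceptional set consists of the elements that are too short for hn
or whose gap is not yet larger than all the omega (g i). *)
pose m := \sum_(i < n) `|omega (g i)|.
pose E := [set h | Gam h /\ wl h <= Num.max n%:R ((m + D) / c)].
have [e eE] : exists e : seq M, E = [set` e].
  by apply/finite_seqP; exact: finite_word_length.
pose f (h : M) := expR (- s * omega h).
have f0 h : 0 <= f h by exact: expR_ge0.
pose F0 := \sum_(h <- undup e) f h.
have F00 : 0 <= F0 by apply: sumr_ge0 => h _.
exists (2 * F0 + 1); first by rewrite ltr_wpDl // mulr_ge0.
move=> t ut Gt.
pose T := \sum_(h <- t) `|omega h|.
have [t' t'E] : exists t' : seq M, [set h | Gam h /\ omega h <= T] = [set` t'].
  by apply/finite_seqP; exact: (finite_omega hk hGam hS hQI hgap).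
pose s' := undup t'.
have us' : uniq s' by exact: undup_uniq.
have s'P h : (h \in s') <-> (Gam h /\ omega h <= T).
  rewrite mem_undup; split=> [ht|ht].
    by have : [set` t'] h by []; rewrite -t'E.
  by have : [set h | Gam h /\ omega h <= T] h by []; rewrite t'E.
pose P := \sum_(h <- s') f h.
have P0 : 0 <= P by apply: sumr_ge0.
have tP : \sum_(h <- t) f h <= P.
  apply: sum_uniq_subset => // h ht; apply/s'P; split; first exact: Gt.
  apply: le_trans (ler_norm _) _; rewrite /T (big_rem h) //= lerDl.
  by apply: sumr_ge0.
suff PF : P <= F0 + P / 2 by apply: le_trans tP _; lra.
pose C i := expR (2 * s * A) * rho i `^ s.
have C0 i : 0 <= C i by rewrite mulr_ge0 ?expR_ge0 ?powR_ge0.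
have key h : h \in s' -> f h <= (if h \in e then f h else 0) +
    \sum_(i < n | J i) C i * (if (g i)^-1 * h \in s' then f ((g i)^-1 * h) else 0).
  move=> /s'P[Gh hT]; have sumge0 : 0 <= \sum_(i < n | J i) C i *
      (if (g i)^-1 * h \in s' then f ((g i)^-1 * h) else 0).
    by apply: sumr_ge0 => i _; rewrite mulr_ge0 //; case: ifP.
  set sm := \sum_(_ < _ | _) _ in sumge0 *.
  have [he|hE] := boolP (h \in e).
    by rewrite lerDl; exact: sumge0.
  rewrite add0r /sm {sm sumge0}.
  have : ~ E h by rewrite eE => /= he; rewrite he in hE.
  move=> /not_andP[//|/negP]; rewrite -ltNge gt_max => /andP[nw mw].
  have [U [V [svdg r1]]] := svd_top hk (SL_det hGam Gh).
  have tl : top_line h (col ord0 U) by exists U, V.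
  have [i [ilt Ji xi]] := hn h _ Gh tl (ltW nw).
  have [Gg g1 g2 g3] := gP i Ji.
  have gm : omega (g i) <= m.
    apply: le_trans (ler_norm _) _; rewrite /m (bigD1 (Ordinal ilt)) //= lerDl.
    by apply: sumr_ge0.
  have ggap : omega (g i) <= sigma_gap h.
    apply: le_trans (gapge _ Gh); apply: le_trans gm _.
    by rewrite lerBrDr -ler_pdivrMl // mulrC ltW.
  have h4 := g3 h _ Gh tl xi ggap.
  have Gg' : Gam ((g i)^-1 * h) by apply: (SL_mul hGam) => //; exact: (SL_inv hGam).
  have [_ /andP[ri0 ri1]] := Jx i Ji.
  have lnr : 2 * A <= ln (rho i)^-1.
    rewrite lnV ?posrE // lerNr -[leRHS]expRK ler_ln ?posrE ?expR_gt0 //.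
  have in' : (g i)^-1 * h \in s'.
    apply/s'P; split; first exact: Gg'.
    move: h4 hT g2 lnr; move: (omega h) (omega (g i)) (omega _) (ln _) => a b c' l.
    by clear; lra.
  rewrite (bigD1 (Ordinal ilt)) //= in'.
  apply: (@le_trans _ _ (C i * f ((g i)^-1 * h))); last first.
    rewrite lerDl; apply: sumr_ge0 => j _.
    by rewrite mulr_ge0 //; case: ifP.
  rewrite /C /f /powR gt_eqF // -!expRD ler_expR.
  have h5 : s * (omega (g i) + omega ((g i)^-1 * h) - A) <= s * omega h.
    by rewrite ler_pM2l.
  have h6 : s * (ln (rho i)^-1 - A) <= s * omega (g i).
    by apply: ler_wpM2l; [exact: ltW|exact: g2].
  rewrite lnV ?posrE // in h6.
  move: h5 h6; move: (omega h) (omega (g i)) (omega _) (ln _) => a b c' l.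
  by clear; lra.
have sumE : \sum_(h <- s') (if h \in e then f h else 0) <= F0.
  rewrite -big_mkcond /= -big_filter; apply: sum_uniq_subset => //.
    exact: filter_uniq.
  by move=> h; rewrite mem_filter mem_undup => /andP[].
have sumI i : J i ->
    \sum_(h <- s') (if (g i)^-1 * h \in s' then f ((g i)^-1 * h) else 0) <= P.
  move=> Ji; have [Gg _ _ _] := gP i Ji.
  have gu : (g i)^-1 \is a GRing.unit by rewrite unitrV (SL_unit hGam Gg).
  rewrite -big_mkcond /= -big_filter -(big_map (fun h => (g i)^-1 * h) xpredT f).
  apply: sum_uniq_subset => //.
    by rewrite map_inj_uniq ?filter_uniq //; exact: mulrI gu.
  by move=> _ /mapP[h + ->]; rewrite mem_filter => /andP[].
apply: (@le_trans _ _ (\sum_(h <- s') ((if h \in e then f h else 0) +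
    \sum_(i < n | J i) C i * (if (g i)^-1 * h \in s' then f ((g i)^-1 * h) else 0)))).
  by rewrite /P big_seq [leRHS]big_seq; apply: ler_sum => h; exact: key.
rewrite big_split /=; apply: lerD => //.
rewrite exchange_big /=.
apply: (@le_trans _ _ (\sum_(i < n | J i) C i * P)).
  by apply: ler_sum => i Ji; rewrite -mulr_sumr ler_wpM2l // sumI.
rewrite -mulr_suml mulrC ler_wpM2l // /C -mulr_sumr.
apply: (@le_trans _ _ (expR (2 * s * A) * eta)).
  by rewrite ler_pM2l ?expR_gt0.
by rewrite /eta mulrA -expRD subrr expR0 mul1r.
Qed.

(** Chebyshev's inequality: every element with [omega < r] contributes at least
[expR (- s * r)] to the sum. *)
Lemma omega_count (s F : R) : 0 < F ->
  (forall t : seq M, uniq t -> (forall g, g \in t -> Gam g) ->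
     \sum_(g <- t) expR (- s * omega g) <= F) -> 0 < s ->
  (hilbert_critical_exponent Gam <= s%:E)%E.
Proof.
move=> F0 sumF s0; apply/lee_addgt0Pr => e e0.
pose A r := [set g : M | Gam g /\ sigma 1 g - sigma k.+1 g < r].
have Afin r : finite_set (A r).
  apply: sub_finite_set (finite_omega hk hGam hS hQI hgap r) => g /= [Gg gr].
  by split => //; rewrite (omegaE hGam) // ltW.
(* The constant factor F is absorbed by the error e. *)
pose V := [set r : R | 0 < r /\ `|ln F| <= e * r].
have VF : pinfty_nbhs R V.
  exists (Num.max 0 (`|ln F| / e)); split; first by rewrite num_real.
  move=> r; rewrite gt_max => /andP[r0 rF]; split => //.
  by rewrite -ler_pdivrMl // mulrC ltW.
apply: le_trans (ereal_inf_lbound _) _.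
  by exists V; [exact: VF|reflexivity].
apply: ge_ereal_sup => _ [r [r0 rF] <-].
rewrite -/(A r) /counting asboolT //.
set t : seq M := finmap.enum_fset (fset_set (A r)).
set n := size t.
have tA g : (g \in t) = (g \in A r) := in_fset_set (Afin r) g.
have nle : n%:R <= F * expR (s * r).
  have tG g : g \in t -> Gam g by rewrite tA => /set_mem[].
  have h2 := sumF t (finmap.fset_uniq _) tG.
  have : \sum_(g <- t) expR (- s * r) <= F.
    apply: le_trans h2; rewrite big_seq [leRHS]big_seq; apply: ler_sum => g.
    rewrite tA => /set_mem[Gg gr]; rewrite ler_expR !mulNr lerN2 ler_pM2l //.
    by rewrite (omegaE hGam) // ltW.
  rewrite big_const_seq count_predT iter_addr_0 -/n -(mulr_natl (expR _)).
  by rewrite mulNr expRN ler_pdivrMr ?expR_gt0.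
have [n0|n0] := posnP n.
  by rewrite n0 le0_lneNy // mulNyr gtr0_sg ?invr_gt0 // mul1e leNye.
rewrite lne_EFin ?ltr0n // -EFinM lee_fin ler_pdivrMr //.
have : ln n%:R <= ln F + s * r.
  by rewrite -[s * r]expRK -lnM ?posrE ?expR_gt0 // ler_ln ?posrE ?ltr0n ?mulr_gt0 ?expR_gt0.
move=> /le_trans; apply; rewrite mulrDl addrC lerD2l.
by apply: le_trans rF; exact: ler_norm.
Qed.

End Poincare.

(** * Riemannian metrics on projective space *)

Section Quad.
Context {R : realType} {k : nat}.
Local Notation V := 'cV[R]_k.+1.
Local Notation M := 'M[R]_k.+1.

Lemma cvg_dot {T : Type} {F : set_system T} {FF : Filter F} (u v : T -> V) (u0 v0 : V) :
  (forall i, u x i 0 @[x --> F] --> (u0 i 0 : R)) ->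
  (forall i, v x i 0 @[x --> F] --> (v0 i 0 : R)) ->
  dot (u x) (v x) @[x --> F] --> dot u0 v0.
Proof.
move=> uu vv; rewrite dotE; under eq_fun do rewrite dotE.
by apply: cvg_sum_fin => i; exact: cvgM.
Qed.

Lemma cvg_quad {T : Type} {F : set_system T} {FF : Filter F}
    (A : T -> M) (v : T -> V) (A0 : M) (v0 : V) :
  (forall i j, A x i j @[x --> F] --> (A0 i j : R)) ->
  (forall i, v x i 0 @[x --> F] --> (v0 i 0 : R)) ->
  dot (v x) (A x *m v x) @[x --> F] --> dot v0 (A0 *m v0).
Proof.
move=> AA vv; apply: cvg_dot => // i; rewrite mxE; under eq_fun do rewrite mxE.
by apply: cvg_sum_fin => j; exact: cvgM.
Qed.

Lemma quad_dot (A : M) (v : V) : (v^T *m A *m v) 0 0 = dot v (A *m v).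
Proof. by rewrite /dot mulmxA. Qed.

Lemma cvg_entry {T : Type} {F : set_system T} {FF : Filter F} m n
  (A : T -> 'M[R]_(m, n)) (A0 : 'M[R]_(m, n)) i j :
  A @ F --> A0 -> A x i j @[x --> F] --> (A0 i j : R).
Proof. move=> AA; exact: cvg_comp AA (@coord_continuous R m n i j A0). Qed.

Lemma mxcvg_cvg m n (A : nat -> 'M[R]_(m, n)) A0 : mxcvg A A0 -> A @ \oo --> A0.
Proof.
by move=> /mxcvg_norm h; apply/subr_cvg0; apply: norm_cvg0; exact: h.
Qed.

Variable h : V -> M.
Hypothesis hh : riemannian_metric h.

Local Notation q u v := (dot v (h u *m v)).

Lemma metric_continuous u : u != 0 -> {for u, continuous h}.
Proof. by move=> u0; have [+ _] := (hh.1 [::] u u0). Qed.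

Lemma metricZ a u v : u != 0 -> a != 0 -> q (a *: u) v = a ^- 2 * q u v.
Proof.
by move=> u0 a0; have [_ hZ _ _] := hh.2 u u0; rewrite hZ // -scalemxAl dotZr.
Qed.

(** The kernel direction is invisible on both sides, by symmetry. *)
Lemma metric_kernel u v a : u != 0 -> q u (v + a *: u) = q u v.
Proof.
move=> u0; have [hT _ hu _] := hh.2 u u0.
have hu' w : dot u (h u *m w) = 0 by rewrite dot_mulmx hT hu dotC dot0r.
rewrite mulmxDr -scalemxAr hu scaler0 addr0 dotDl dotZl hu' mulr0 addr0 //.
Qed.

Lemma metric_gt0 u v : u != 0 -> dot u v = 0 -> v != 0 -> 0 < q u v.
Proof.
move=> u0 uv v0; have [_ _ _ pos] := hh.2 u u0; rewrite -quad_dot; apply: pos.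
apply/negP => /vlineP[a va]; move: v0; rewrite va scaler_eq0 negb_or => /andP[a0 _].
move: uv; rewrite va dotZr => /eqP; rewrite mulf_eq0 (negbTE a0) dot_eq0.
by rewrite (negbTE u0).
Qed.

Lemma unit_neq0 (u : V) : enorm u = 1 -> u != 0.
Proof. by rewrite -enorm_gt0 => ->. Qed.

(** The metric is evaluated at unit vectors only, by homogeneity; there it takes
its extreme values by compactness. *)
Lemma unit_pairs_compact (u v : nat -> V) :
  (forall n, enorm (u n) = 1) -> (forall n, enorm (v n) = 1) ->
  exists f u0 v0, [/\ increasing_seq f, enorm u0 = 1, enorm v0 = 1,
    dot (u (f n)) (v (f n)) @[n --> \oo] --> dot u0 v0 &
    q (u (f n)) (v (f n)) @[n --> \oo] --> q u0 v0].
Proof.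
move=> u1 v1.
have b1 (w : nat -> V) : (forall n, enorm (w n) = 1) -> forall n i j, `|w n i j| <= 1.
  by move=> w1 n i j; rewrite (ord1 j) -(w1 n) enorm_coord.
have [|f [fi [u0 fu]]] := @mxcvg_compact R _ _ u 1; first exact: b1.
have [|g [gi [v0 gv]]] := @mxcvg_compact R _ _ (v \o f) 1.
  by apply: b1 => n; exact: v1.
have {}fu := mxcvg_subseq gi fu.
have lim1 (w : nat -> V) w0 : mxcvg w w0 -> (forall n, enorm (w n) = 1) -> enorm w0 = 1.
  move=> ww w1; have h1 : dot (w n) (w n) @[n --> \oo] --> dot w0 w0.
    by apply: cvg_dot => i; exact: ww.
  have h2 : (fun n => dot (w n) (w n)) = fun=> 1.
    by apply/funext => n; rewrite -enorm_sqr w1 expr1n.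
  rewrite h2 in h1; have w01 := cvg_unique _ (cvg_cst (1 : R)) h1.
  by apply/eqP; rewrite -(@eqrXn2 _ 2) ?enorm_ge0 // expr1n enorm_sqr -w01.
have u01 : enorm u0 = 1 by apply: (lim1 _ _ fu) => n; exact: u1.
have v01 : enorm v0 = 1 by apply: (lim1 _ _ gv) => n; exact: v1.
exists (f \o g), u0, v0; split => //; first exact: increasing_seq_comp.
  by apply: cvg_dot => i; [exact: fu|exact: gv].
apply: cvg_quad => [i j|i]; last exact: gv.
apply: cvg_entry.
apply: (@cvg_comp _ _ _ ((u \o f) \o g) h); first exact: mxcvg_cvg fu.
exact: (metric_continuous (unit_neq0 u01)).
Qed.

Lemma metric_ge_unit : exists2 m : R, 0 < m & forall u v, enorm u = 1 -> enorm v = 1 ->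
  dot u v = 0 -> m <= q u v.
Proof.
apply: contrapT => nex.
have /boolp.choice[F FP] : forall n : nat, exists uv : V * V,
    [/\ enorm uv.1 = 1, enorm uv.2 = 1, dot uv.1 uv.2 = 0 & q uv.1 uv.2 < n.+1%:R^-1].
  move=> n; apply: contrapT => nex'; apply: nex.
  exists n.+1%:R^-1; first by rewrite invr_gt0.
  move=> u v u1 v1 uv; rewrite leNgt; apply/negP => lt; apply: nex'.
  by exists (u, v).
have [f [u0 [v0 [fi u1 v1 duv quv]]]] := @unit_pairs_compact
  (fun n => (F n).1) (fun n => (F n).2) (fun n => let: And4 a _ _ _ := FP n in a)
  (fun n => let: And4 _ a _ _ := FP n in a).
have d0 : dot u0 v0 = 0.
  have e : (fun n => dot (F (f n)).1 (F (f n)).2) = fun=> 0.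
    by apply/funext => n; case: (FP (f n)).
  by rewrite e in duv; exact: (cvg_unique _ duv (cvg_cst (0 : R))).
have q0 : q u0 v0 <= 0.
  have h0 : (f n).+1%:R^-1 @[n --> \oo] --> (0 : R).
    apply: (cvg_increasing_seq (u := fun l => l.+1%:R^-1) fi).
    exact: cvg_harmonic.
  apply: (ler_cvg_to quv h0); near=> n; apply: ltW.
  by case: (FP (f n)).
have := metric_gt0 (unit_neq0 u1) d0 (unit_neq0 v1); rewrite ltNge q0 //.
Unshelve. all: by end_near. Qed.

Lemma metric_le_unit : exists2 B : R, 0 < B & forall u v, enorm u = 1 -> enorm v = 1 ->
  q u v <= B.
Proof.
apply: contrapT => nex.
have /boolp.choice[F FP] : forall n : nat, exists uv : V * V,
    [/\ enorm uv.1 = 1, enorm uv.2 = 1 & n.+1%:R < q uv.1 uv.2].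
  move=> n; apply: contrapT => nex'; apply: nex.
  exists n.+1%:R; first by rewrite ltr0n.
  move=> u v u1 v1; rewrite leNgt; apply/negP => lt; apply: nex'.
  by exists (u, v).
have [f [u0 [v0 [fi u1 v1 duv quv]]]] := @unit_pairs_compact
  (fun n => (F n).1) (fun n => (F n).2) (fun n => let: And3 a _ _ := FP n in a)
  (fun n => let: And3 _ a _ := FP n in a).
have [n [n1 n2]] : exists n, q (F (f n)).1 (F (f n)).2 <= q u0 v0 + 1 /\
    q u0 v0 + 1 <= n%:R.
  near \oo => n; exists n; split; last by near: n; exact: nbhs_infty_ger.
  near: n; move/cvgrPdist_le : quv => /(_ 1 ltr01); apply: filterS => n.
  by rewrite ler_norml => /andP[+ _]; lra.
have [_ _ n3] := FP (f n).
have := increasing_seq_ge n fi; rewrite -(ler_nat R) => n4.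
have n5 : (f n)%:R <= (f n).+1%:R :> R by rewrite ler_nat.
by move: n1 n2 n3 n4 n5; lra.
Unshelve. all: by end_near. Qed.

(** The derivative of [u / |u|] in the direction [v] is [perp u v / |u|], so
[metric_ge] compares the metric with the round one. *)
Definition perp (u v : V) : V := v - (dot u v / dot u u) *: u.

Lemma dot_perp u v : u != 0 -> dot u (perp u v) = 0.
Proof. by move=> u0; rewrite /perp dotBr dotZr divfK ?subrr // dot_eq0. Qed.

Lemma metric_perp u v : u != 0 -> q u (perp u v) = q u v.
Proof. by move=> u0; rewrite /perp -scaleNr metric_kernel. Qed.

Lemma metric_normalize u v : u != 0 -> v != 0 ->
  q u v = enorm v ^+ 2 / enorm u ^+ 2 *
    q ((enorm u)^-1 *: u) ((enorm v)^-1 *: v).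
Proof.
move=> u0 v0; have nu : enorm u != 0 by rewrite enorm_eq0.
have nv : enorm v != 0 by rewrite enorm_eq0.
rewrite metricZ ?invr_eq0 // -scalemxAr dotZl dotZr.
by field; rewrite nu nv.
Qed.

Lemma enorm_normalize (u : V) : u != 0 -> enorm ((enorm u)^-1 *: u) = 1.
Proof.
move=> u0; rewrite enormZ ger0_norm ?invr_ge0 ?enorm_ge0 // mulVf //.
by rewrite enorm_eq0.
Qed.

Lemma metric_ge : exists2 m : R, 0 < m & forall u v, u != 0 ->
  m * (enorm (perp u v) / enorm u) ^+ 2 <= q u v.
Proof.
have [m m0 hm] := metric_ge_unit; exists m => // u v u0.
rewrite -(metric_perp v u0).
have [->|p0] := eqVneq (perp u v) 0.
  by rewrite enorm0 mul0r expr0n mulr0 mulmx0 dot0r.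
rewrite metric_normalize // mulrC expr_div_n; apply: ler_wpM2l.
  by rewrite divr_ge0 ?exprn_ge0 ?enorm_ge0.
apply: hm; rewrite ?enorm_normalize //.
by rewrite dotZl dotZr dot_perp // !mulr0.
Qed.

Lemma metric_le : exists2 B : R, 0 < B & forall u v, u != 0 ->
  q u v <= B * (enorm v / enorm u) ^+ 2.
Proof.
have [B B0 hB] := metric_le_unit; exists B => // u v u0.
have [->|v0] := eqVneq v 0; first by rewrite enorm0 mul0r expr0n mulr0 mulmx0 dot0r.
rewrite metric_normalize // (mulrC B) expr_div_n; apply: ler_wpM2l.
  by rewrite divr_ge0 ?exprn_ge0 ?enorm_ge0.
by apply: hB; rewrite enorm_normalize.
Qed.

End Quad.

(** * Lengths of curves *)

Section Curve.
Context {R : realType} {k : nat}.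
Local Notation V := 'cV[R]_k.+1.
Local Notation M := 'M[R]_k.+1.
Variable h : V -> M.
Hypothesis hh : riemannian_metric h.
Local Notation mu := (@lebesgue_measure R).


Lemma within01 (f : R -> R) : (forall t : R, t \in `[0, 1] -> {for t, continuous f}) ->
  {within `[0, 1], continuous f}.
Proof.
move=> fc; apply: continuous_in_subspaceT => t.
by rewrite inE /= => t01; exact: fc.
Qed.

Lemma integrable01 (f : R -> R) : (forall t : R, t \in `[0, 1] -> {for t, continuous f}) ->
  mu.-integrable `[0, 1] (EFin \o f).
Proof.
move=> fc; apply: continuous_compact_integrable; first exact: segment_compact.
exact: within01.
Qed.

Section curve.
Variable c : R -> V.
Hypothesis c1 : C1_curve c.
Local Notation dc := (derive1 c).

Let cd (t : R) : derivable c t 1. Proof. by case: c1. Qed.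
Arguments cd : clear implicits.

Let c_entry (t : R) i : is_derive t (1 : R) (fun s => c s i 0 : R) (dc t i 0).
Proof.
have /derivable_mxP/(_ i 0) ct := cd t.
apply: DeriveDef => //; rewrite derive1E (derive_mx (cd t)).
by rewrite mxE.
Qed.

Let c_cont (t : R) : {for t, continuous c}.
Proof. exact/differentiable_continuous/derivable1_diffP/cd. Qed.
Arguments c_cont : clear implicits.

Let dc_cont (t : R) : {for t, continuous dc}.
Proof. by case: c1 => _ + _; apply. Qed.
Arguments dc_cont : clear implicits.

Let c_entry_cont (t : R) i : c s i 0 @[s --> t] --> (c t i 0 : R).
Proof. by apply: cvg_entry; exact: c_cont. Qed.

Let dc_entry_cont (t : R) i : dc s i 0 @[s --> t] --> (dc t i 0 : R).
Proof. by apply: cvg_entry; exact: dc_cont. Qed.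

Lemma is_derive_dotl w (t : R) :
  is_derive t (1 : R) (fun s => dot w (c s)) (dot w (dc t)).
Proof.
rewrite (_ : (fun s => _) = \sum_(i < k.+1) (w i 0 *: (fun s => c s i 0 : R))).
  rewrite dotE; apply: is_derive_sum => i.
  by apply: is_deriveZ; exact: c_entry.
by apply/funext => s; rewrite dotE fct_sumE.
Qed.

Lemma is_derive_dot_sqr (t : R) :
  is_derive t (1 : R) (fun s => dot (c s) (c s)) (2 * dot (c t) (dc t)).
Proof.
rewrite (_ : (fun s => _) =
    \sum_(i < k.+1) ((fun s => c s i 0 : R) * (fun s => c s i 0 : R))).
  rewrite (_ : 2 * _ = \sum_(i < k.+1)
      (c t i 0 *: dc t i 0 + c t i 0 *: dc t i 0)).
    by apply: is_derive_sum => i; apply: is_deriveM; exact: c_entry.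
  rewrite dotE mulr_sumr; apply: eq_bigr => i _.
  by rewrite mulr2n mulrDl mul1r.
by apply/funext => s; rewrite dotE fct_sumE.
Qed.

Let speed (t : R) : R := Num.sqrt (dot (dc t) (h (c t) *m dc t)).
Let unit_part (t : R) : V := (enorm (c t))^-1 *: c t.

Lemma curve_lengthE : curve_length h c = \int[mu]_(t in `[0, 1]) speed t.
Proof. by apply: eq_Rintegral => t _; rewrite quad_dot. Qed.

Let c_neq0 (t : R) : t \in `[0, 1] -> c t != 0.
Proof. by move=> t01; case: c1 => _ _; apply. Qed.

Lemma speed_continuous (t : R) : t \in `[0, 1] -> {for t, continuous speed}.
Proof.
move=> /c_neq0 ct; apply: continuous_cvg; first exact: sqrt_continuous.
apply: cvg_quad => [i j|i]; last exact: dc_entry_cont.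
apply: cvg_entry; apply: (cvg_comp c h (c_cont t)).
exact: (metric_continuous hh ct).
Qed.

Section chord.
Variable w : V.

Let f (t : R) : R := dot w (c t) * (Num.sqrt (dot (c t) (c t)))^-1.
Let phi (t : R) : R := (dot w (dc t) - dot (c t) (dc t) * (dot (c t) (c t))^-1 *
  dot w (c t)) * (Num.sqrt (dot (c t) (c t)))^-1.

Let f_derive (t : R) : t \in `[0, 1] -> is_derive t (1 : R) f (phi t).
Proof.
move=> /c_neq0 ct; have N0 : 0 < dot (c t) (c t) by rewrite lt_def dot_eq0 ct dot_ge0.
pose r := Num.sqrt (dot (c t) (c t)).
have r0 : 0 < r by rewrite sqrtr_gt0.
have rN : dot (c t) (c t) = r ^+ 2 by rewrite sqr_sqrtr // ltW.
have d1 : is_derive t (1 : R) (fun s => dot w (c s)) (dot w (dc t)).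
  exact: is_derive_dotl.
have d2 : is_derive t (1 : R) (fun s => dot (c s) (c s)) (2 * dot (c t) (dc t)).
  exact: is_derive_dot_sqr.
have d3 : is_derive t (1 : R) (Num.sqrt \o (fun s => dot (c s) (c s)))
    ((2 * r)^-1 * (2 * dot (c t) (dc t))).
  by apply: is_derive1_comp; exact: is_derive1_sqrt.
have d4 : is_derive t (1 : R) (fun s => (Num.sqrt (dot (c s) (c s)))^-1)
    (- r ^- 2 *: ((2 * r)^-1 * (2 * dot (c t) (dc t)))).
  by apply: is_deriveV d3; rewrite /= gt_eqF.
have := is_deriveM d1 d4; rewrite /GRing.scale /= -/r.
rewrite (_ : _ * (- _ * _) + _ = phi t) //.
by rewrite /phi -/r rN; field; rewrite gt_eqF.
Qed.

Let phi_cont (t : R) : t \in `[0, 1] -> {for t, continuous phi}.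
Proof.
move=> /c_neq0 ct; have N0 : dot (c t) (c t) != 0 by rewrite dot_eq0.
have r0 : Num.sqrt (dot (c t) (c t)) != 0.
  by rewrite gt_eqF // sqrtr_gt0 lt_def N0 dot_ge0.
have cw (u : R -> V) : (forall i, u s i 0 @[s --> t] --> (u t i 0 : R)) ->
    dot w (u s) @[s --> t] --> dot w (u t).
  by move=> uc; apply: cvg_dot => i //; exact: cvg_cst.
have cc i : c s i 0 @[s --> t] --> (c t i 0 : R) by exact: c_entry_cont.
have cdc i : dc s i 0 @[s --> t] --> (dc t i 0 : R) by exact: dc_entry_cont.
have cN : dot (c s) (c s) @[s --> t] --> dot (c t) (c t) by exact: cvg_dot.
apply: cvgM; last first.
  apply: cvgV => //; apply: continuous_cvg => //; exact: sqrt_continuous.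
apply: cvgB; first exact: cw.
apply: cvgM; last exact: cw.
by apply: cvgM; [exact: cvg_dot|apply: cvgV].
Qed.

Let f_FTC : \int[mu]_(t in `[0, 1]) phi t = f 1 - f 0.
Proof.
have in0 : (0 : R) \in `[0, 1] by rewrite in_itv /= lexx ler01.
have in1 : (1 : R) \in `[0, 1] by rewrite in_itv /= lexx ler01.
have fc (t : R) : t \in `[0, 1] -> {for t, continuous f}.
  move=> t01; apply/differentiable_continuous/derivable1_diffP.
  by case: (f_derive t01).
rewrite /Rintegral (@continuous_FTC2 _ phi f) //.
- exact: within01 phi_cont.
- split.
  + move=> t t01; have [] // := f_derive (subset_itv_oo_cc t01).
  + exact/cvg_at_right_filter/fc.
  + exact/cvg_at_left_filter/fc.
- move=> t t01; rewrite derive1E.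
  by have [_ ->] := f_derive (subset_itv_oo_cc t01).
Qed.

(** The function [f] is the coordinate along [w] of the normalized curve, and its
derivative is bounded by the norm of [w] times that of the derivative of the
normalized curve, which the metric controls. *)
Lemma curve_chord m : 0 < m -> (forall u v, u != 0 ->
    m * (enorm (perp u v) / enorm u) ^+ 2 <= dot v (h u *m v)) ->
  f 1 - f 0 <= enorm w * ((Num.sqrt m)^-1 * curve_length h c).
Proof.
move=> m0 hm; rewrite curve_lengthE -f_FTC mulrA -RintegralZl //; last first.
  by apply: integrable01 => t t01; exact: speed_continuous.
apply: le_Rintegral => //.
- exact: integrable01 phi_cont.
- apply: integrable01 => t t01.
  by apply: cvgM; [exact: cvg_cst|exact: speed_continuous].
move=> t /= t01; have ct := c_neq0 t01.
have -> : phi t = dot w (perp (c t) (dc t)) / enorm (c t).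
  by rewrite /phi /perp dotBr dotZr.
apply: le_trans (ler_norm _) _; rewrite normrM normfV (ger0_norm (enorm_ge0 _)).
apply: (@le_trans _ _ (enorm w * (enorm (perp (c t) (dc t)) / enorm (c t)))).
  rewrite mulrA; apply: ler_wpM2r; first by rewrite invr_ge0 enorm_ge0.
  exact: cauchy_schwarz.
rewrite -mulrA; apply: ler_wpM2l; first exact: enorm_ge0.
rewrite ler_pdivlMl ?sqrtr_gt0 //.
rewrite -[leLHS]ger0_norm; last first.
  by rewrite mulr_ge0 ?sqrtr_ge0 // divr_ge0 ?enorm_ge0.
rewrite -sqrtr_sqr; apply: ler_wsqrtr.
by rewrite exprMn sqr_sqrtr ?(ltW m0) // hm.
Qed.

End chord.

(** [curve_chord] with [w] the difference of the two normalized endpoints. *)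
Lemma curve_length_ge m : 0 < m -> (forall u v, u != 0 ->
    m * (enorm (perp u v) / enorm u) ^+ 2 <= dot v (h u *m v)) ->
  Num.sqrt m * enorm (unit_part 1 - unit_part 0) <= curve_length h c.
Proof.
move=> m0 hm; have s0 : 0 < Num.sqrt m by rewrite sqrtr_gt0.
set w := unit_part 1 - unit_part 0.
have [->|w0] := eqVneq w 0.
  rewrite enorm0 mulr0 curve_lengthE; apply: Rintegral_ge0 => t _.
  exact: sqrtr_ge0.
have := curve_chord w m0 hm.
have fE t : dot w (c t) * (Num.sqrt (dot (c t) (c t)))^-1 = dot w (unit_part t).
  by rewrite /unit_part dotZr mulrC.
rewrite !fE -dotBr -/w -enorm_sqr expr2 ler_pM2l ?enorm_gt0 //.
by rewrite -ler_pdivlMl ?invr_gt0 // invrK.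
Qed.

End curve.

Definition segment (u v : V) (t : R) : V := u + t *: (v - u).

Lemma segment_derive u v (t : R) : is_derive t (1 : R) (segment u v) (v - u).
Proof.
have d i j : is_derive t (1 : R) (fun s => segment u v s i j : R) ((v - u) i j).
  rewrite (_ : (fun s => _) = cst (u i j) + ((v - u) i j \*: (id : R -> R))).
    rewrite -[X in is_derive _ _ _ X]mulr1 -[X in is_derive _ _ _ X]add0r.
    exact: is_deriveD.
  by apply/funext => s; rewrite /segment !mxE mulrC /= !fctE /=.
have dm : derivable (segment u v) t 1.
  by apply/derivable_mxP => i j; case: (d i j).
apply: DeriveDef => //; rewrite (derive_mx dm); apply/matrixP => i j.
by rewrite mxE; case: (d i j).
Qed.

Lemma segment_C1 u v : (forall t, 0 <= t <= 1 -> segment u v t != 0) ->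
  C1_curve (segment u v).
Proof.
move=> uv; split => // [t|].
  by case: (segment_derive u v t).
have -> : derive1 (segment u v) = fun=> v - u.
  by apply/funext => t; rewrite derive1E; case: (segment_derive u v t).
exact: cst_continuous.
Qed.

Lemma segment_length B u v : (forall x y, x != 0 ->
    dot y (h x *m y) <= B ^+ 2 * (enorm y / enorm x) ^+ 2) -> 0 <= B ->
  (forall t, 0 <= t <= 1 -> 1 <= enorm (segment u v t)) ->
  curve_length h (segment u v) <= B * enorm (v - u).
Proof.
move=> hB B0 uv.
have uv0 t : 0 <= t <= 1 -> segment u v t != 0.
  by move=> t01; rewrite -enorm_gt0; apply: lt_le_trans (uv t t01).
have c1 := segment_C1 uv0.
rewrite curve_lengthE //.
have -> : B * enorm (v - u) = \int[mu]_(t in `[0, 1]) (B * enorm (v - u)).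
  rewrite Rintegral_cst // -[X in _ = _ * fine X]/(lebesgue_measure `[0%R, 1%R]%classic).
  by rewrite lebesgue_measure_itv /= lte_fin ltr01 -EFinB subr0 /= mulr1.
apply: le_Rintegral => //.
- by apply: integrable01 => t t01; exact: speed_continuous.
- by apply: integrable01 => t t01; exact: cst_continuous.
move=> t /= t01.
have -> : derive1 (segment u v) t = v - u.
  by rewrite derive1E; case: (segment_derive u v t).
have s1 := uv t t01.
rewrite -[leRHS]ger0_norm ?mulr_ge0 ?enorm_ge0 // -sqrtr_sqr; apply: ler_wsqrtr.
apply: le_trans (hB _ _ (uv0 t t01)) _; rewrite [leRHS]exprMn.
apply: ler_wpM2l; first exact: sqr_ge0.
rewrite ler_pXn2r ?nnegrE ?divr_ge0 ?enorm_ge0 // ler_pdivrMr ?(lt_le_trans _ s1) //.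
by rewrite ler_peMr ?enorm_ge0.
Qed.

End Curve.

(** * Riemannian distance and Hausdorff measure *)

Section RiemDist.
Context {R : realType} {k : nat}.
Local Notation V := 'cV[R]_k.+1.
Local Notation M := 'M[R]_k.+1.
Variable h : V -> M.
Hypothesis hh : riemannian_metric h.

Let lengths (L L' : proj_space R k) := [set l | exists c, [/\ C1_curve c,
  c 0 \in val L, c 1 \in val L' & l = curve_length h c]].

Let lengths_lb L L' : lbound (lengths L L') 0.
Proof. by move=> _ [c [_ _ _ ->]]; apply: Rintegral_ge0 => t _; exact: sqrtr_ge0. Qed.

Lemma proj_lineE (L : proj_space R k) x : x != 0 -> x \in val L -> val L = <[x]>%VS.
Proof. by move=> x0 xL; apply: line_vline => //; exact/eqP/(valP L). Qed.

Lemma unit_line_sign (x u : V) : enorm x = 1 -> u != 0 -> u \in <[x]>%VS ->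
  exists b : bool, (enorm u)^-1 *: u = (-1) ^+ b *: x.
Proof.
move=> x1 u0 /vlineP[a ua]; exists (a < 0).
have a0 : a != 0 by apply/eqP => a0; move: u0; rewrite ua a0 scale0r eqxx.
rewrite ua enormZ x1 mulr1 scalerA; congr (_ *: _).
case: ltP => [/ltr0_norm|/ger0_norm] ->; last by rewrite expr0 mulVf.
by rewrite expr1 invrN mulNr mulVf.
Qed.

Lemma segment_neq0 (x z : V) : enorm x = 1 -> enorm z = 1 -> 0 <= dot x z ->
  forall t, 0 <= t <= 1 -> segment x z t != 0.
Proof.
move=> x1 z1 xz t /andP[t0 t1]; apply/eqP => s0.
have xx : dot x x = 1 by rewrite -enorm_sqr x1 expr1n.
have zz : dot z z = 1 by rewrite -enorm_sqr z1 expr1n.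
have h1 : dot x (segment x z t) = 0 by rewrite s0 dot0r.
have h2 : dot z (segment x z t) = 0 by rewrite s0 dot0r.
move: h1 h2; rewrite /segment !dotDr !dotZr !dotBr xx zz (dotC z x) => h1 h2.
have h3 : 0 <= t * dot x z by rewrite mulr_ge0.
have t1' : t = 1 by lra.
by move: h2; rewrite t1'; lra.
Qed.

(** An infimum over the empty set would be 0, so some curve has to be exhibited:
the segment between representatives that form an acute angle avoids 0. *)
Lemma riem_dist_ge : exists2 a : R, 0 < a & forall (L L' : proj_space R k) x y,
  enorm x = 1 -> enorm y = 1 -> x \in val L -> y \in val L' ->
  a * chord x y <= riem_dist h L L'.
Proof.
have [m m0 hm] := metric_ge hh.
exists (Num.sqrt m); first by rewrite sqrtr_gt0.
move=> L L' x y x1 y1 xL yL'; apply: lb_le_inf.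
  pose b := dot x y < 0; pose z := (-1) ^+ b *: y.
  have z1 : enorm z = 1 by rewrite enorm_sign.
  have xz : 0 <= dot x z.
    rewrite /z dotZr /b; case: ltP => [xy|xy]; last by rewrite expr0 mul1r.
    by rewrite expr1 mulN1r oppr_ge0 ltW.
  exists (curve_length h (segment x z)), (segment x z); split => //.
  - exact: segment_C1 (segment_neq0 x1 z1 xz).
  - by rewrite /segment scale0r addr0.
  - by rewrite /segment scale1r addrC subrK memvZ.
move=> _ [c [c1 c0L c1L' ->]].
have [_ _ cneq] := c1.
have c00 : c 0 != 0 by apply: cneq; rewrite lexx ler01.
have c10 : c 1 != 0 by apply: cneq; rewrite lexx ler01.
apply: le_trans (curve_length_ge hh c1 m0 hm).
apply: ler_wpM2l; first exact: sqrtr_ge0.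
have x0 := unit_neq0 x1; have y0 := unit_neq0 y1.
rewrite (proj_lineE x0 xL) in c0L; rewrite (proj_lineE y0 yL') in c1L'.
have [b ->] := unit_line_sign x1 c00 c0L.
have [b' ->] := unit_line_sign y1 c10 c1L'.
rewrite -(enorm_sign b) scalerBr !scalerA -!signr_addb addbb expr0 scale1r.
by rewrite enorm_distC; exact: chord_le.
Qed.

Lemma riem_dist_le : exists2 B : R, 0 <= B & forall (L L' : proj_space R k) u v,
  u \in val L -> v \in val L' ->
  (forall t, 0 <= t <= 1 -> 1 <= enorm (segment u v t)) ->
  riem_dist h L L' <= B * enorm (v - u).
Proof.
have [B B0 hB] := metric_le hh; exists (Num.sqrt B); first exact: sqrtr_ge0.
move=> L L' u v uL vL' uv.
have uv0 t : 0 <= t <= 1 -> segment u v t != 0.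
  by move=> t01; rewrite -enorm_gt0; apply: lt_le_trans (uv t t01).
apply: le_trans (segment_length hh _ (sqrtr_ge0 B) uv); last first.
  by move=> x y x0; rewrite sqr_sqrtr ?(ltW B0) // hB.
apply: ge_inf; first by exists 0; exact: lengths_lb.
exists (segment u v); split => //; first exact: segment_C1.
  by rewrite /segment scale0r addr0.
by rewrite /segment scale1r addrC subrK.
Qed.

End RiemDist.

Section Hausdorff.
Context {R : realType} {X : Type} (d : X -> X -> R).
Local Open Scope ereal_scope.

Lemma diam_ge0 (U : set X) : 0 <= diam d U.
Proof. by rewrite le_max lexx. Qed.

Lemma le_diam (U : set X) x y : U x -> U y -> (d x y)%:E <= diam d U.
Proof.
move=> Ux Uy; rewrite le_max; apply/orP; right.
by apply: ereal_sup_ubound; exists (x, y).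
Qed.

Lemma diam_le (U : set X) (r : R) : (0 <= r)%R ->
  (forall x y, U x -> U y -> (d x y <= r)%R) -> diam d U <= r%:E.
Proof.
move=> r0 Ur; rewrite ge_max lee_fin r0 /=; apply: ge_ereal_sup => _ [[x y] [/= Ux Uy] <-].
by rewrite lee_fin; exact: Ur.
Qed.

Lemma diam_set0 : diam d set0 = 0.
Proof. by apply/le_anti; rewrite diam_ge0 diam_le. Qed.

Lemma hausdorff_premeasure_ge0 s e A : 0 <= hausdorff_premeasure d s e A.
Proof.
apply/ereal_infP => _ [U _ <-].
by apply: nneseries_ge0 => n _ _; exact: poweR_ge0.
Qed.

(** A finite cover is turned into a sequence by adding empty sets, which have
diameter 0. *)
Lemma hausdorff_premeasure_fin (I : finType) (U : I -> set X) (A : set X) (s e r : R) :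
  (0 < s)%R -> (0 <= r <= e)%R -> A `<=` \bigcup_i U i ->
  (forall i, diam d (U i) <= r%:E) ->
  hausdorff_premeasure d s e A <= (#|I|%:R * r `^ s)%:E.
Proof.
move=> s0 /andP[r0 re] AU Ur.
pose W n := [set x | exists i : I, enum_rank i = n :> nat /\ U i x].
have Wr n : diam d (W n) <= r%:E.
  apply: diam_le => // x y [i [<- Ux]] [j [/val_inj/enum_rank_inj ji Uy]].
  rewrite ji in Uy; rewrite -lee_fin; apply: le_trans (Ur i); exact: le_diam.
have W0 n : (#|I| <= n)%N -> W n = set0.
  move=> In; apply/seteqP; split => // x [i [ni _]].
  by have := ltn_ord (enum_rank i); rewrite ni ltnNge In.
apply: (@le_trans _ _ (\sum_(0 <= n <oo) (diam d (W n) `^ s))).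
  apply: ereal_inf_lbound; exists W => //; split.
    move=> x /AU[i _ Ux]; exists (enum_rank i) => //; by exists i.
  by move=> n; apply: le_trans (Wr n) _; rewrite lee_fin.
apply: lime_le; first by apply: is_cvg_nneseries => n _ _; exact: poweR_ge0.
apply: nearW => n.
suff : \sum_(0 <= i < n) (diam d (W i) `^ s) <= ((minn n #|I|)%:R * r `^ s)%:E.
  move/le_trans; apply; rewrite lee_fin ler_wpM2r ?powR_ge0 // ler_nat.
  exact: geq_minr.
elim: n => [|n IH]; first by rewrite big_geq // min0n mul0r.
rewrite big_nat_recr //=; have [nI|In] := ltnP n #|I|.
  have -> : minn n.+1 #|I| = (minn n #|I|).+1.
    by rewrite !(minn_idPl _) // ltnW.
  rewrite -natr1 mulrDl mul1r EFinD; apply: leeD => //.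
  rewrite -poweR_EFin; apply: gt0_ler_poweR; first exact: ltW.
  - by rewrite in_itv /= leey diam_ge0.
  - by rewrite in_itv /= leey lee_fin r0.
  - exact: Wr.
rewrite W0 // diam_set0 poweR0r ?gt_eqF // adde0.
by apply: le_trans IH _; rewrite !(minn_idPr _) // ltnW.
Qed.

End Hausdorff.

(** * The two inequalities *)

Section UpperBound.
Context {R : realType} {k : nat}.
Local Notation V := 'cV[R]_k.+1.
Local Notation M := 'M[R]_k.+1.
Variable h : V -> M.
Hypothesis hh : riemannian_metric h.

(** Normalizing the largest coordinate of a vector of [L] to 1. *)
Lemma chart_rep (L : proj_space R k) : exists (u : V) (j : 'I_k.+1),
  [/\ u \in val L, u j 0 = 1 & forall i, `|u i 0| <= 1].
Proof.
pose x := vpick (val L).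
have x0 : x != 0.
  by rewrite vpick0; apply/eqP => L0; have := valP L; rewrite /= L0 dimv0.
have [j jmax] : exists j, forall i, `|x i 0| <= `|x j 0|.
  by case: (@arg_maxP _ _ _ ord0 xpredT (fun i => `|x i 0|) isT) => j _ jm; exists j => i; exact: jm.
have xj : x j 0 != 0.
  apply/eqP => xj0; move: x0 => /eqP; apply; apply/colP => i; rewrite mxE.
  by apply/eqP; rewrite -normr_le0; apply: le_trans (jmax i) _; rewrite xj0 normr0.
exists ((x j 0)^-1 *: x), j; split.
- by rewrite memvZ // memv_pick.
- by rewrite mxE mulVf.
- move=> i; rewrite mxE normrM normfV ler_pdivrMl ?normr_gt0 // mulr1.
  exact: jmax.
Qed.

(** In the affine chart where the coordinate [z.1] is 1, the cube [-1, 1] ^ k is cut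
into cubes of side [1 / N], indexed by the lower corner. *)
Definition cell (N : nat) (z : 'I_k.+1 * {ffun 'I_k -> 'I_(2 * N).+1}) :
    set (proj_space R k) :=
  [set L : proj_space R k | exists u : V, [/\ u \in val L, u z.1 0 = 1 & forall i,
    (z.2 i)%:R <= (u (lift z.1 i) 0 + 1) * N%:R <= (z.2 i).+1%:R]].

Lemma cells_cover N (L : proj_space R k) : exists z, cell (N := N) z L.
Proof.
have [u [j [uL uj u1]]] := chart_rep L.
have y0 i : 0 <= (u i 0 + 1) * N%:R.
  by rewrite mulr_ge0 //; move: (u1 i); rewrite ler_norml => /andP[]; lra.
have yN i : (u i 0 + 1) * N%:R <= (2 * N)%:R.
  by rewrite natrM ler_wpM2r //; move: (u1 i); rewrite ler_norml => /andP[_]; lra.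
have yt i : (Num.truncn ((u i 0 + 1) * N%:R)%R < (2 * N).+1)%N.
  rewrite ltnS -(ler_nat R); apply: le_trans (yN i).
  by rewrite truncn_le.
exists (j, [ffun i => Ordinal (yt (lift j i))]), u; split => // i.
rewrite ffunE /=; have /andP[-> /ltW ->] := truncn_itv (y0 (lift j i)).
by [].
Qed.

(** Segments between two points of a chart stay in the chart, hence away from 0,
where the metric is bounded by a multiple of the Euclidean one. *)
Lemma cell_diam : exists2 r : R, 0 < r & forall N z, (0 < N)%N ->
  (diam (riem_dist h) (cell (N := N) z) <= (r / N%:R)%:E)%E.
Proof.
have [B B0 hB] := riem_dist_le hh.
exists (B * k.+1%:R + 1); first by rewrite ltr_wpDl // mulr_ge0.
move=> N [j f] N0; have N0' : 0 < N%:R :> R by rewrite ltr0n.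
apply: diam_le => [|L L' [u [uL uj uf]] [v [vL' vj vf]]].
  by rewrite divr_ge0 ?addr_ge0 ?mulr_ge0.
apply: le_trans (hB L L' u v uL vL' _) _ => [t _|].
  apply: le_trans (enorm_coord _ j).
  by rewrite /segment !mxE /= in uj vj *; rewrite uj vj subrr mulr0 addr0 normr1.
have : enorm (v - u) <= k.+1%:R / N%:R.
  apply: le_trans (enorm_le_sum _) _.
  apply: (@le_trans _ _ (\sum_(i < k.+1) N%:R^-1)); last first.
    by rewrite sumr_const card_ord -(mulr_natl (N%:R^-1)).
  apply: ler_sum => i _; rewrite !mxE.
  have [i' ->|->] := unliftP j i; last first.
    by rewrite /= in uj vj; rewrite uj vj subrr normr0 invr_ge0 ltW.
  have /andP[/= u1 u2] := uf i'; have /andP[/= v1 v2] := vf i'.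
  rewrite -[leRHS]mul1r ler_pdivlMr // -[X in _ * X](ger0_norm (ltW N0')) -normrM.
  rewrite -natr1 in u2 v2.
  by rewrite ler_norml mulrBl; move: u1 u2 v1 v2; rewrite !mulrDl; lra.
move=> le1; apply: (@le_trans _ _ (B * (k.+1%:R / N%:R))); first exact: ler_wpM2l.
by rewrite mulrA ler_pM2r ?invr_gt0 // lerDl.
Qed.

(** About [N ^ k] cells of diameter at most [r / N] cover the projective space, so
the sum of the powers of their diameters is of order [N ^ (- t)] for the exponent
[k + t]. *)
Lemma hausdorff_dim_riem_le (A : set (proj_space R k)) :
  (hausdorff_dim (riem_dist h) A <= k%:R%:E)%E.
Proof.
apply/lee_addgt0Pr => t t0; apply: ereal_inf_lbound.
exists (k%:R + t); last by rewrite EFinD.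
have s0 : 0 < k%:R + t by rewrite ltr_wpDl.
split => //; apply/le_anti/andP; split; last first.
  apply: le_trans (_ : hausdorff_premeasure (riem_dist h) (k%:R + t) 1 A <= _)%E.
    exact: hausdorff_premeasure_ge0.
  by apply: ereal_sup_ubound; exists 1; rewrite //= ltr01.
apply: ge_ereal_sup => _ [e /= e0 <-].
apply/lee_addgt0Pr => eta eta0; rewrite add0e.
have [r r0 hr] := cell_diam.
pose C := k.+1%:R * 3 ^+ k * r `^ (k%:R + t).
have C0 : 0 < C by rewrite !mulr_gt0 ?powR_gt0 ?exprn_gt0.
pose y := Num.max (r / e) ((C / eta) `^ t^-1).
have y0 : 0 <= y by rewrite le_max powR_ge0 orbT.
pose N := (Num.truncn y).+1.
have N0 : 0 < N%:R :> R by rewrite ltr0n.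
have yN : y <= N%:R by apply: ltW; exact: truncnS_gt.
have reN : r / N%:R <= e.
  rewrite ler_pdivrMr // mulrC -ler_pdivrMr //; apply: le_trans yN.
  by rewrite le_max lexx.
have CN : C / eta <= N%:R `^ t.
  have : (C / eta) `^ t^-1 `^ t <= N%:R `^ t.
    apply: ge0_ler_powR; rewrite ?nnegrE ?powR_ge0 ?(ltW N0) ?(ltW t0) //.
    by apply: le_trans yN; rewrite le_max lexx orbT.
  rewrite -powRrM mulVf ?gt_eqF // powRr1 //.
  by rewrite divr_ge0 // ltW.
have re0 : 0 <= r / N%:R <= e by rewrite reN divr_ge0 // ltW.
have cov : A `<=` \bigcup_z cell (N := N) z.
  by move=> L _; have [z zL] := cells_cover N L; exists z.
apply: le_trans (hausdorff_premeasure_fin s0 re0 cov (fun z => hr N z isT)) _.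
rewrite lee_fin card_prod card_ffun !card_ord natrM natrX.
have -> : (r / N%:R) `^ (k%:R + t) = r `^ (k%:R + t) / (N%:R ^+ k * N%:R `^ t).
  rewrite powRM ?invr_ge0 ?(ltW r0) ?(ltW N0) //; congr (_ * _).
  rewrite -powR_inv1 ?(ltW N0) // -powRrM mulN1r powRN; congr (_^-1).
  by rewrite powRD ?gt_eqF ?implybT // powR_mulrn // ltW.
have Nk : (2 * N).+1%:R ^+ k <= 3 ^+ k * N%:R ^+ k :> R.
  rewrite -exprMn; apply: lerXn2r; rewrite ?nnegrE ?mulr_ge0 //.
  by rewrite -natrM ler_nat /N; lia.
apply: (@le_trans _ _ (k.+1%:R * (3 ^+ k * N%:R ^+ k) *
    (r `^ (k%:R + t) / (N%:R ^+ k * N%:R `^ t)))).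
  apply: ler_wpM2r.
    by rewrite divr_ge0 ?mulr_ge0 ?powR_ge0 ?exprn_ge0 // ltW.
  exact: ler_wpM2l.
have Nt0 : 0 < N%:R `^ t by rewrite powR_gt0.
have Nk0 : 0 < N%:R ^+ k :> R by rewrite exprn_gt0.
rewrite (_ : _ * _ = C / N%:R `^ t); last first.
  by rewrite /C; field; rewrite !gt_eqF.
by rewrite ler_pdivrMr // mulrC -ler_pdivrMr.
Qed.

End UpperBound.

Section LowerBound.
Context {R : realType} {k : nat}.
Local Notation V := 'cV[R]_k.+1.
Local Notation M := 'M[R]_k.+1.
Variable h : V -> M.
Hypothesis hh : riemannian_metric h.
Variables (Gam : set M).
Hypothesis hk : (1 <= k)%N.
Hypothesis hGam : SL_subgroup Gam.
Hypothesis hA : projective_anosov Gam.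

(** A cover of the limit lines with small sum of powers of the diameters gives balls
for the chordal distance, by [riem_dist_ge], to which [poincare_bound] applies. *)
Lemma exponent_le_hausdorff_dim :
  (hilbert_critical_exponent Gam <=
   hausdorff_dim (riem_dist h) (@flag_line R k @` limit_set Gam))%E.
Proof.
have [_ [S hS qi] hgap] := hA.
have hQI := qi 1 (det1 _ _).
apply/ereal_infP => _ [s [s0 Hs0] <-].
have [eta [rho0 [eta0 rho00 pb]]] := poincare_bound hk hGam hS hQI hgap s0.
have [a a0 ha] := riem_dist_ge hh.
set A := _ @` _ in Hs0.
pose e := a * rho0.
have e0 : 0 < e by rewrite mulr_gt0.
pose eta1 := a `^ s * (eta / 2).
have eta10 : 0 < eta1 by rewrite mulr_gt0 ?powR_gt0 ?divr_gt0.
have : (hausdorff_premeasure (riem_dist h) s e A < eta1%:E)%E.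
  apply: le_lt_trans (_ : (0 < _)%E); last by rewrite lte_fin.
  by rewrite -Hs0; apply: ereal_sup_ubound; exists e.
move=> /ereal_inf_lt[_ [U [AU Ue] <-] Usum].
pose dU i := fine (diam (riem_dist h) (U i)).
have dfin i : diam (riem_dist h) (U i) = (dU i)%:E.
  rewrite /dU fineK // ge0_fin_numE ?diam_ge0 //.
  exact: le_lt_trans (Ue i) (ltry _).
have dU0 i : 0 <= dU i by rewrite -lee_fin -dfin diam_ge0.
have dUe i : dU i <= e by rewrite -lee_fin -dfin.
have dUsum n : \sum_(i < n) dU i `^ s <= eta1.
  rewrite -lee_fin; apply: le_trans (ltW Usum).
  rewrite -sumEFin; apply: le_trans (_ : (\sum_(0 <= i < n)
     (diam (riem_dist h) (U i)) `^ s <= _)%E).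
    by rewrite big_mkord; apply: lee_sum => i _; rewrite dfin poweR_EFin.
  by apply: nneseries_lim_ge => i _ _; exact: poweR_ge0.
(* Sets of diameter 0 also need balls of positive radius; the powers of the radii
eps i add up to at most eta / 2. *)
pose eps (i : nat) : R := Num.min rho0 ((eta / 2 ^+ i.+2) `^ s^-1).
have eps0 i : 0 < eps i.
  by rewrite lt_min rho00 powR_gt0 // divr_gt0 // exprn_gt0.
have epss i : eps i `^ s <= eta / 2 ^+ i.+2.
  apply: (@le_trans _ _ ((eta / 2 ^+ i.+2) `^ s^-1 `^ s)).
    apply: ge0_ler_powR; rewrite ?nnegrE ?powR_ge0 ?(ltW s0) ?(ltW (eps0 _)) //.
    by rewrite ge_min lexx orbT.
  by rewrite -powRrM mulVf ?gt_eqF // powRr1 // divr_ge0 ?exprn_ge0 // ltW.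
pose rho i := Num.max (dU i / a) (eps i).
pose hit i x := enorm x = 1 /\ exists F, [/\ limit_set Gam F, x \in (val F).1 &
  U i (flag_line F)].
pose J : pred nat := fun i => `[< exists x, hit i x >].
have /boolp.choice[x xP] : forall i, exists x, J i -> hit i x.
  move=> i; have [/asboolP[x hx]|nJ] := boolP (J i); first by exists x.
  by exists 0.
have Jrho i : J i -> in_limit_line Gam (x i) /\ 0 < rho i <= rho0.
  move=> /xP[x1 [F [LF xF _]]]; split; first by split => //; exists F.
  rewrite lt_max eps0 orbT ge_max ge_min lexx andbT /=.
  by rewrite ler_pdivrMr // mulrC.
have cov : chord_cover Gam J x rho.
  move=> u [u1 [F LF uF]].
  have [i _ UiF] : (\bigcup_i U i) (flag_line F) by apply: AU; exists F.
  have Ji : J i by apply/asboolP; exists u; split => //; exists F.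
  exists i => //; have [x1 [F' [LF' xF' UF']]] := xP i Ji.
  rewrite le_max; apply/orP; left; rewrite ler_pdivlMr // mulrC.
  apply: le_trans (ha (flag_line F) (flag_line F') _ _ u1 x1 uF xF') _.
  by rewrite -lee_fin -dfin; exact: le_diam.
have rsum n : \sum_(i < n | J i) rho i `^ s <= eta.
  apply: (@le_trans _ _ (\sum_(i < n) ((a `^ s)^-1 * dU i `^ s + eta / 2 ^+ i.+2))).
    rewrite big_mkcond /=; apply: ler_sum => i _.
    have p1 : 0 <= (a `^ s)^-1 * dU i `^ s by rewrite mulr_ge0 ?invr_ge0 ?powR_ge0.
    have p2 : 0 <= eta / 2 ^+ i.+2 by rewrite divr_ge0 ?exprn_ge0 // ltW.
    case: ifP => _; last by rewrite addr_ge0.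
    rewrite /rho; have [_|_] := leP (dU i / a) (eps i); last first.
      rewrite powRM ?invr_ge0 ?(ltW a0) // mulrC.
      by rewrite -powR_inv1 ?(ltW a0) // -powRrM mulN1r powRN lerDl.
    by apply: le_trans (epss i) _; rewrite lerDr.
  rewrite big_split /= -mulr_sumr.
  have h1 : (a `^ s)^-1 * \sum_(i < n) dU i `^ s <= eta / 2.
    by rewrite ler_pdivrMl ?powR_gt0 // dUsum.
  have h2 : \sum_(i < n) eta / 2 ^+ i.+2 <= eta / 2.
    suff -> : \sum_(i < n) eta / 2 ^+ i.+2 = eta / 2 - eta / 2 ^+ n.+1.
      by rewrite gerBl divr_ge0 ?exprn_ge0 // ltW.
    elim: n {h1} => [|n IH]; first by rewrite big_ord0 expr1 subrr.
    rewrite big_ord_recr /= IH (exprS _ n.+1) ; field.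
    by rewrite expf_neq0.
  lra.
have [F F0 hF] := pb J x rho Jrho cov rsum.
exact: (omega_count hk hGam hS hQI hgap F0 hF s0).
Qed.

End LowerBound.

Theorem theorem10p1 (R : realType) (k : nat) (hk : (2 <= k)%N)
  (Gam : set 'M[R]_k.+1) (hGam : SL_subgroup Gam)
  (hAnosov : projective_anosov Gam)
  (S : seq 'M[R]_k.+1) (hS : generates Gam S)
  (xi : set (nat -> 'M[R]_k.+1) -> flag R k)
  (hxi : boundary_embedding Gam S xi)
  (h : 'cV[R]_k.+1 -> 'M[R]_k.+1) (hh : riemannian_metric h) :
  (hilbert_critical_exponent Gam
     <= hausdorff_dim (riem_dist h) (xi1 xi @` gromov_boundary Gam S))%E /\
  (hausdorff_dim (riem_dist h) (xi1 xi @` gromov_boundary Gam S)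
     <= k%:R%:E)%E.
Proof.
split; last exact: hausdorff_dim_riem_le.
have [_ _ _ _ img] := hxi.
have -> : xi1 xi @` gromov_boundary Gam S = @flag_line R k @` limit_set Gam.
  by rewrite -img -image_comp.
by have := exponent_le_hausdorff_dim hh (ltnW hk) hGam hAnosov.
Qed.
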